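(* The maximum cardinality of a triangular ($3$-angular) line system in $\mathbb{R}^3$ is $12$. Up to isometry of line systems there are exactly two such configurations of $12$ lines. Both come from the matrix \[ C(\alpha,\beta,\gamma)=\begin{bmatrix} 1 & \alpha & \alpha & \alpha & \alpha & \beta & \beta & \beta & \beta & \gamma & \gamma & \gamma \\ \alpha & 1 & \beta & \gamma & \gamma & \alpha & \beta & \beta & \gamma & \alpha & \alpha & \beta \\ \alpha & \beta & 1 & \gamma & -\alpha & \gamma & -\beta & -\gamma & \alpha & \beta & -\beta & \alpha \\ \alpha & \gamma & \gamma & 1 & \beta & \beta & \alpha & \gamma & \beta & \alpha & \beta & \alpha \\ \alpha & \gamma & -\alpha & \beta & 1 & -\beta & \gamma & \alpha & -\gamma & \beta & \alpha & -\beta \\ \beta & \alpha & \gamma & \beta & -\beta & 1 & -\gamma & -\beta & \alpha & \gamma & -\alpha & \alpha \\ \beta & \beta & -\beta & \alpha & \gamma & -\gamma & 1 & \alpha & -\beta & \gamma & \alpha & -\alpha \\ \beta & \beta & -\gamma & \gamma & \alpha & -\beta & \alpha & 1 & -\alpha & \alpha & \gamma & -\beta \\ \beta & \gamma & \alpha & \beta & -\gamma & \alpha & -\beta & -\alpha & 1 & \alpha & -\beta & \gamma \\ \gamma & \alpha & \beta & \alpha & \beta & \gamma & \gamma & \alpha & \alpha & 1 & \beta & \beta \\ \gamma & \alpha & -\beta & \beta & \alpha & -\alpha & \alpha & \gamma & -\beta & \beta & 1 & -\gamma \\ \gamma & \beta & \alpha & \alpha & -\beta & \alpha & -\alpha &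 -\beta & \gamma & \beta & -\gamma & 1 \end{bmatrix}; \] namely, one has Gram matrix $C((-7+4\sqrt2)/17,(5+2\sqrt2)/17,(-3-8\sqrt2)/17)$ and consists of the main diagonals of the truncated cube, and the other has Gram matrix $C((-7-4\sqrt2)/17,(5-2\sqrt2)/17,(-3+8\sqrt2)/17)$ and consists of the main diagonals of the small rhombicuboctahedron.
   Context: For a finite set $\mathcal{X}\subset\mathbb{R}^d$ of unit vectors put $A(\mathcal{X}):=\{\langle x,x'\rangle\colon x\neq x';\ x,x'\in\mathcal{X}\}$. For $m\geq1$ the set $\mathcal{X}$ spans a system of $m$-angular lines (the lines through the origin in the directions $x\in\mathcal{X}$) if $-1\notin A(\mathcal{X})$ and $|\{\gamma^2\colon\gamma\in A(\mathcal{X})\}|\leq m$; ''triangular'' means $m=3$. The cardinality of the line system is $|\mathcal{X}|$. Line systems are considered up to applying an orthogonal transformation of $\mathbb{R}^d$ and replacing vectors $x\in\mathcal{X}$ by $-x$. The Gram matrix of $\mathcal{X}=\{x_1,\dots,x_n\}$ is $[\langle x_i,x_j\rangle]_{i,j=1}^n$ (it depends on the ordering and on the choice of signs). The main diagonals of an origin-centred, centrally symmetric polyhedron are the lines through pairs of antipodal vertices. *)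

(* Defs.v *)
From mathcomp Require Import all_boot all_order all_algebra all_fingroup finmap.
From mathcomp Require Import boolp classical_sets reals convex.
Set Implicit Arguments.
Unset Strict Implicit.
Unset Printing Implicit Defensive.
Import Order.TTheory GRing.Theory Num.Theory.
Local Open Scope ring_scope.

Section LineSystems.
Variables (R : realType) (d : nat).
Implicit Types (X Y : {fset 'rV[R]_d}) (u v : 'rV[R]_d).

Definition dotp u v : R := \sum_i u 0 i * v 0 i.

(* The set A(X) of inner products of distinct elements of X. *)
Definition inner_products X : {fset R} :=
  [fset dotp p.1 p.2 | p in [fset p in (X `*` X)%fset | p.1 != p.2]]%fset.

Definition angular_lines (m : nat) X : Prop :=
  [/\ forall x, x \in X -> dotp x x = 1,
      -1 \notin inner_products X
    & (#|` [fset a ^+ 2 | a in inner_products X]%fset| <= m)%N].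

(* Y is obtained from X by an orthogonal transformation (acting on row vectors
   from the right) followed by changing the signs of some of the vectors. *)
Definition isometric X Y : Prop :=
  exists (Q : 'M[R]_d) (s : 'rV[R]_d -> bool),
    Q *m Q^T = 1%:M /\ Y = [fset (-1) ^+ s x *: (x *m Q) | x in X]%fset.

Definition has_gram (n : nat) (G : 'M[R]_n) X : Prop :=
  exists x : 'I_n -> 'rV[R]_d,
    [/\ injective x, X =i codom x & G = \matrix_(i, j) dotp (x i) (x j)].

Definition lines X : set {vspace 'rV[R]_d} :=
  [set l | exists2 x, x \in X & l = <[x]>%VS]%classic.

Definition convex_hull (V : set 'rV[R]_d) : set 'rV[R]_d :=
  smallest (@convex_set R 'rV[R]_d) V.

(* The vertices of a polytope, as its extreme points. *)
Definition vertices (P : set 'rV[R]_d) : set 'rV[R]_d :=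
  [set p | P p /\ forall x y (t : R), P x -> P y -> 0 < t < 1 ->
           p = t *: x + (1 - t) *: y -> x = y]%classic.

(* For v != 0, the line through v and - v is the span of v. *)
Definition main_diagonals (P : set 'rV[R]_d) : set {vspace 'rV[R]_d} :=
  [set l | exists v, [/\ vertices P v, vertices P (- v) & l = <[v]>%VS]]%classic.

End LineSystems.

Section Polyhedra.
Variable R : realType.

Definition signed_permutations (a b c : R) : set 'rV[R]_3 :=
  [set v | exists (p : 'S_3) (s : 'I_3 -> bool),
           v = \row_j ((-1) ^+ s j * [:: a; b; c]`_(p j))]%classic.

(* Standard Cartesian coordinates of the vertices, for edge length
   2 * (sqrt 2 - 1), respectively 2. *)
Definition truncated_cube : set 'rV[R]_3 :=
  convex_hull (signed_permutations 1 1 (Num.sqrt 2 - 1)).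

Definition small_rhombicuboctahedron : set 'rV[R]_3 :=
  convex_hull (signed_permutations 1 1 (Num.sqrt 2 + 1)).

Definition Cmx (a b g : R) : 'M[R]_12 :=
  \matrix_(i, j) (nth [::] [::
    [:: 1; a; a; a; a; b; b; b; b; g; g; g];
    [:: a; 1; b; g; g; a; b; b; g; a; a; b];
    [:: a; b; 1; g; - a; g; - b; - g; a; b; - b; a];
    [:: a; g; g; 1; b; b; a; g; b; a; b; a];
    [:: a; g; - a; b; 1; - b; g; a; - g; b; a; - b];
    [:: b; a; g; b; - b; 1; - g; - b; a; g; - a; a];
    [:: b; b; - b; a; g; - g; 1; a; - b; g; a; - a];
    [:: b; b; - g; g; a; - b; a; 1; - a; a; g; - b];
    [:: b; g; a; b; - g; a; - b; - a; 1; a; - b; g];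
    [:: g; a; b; a; b; g; g; a; a; 1; b; b];
    [:: g; a; - b; b; a; - a; a; g; - b; b; 1; - g];
    [:: g; b; a; a; - b; a; - a; - b; g; b; - g; 1]] i)`_j.

End Polyhedra.

Arguments truncated_cube R : clear implicits.
Arguments small_rhombicuboctahedron R : clear implicits.

(* Main.v *)
Require Import Defs.
From HB Require Import structures.
From Stdlib Require Import ZArith.
From mathcomp Require Import all_boot all_order all_algebra all_fingroup finmap.
From mathcomp Require Import boolp classical_sets reals convex.
From mathcomp Require Import interval_inference zify ssrZ ring lra.
Set Implicit Arguments.
Unset Strict Implicit.
Unset Printing Implicit Defensive.
Import Order.TTheory GRing.Theory Num.Theory.
Local Open Scope ring_scope.

(** Let a system of at least 12 lines be given. Only the at most three values of |<x,x'>| matter;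
    colour the pairs among twelve of the lines by these values. One colour has at least 22 of the 66
    pairs, while a graph on 12 vertices without a 4-cycle has at most 21 edges ([C4free_absurd]), so
    some 4-cycle is monochromatic ([monochromatic_C4]). After sign changes its sides are <x1,x2> =
    <x2,x3> = <x3,x4> = a >= 0 and <x4,x1> = a (balanced) or -a (unbalanced), and its diagonals u =
    <x1,x3> and v = <x2,x4> lie among +-a, +-b, +-c. Four vectors of R^3 are dependent, which gives
    an equation between a, u and v ([balanced_eqn], [unbalanced_eqn]).

    Every other line is described by the four labels of its products with the cycle ([cycle_quads]),
    one of 648 quadruples. Expansion in a basis built from the cycle turns unit length, and the fact
    that two such vectors have product +-a, +-b or +-c, into polynomial conditions in a, b, c.
    Twelve lines thus give an 8-clique in a compatibility graph on the quadruples. A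
    branch-and-bound search over (b, c), with a confined by the equation of the cycle, refutes boxes
    by exact integer interval arithmetic ([search_sound], the lemmas [run_...]). Some regions of the
    parameter space, among them regions near the value 1, where lines would merge, are removed by
    geometric arguments ([not_excluded]: Welch's bound, mirror images, clusters of close lines), and
    so is the coplanar unbalanced cycle, whose labels do not determine a vector ([degenerate]).

    The search leaves only balanced cycles with equal diagonals u = v different from +-a. There the
    8-cliques are listed; each is maximal, so there are exactly 12 lines, and each carries the
    pattern of the matrix C ([special_cycle]). A few relations inside C force 17 alpha^2 + 14 alpha
    + 1 = 0 and express beta and gamma by alpha, hence the values of the theorem for a t with t^2 =
    2 ([Cmx_roots]). The Gram matrix determines the lines up to isometry ([gram_isometry],
    [isometric_system]). A model is given by the vectors with coordinates +-1, +-1, +-(t - 1) in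
    some order: t = sqrt 2 yields the truncated cube and t = - sqrt 2 the small rhombicuboctahedron
    ([system_lines]). The two differ in a product ([not_isometric]). *)

(** * Graphs on twelve vertices without 4-cycles *)

Section FourCycleFree.
Import mathcomp.boot.fintype mathcomp.boot.finset.
Local Open Scope nat_scope.
Variables (T : finType) (e : rel T).
Hypotheses (e_sym : symmetric e) (e_irr : irreflexive e).
Implicit Types (A B S : {set T}) (u v w : T).

Let N v := [set w | e v w].
Hypothesis C4free : forall u v, u != v -> #|N u :&: N v| <= 1.

(** Counts ordered adjacent pairs, so [incidences S S] is twice the number of edges inside [S]. *)
Definition incidences A B := \sum_(a in A) #|N a :&: B|.

Lemma incidencesE A B : incidences A B = \sum_(a in A) \sum_(b in B) e a b.
Proof.
apply: eq_bigr => a _; rewrite -sum1_card big_mkcond [RHS]big_mkcond /=.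
by apply: eq_bigr => b _; rewrite !inE andbC; case: (b \in B); case: (e a b).
Qed.

Lemma incidencesC A B : incidences A B = incidences B A.
Proof.
by rewrite !incidencesE exchange_big; apply: eq_bigr => a _; apply: eq_bigr => b _; rewrite e_sym.
Qed.

Lemma incidencesUr A B S : [disjoint B & S] ->
  incidences A (B :|: S) = incidences A B + incidences A S.
Proof.
move=> BS; rewrite /incidences -big_split; apply: eq_bigr => a _ /=.
by rewrite setIUr cardsU setIACA (disjoint_setI0 BS) setI0 cards0 subn0.
Qed.

Lemma incidencesUl A B S : [disjoint B & S] ->
  incidences (B :|: S) A = incidences B A + incidences S A.
Proof. by move=> BS; rewrite !(incidencesC _ A) incidencesUr. Qed.

Lemma handshake S : ~~ odd (incidences S S).
Proof.
rewrite incidencesE pair_big_dep /=.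
pose swap (p : T * T) := (p.2, p.1); have swapK : cancel swap swap by case.
pose lt (p : T * T) := enum_rank p.1 < enum_rank p.2.
rewrite (bigID lt) /= [X in _ + X](reindex_inj (can_inj swapK)) /=.
set s := \sum_(i | _) _; rewrite [X in _ + X](_ : _ = s) ?addnn ?odd_double //.
rewrite [LHS]big_mkcond [RHS]big_mkcond; apply: eq_bigr => -[x y] _ /=; rewrite /lt /= e_sym.
rewrite -leqNgt leq_eqVlt [(y \in S) && _]andbC.
case: (eqVneq x y) => [->|xy]; first by rewrite e_irr; do 2!case: ifP.
by have /negPf-> : val (enum_rank x) != enum_rank y by apply: contraNneq xy => /val_inj/enum_rank_inj->.
Qed.

(** Without 4-cycles a neighbour of v has at most one neighbour inside N v. The sum is even by
    [handshake], so an odd neighbourhood loses one. *)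
Lemma incidences_nbh v S :
  odd #|N v :&: S| + incidences (N v :&: S) (N v :&: S) <= #|N v :&: S|.
Proof.
have le : incidences (N v :&: S) (N v :&: S) <= #|N v :&: S|.
  rewrite -[leqRHS]muln1 -sum_nat_const leq_sum // => u; rewrite !inE => /andP[vu _].
  apply: leq_trans (C4free (_ : u != v)); last by apply: contraTneq vu => ->; rewrite e_irr.
  by apply: subset_leq_card; rewrite setISS // subsetIl.
by have := handshake (N v :&: S); move: le; lia.
Qed.

Lemma incidences_far v S : v \notin S -> [disjoint N v & S] -> incidences S (N v) <= #|S|.
Proof.
move=> vS _; rewrite -[leqRHS]muln1 -sum_nat_const leq_sum // => u uS.
by apply: C4free; apply: contraNneq vS => <-.
Qed.

(** Count walks of length two from v inside S. They return to v, end in N v or end elsewhere, and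
    the last two kinds are few without 4-cycles; summing over v bounds the sum of the d(w)^2. For
    |S| = 12 the result still allows 22 edges, hence the finer analysis below. *)
Lemma incidences_bound S : 5 * incidences S S <= #|S| ^ 2 + 7 * #|S|.
Proof.
pose d v := #|N v :&: S|.
have walk v : v \in S -> \sum_(w in N v :&: S) d w + odd (d v) <= d v + #|S|.-1.
  move=> vS; rewrite -[\sum_(w in _) _]/(incidences (N v :&: S) S) -(setD1K vS).
  rewrite incidencesUr ?disjoints1 ?setD11 //.
  have -> : incidences (N v :&: (v |: S :\ v)) [set v] = d v.
    rewrite setD1K // incidencesC /incidences big_set1 /d; congr #|pred_of_set _|.
    by apply/setP => w; rewrite !inE andbA andbb.
  rewrite setD1K //.
  have Ssplit : S :\ v = (N v :&: S) :|: (S :\ v :\: N v).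
    apply/setP => w; rewrite !inE; case: (eqVneq w v) => [->|_] /=; first by rewrite e_irr andbF.
    by case: (e v w); rewrite ?orbF ?andbT.
  have dj : [disjoint N v :&: S & S :\ v :\: N v].
    by rewrite -setI_eq0; apply/eqP/setP => w; rewrite !inE; case: (e v w); rewrite ?andbF.
  have cS : #|S| = (d v + #|S :\ v :\: N v|).+1.
    by rewrite (cardsD1 v) vS [in LHS]Ssplit cardsU (disjoint_setI0 dj) cards0 subn0.
  rewrite [X in incidences _ X]Ssplit incidencesUr //; have := incidences_nbh v S.
  have : incidences (N v :&: S) (S :\ v :\: N v) <= #|S :\ v :\: N v|.
    rewrite incidencesC; apply: leq_trans (incidences_far (v := v) _ _).
    - by rewrite leq_sum // => u _; rewrite subset_leq_card // setIS // subsetIl.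
    - by rewrite !inE eqxx andbF.
    - by rewrite -setI_eq0; apply/eqP/setP => w; rewrite !inE; case: (e v w); rewrite ?andbF.
  by rewrite -/(d v) {}cS; case: (odd (d v)) => /=; lia.
have sq : \sum_(v in S) \sum_(w in N v :&: S) d w = \sum_(w in S) d w * d w.
  transitivity (\sum_(v in S) \sum_(w in S) e v w * d w).
    apply: eq_bigr => v _; rewrite big_mkcond [RHS]big_mkcond; apply: eq_bigr => w _.
    by rewrite !inE andbC; case: (w \in S); case: (e v w); rewrite ?mul1n.
  rewrite exchange_big; apply: eq_bigr => w _; rewrite -big_distrl /=; congr (_ * _).
  rewrite /d -sum1_card big_mkcond [RHS]big_mkcond; apply: eq_bigr => v _.
  by rewrite !inE e_sym andbC; case: (v \in S); case: (e w v).
have tot : \sum_(w in S) (d w * d w + odd (d w)) <= \sum_(w in S) (d w + #|S|.-1).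
  by rewrite big_split -sq -big_split leq_sum.
(* The linear bound 6 d <= 8 + d^2 + [d odd] is an equality exactly for d = 2, 3, 4. *)
have low : 6 * \sum_(w in S) d w <= #|S| * 8 + \sum_(w in S) (d w * d w + odd (d w)).
  rewrite big_distrr -sum_nat_const -big_split.
  by apply: leq_sum => w _ /=; case: (d w) => [|[|[|[|[|n]]]]] //; nia.
have := leq_trans low (leq_add (leqnn _) tot); rewrite big_split sum_nat_const /=.
by rewrite -/(incidences S S); case: #|S| => [|n] /=; nia.
Qed.

Let d v := #|N v|.
Let Z v := ~: (v |: N v).

Lemma nbhP u v : (u \in N v) = e v u. Proof. by rewrite inE. Qed.

Lemma nbh_common v w : w \in N v -> #|N w :&: N v| <= 1.
Proof. by rewrite inE => vw; apply: C4free; apply: contraTneq vw => ->; rewrite e_irr. Qed.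

Lemma nbh_self v : incidences (N v) (N v) <= d v - odd (d v).
Proof. by have := incidences_nbh v setT; rewrite setIT -/(d v); lia. Qed.

Lemma incidences1 v : incidences [set v] setT = d v.
Proof. by rewrite /incidences big_set1 setIT. Qed.

Lemma decomposition v A : incidences A setT =
  incidences A [set v] + incidences A (N v) + incidences A (Z v).
Proof.
have vN : [disjoint [set v] & N v] by rewrite disjoints1 inE e_irr.
by rewrite -incidencesUr // -incidencesUr ?disjoints_subset ?setCK // setUCr.
Qed.

Lemma decompositionN v : incidences (N v) setT = d v + incidences (N v) (N v) + incidences (N v) (Z v).
Proof.
rewrite (decomposition v) incidencesC /incidences big_set1 setIid; congr (_ + _ + _).
Qed.

Lemma decompositionZ v : incidences (Z v) setT = incidences (N v) (Z v) + incidences (Z v) (Z v).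
Proof.
rewrite (decomposition v) incidencesC [incidences (N v) _]incidencesC; congr (_ + _).
rewrite [X in X + _](_ : _ = 0) // /incidences big_set1; apply/eqP.
by rewrite cards_eq0; apply/eqP/setP => w; rewrite !inE; case: (e v w); rewrite ?orbT.
Qed.

Lemma total_decomposition v : incidences setT setT =
  d v + (d v + incidences (N v) (N v) + incidences (N v) (Z v))
  + (incidences (N v) (Z v) + incidences (Z v) (Z v)).
Proof.
rewrite -decompositionZ -decompositionN -(incidences1 v) [LHS](decomposition v).
by rewrite !(incidencesC setT).
Qed.

Lemma incidences_nbh_far v : incidences (N v) (Z v) <= #|Z v|.
Proof.
rewrite incidencesC; apply: (incidences_far (v := v)); first by rewrite !inE eqxx.
by rewrite disjoint_sym disjoints_subset setCS subsetUr.
Qed.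

Hypotheses (T12 : #|T| = 12) (edges : 44 <= incidences setT setT).

Lemma card_far v : #|Z v| = 11 - d v.
Proof. by have := cardsC (v |: N v); rewrite cardsU1 inE e_irr T12 -/(Z v) -/(d v) /=; lia. Qed.

(** For degree k >= 4 the pieces of [total_decomposition] are at most k - [k odd], 11 - k and, on
    the 11 - k remaining vertices, the even part of [incidences_bound]. Their total reaches 44 only
    for k = 4, and then every bound is attained. *)
Lemma incidences_le44 v : 4 <= d v -> [/\ d v = 4, incidences (N v) (N v) = 4
  & incidences (N v) (Z v) = 7].
Proof.
move=> d4; have d11 : d v <= 11.
  by have := cardsC (v |: N v); rewrite cardsU1 inE e_irr T12 -/(d v) /=; lia.
have := edges; rewrite (total_decomposition v).
have := nbh_self v; have := incidences_nbh_far v; have := incidences_bound (Z v).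
have := handshake (Z v); rewrite card_far.
move: d4 d11; move: (d v) (incidences _ _) (incidences _ _) (incidences _ _) => k x y z.
by case: k => [|[|[|[|[|[|[|[|[|[|[|[|k]]]]]]]]]]]] //= *; split; lia.
Qed.

Let F := [set v | d v == 4].
Let H := [set v | d v == 3].

Lemma deg_le4 v : d v <= 4.
Proof. by rewrite leqNgt; apply/negP => h; have [dv _ _] := incidences_le44 (ltnW h); rewrite dv in h. Qed.

(** The degrees in N v sum to 4 + 4 + 7 = 15, one less than the maximum 16. *)
Lemma four_nbh v : v \in F -> #|N v :&: H| = 1 /\ N v \subset F :|: H.
Proof.
rewrite inE => /eqP dv; have [_ NN NZ] := incidences_le44 (eq_leq (esym dv)).
have : \sum_(w in N v) d w = 15.
  rewrite -[RHS]/(4 + 4 + 7) -{1}dv -{1}NN -NZ -decompositionN.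
  by apply: eq_bigr => w _; rewrite setIT.
have tot : \sum_(w in N v) d w + \sum_(w in N v) (4 - d w) = 16.
  rewrite -big_split (eq_bigr (fun=> 4)) => [|w _]; last by have := deg_le4 w; rewrite /=; lia.
  by rewrite sum_nat_const -/(d v) dv.
move=> h15; have {h15 tot} : \sum_(w in N v) (4 - d w) = 1 by lia.
have cardNH : #|N v :&: H| = \sum_(w in N v) (w \in H).
  by rewrite -sum1_card big_mkcond [RHS]big_mkcond; apply: eq_bigr => w _; rewrite inE; do 2!case: (_ \in _).
move=> one; have sub : N v \subset F :|: H.
  apply/subsetP => w wN; rewrite !inE; move: one; rewrite (bigD1 w) //=.
  by have := deg_le4 w; lia.
split=> //; rewrite cardNH -[RHS]one; apply: eq_bigr => w /(subsetP sub); rewrite !inE.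
by case/orP=> /eqP->.
Qed.

(** Four terms that are at most 1 and sum to 4 are all equal to 1. *)
Lemma four_common v u : v \in F -> u \in N v -> #|N u :&: N v| = 1.
Proof.
rewrite inE => /eqP dv uN; have [_ NN _] := incidences_le44 (eq_leq (esym dv)).
apply/eqP; rewrite eqn_leq nbh_common //=; move: NN; rewrite /incidences (bigD1 u) //= => NN.
have : \sum_(w in N v | w != u) #|N w :&: N v| <= \sum_(w in N v | w != u) 1.
  by apply: leq_sum => w /andP[wN _]; exact: nbh_common.
rewrite sum1_card (_ : #|_| = 3); first by lia.
have := cardsD1 u (N v); rewrite uN -/(d v) dv => -[->]; apply: eq_card => w.
by rewrite in_setD1 andbC unfold_in.
Qed.

(* A vertex of degree 4 lies in two triangles, one of which contains its
   unique neighbour of degree 3. *)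
Lemma mixed_triangle v w : v \in F -> w \in N v :&: H -> N w :&: N v \subset F.
Proof.
move=> vF; have [/eqP/cards1P[w' E] sub] := four_nbh vF; rewrite E inE => /eqP->.
apply/subsetP => t; rewrite in_setI => /andP[tw tv].
move: (subsetP sub _ tv); rewrite in_setU => /orP[//|tH].
have : t \in N v :&: H by rewrite in_setI tv.
by rewrite E inE => /eqP tw'; move: tw; rewrite tw' inE e_irr.
Qed.

(** Adjacency matches the degree-4 neighbours of w perfectly ([four_common], [mixed_triangle]), so
    their number is even, and it is at most 3. *)
Lemma three_nbh w : w \in H -> #|N w :&: F| <= 2.
Proof.
move=> wH; have le3 : #|N w :&: F| <= 3.
  by apply: leq_trans (subset_leq_card (subsetIl _ _)) _; move: wH; rewrite inE => /eqP dw; rewrite -/(d w) dw.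
suff : ~~ odd #|N w :&: F| by move: le3; case: #|_| => [|[|[|[|]]]].
have <- : incidences (N w :&: F) (N w :&: F) = #|N w :&: F|; last exact: handshake.
rewrite -sum1_card; apply: eq_bigr => v; rewrite in_setI => /andP[vw vF].
have wv : w \in N v by rewrite inE e_sym -nbhP.
rewrite -(four_common vF wv) setIA [N v :&: _]setIC; congr #|pred_of_set _|.
by apply/setIidPl; apply: mixed_triangle => //; rewrite in_setI wv.
Qed.

(** A degree-4 vertex has one neighbour of degree 3, and a degree-3 vertex at most two of degree 4,
    so |F| <= 2 |H|. Together with 2 |F| + |H| >= 44 - 24 and |F| + |H| <= 12 this leaves |F| =
    8. *)
Lemma card_four : #|F| = 8.
Proof.
have FH : #|F| = incidences F H.
  by rewrite -sum1_card; apply: eq_bigr => v /four_nbh[].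
have HF : incidences H F <= 2 * #|H|.
  by rewrite mulnC -sum_nat_const; apply: leq_sum => w; exact: three_nbh.
have dj : F :&: H = set0 by apply/setP => v; rewrite !inE; case: eqP => // ->.
have cFH := cardsU F H; rewrite dj cards0 subn0 in cFH.
have cC := cardsC (F :|: H); rewrite T12 in cC.
have tot : incidences setT setT <= 4 * #|F| + 3 * #|H| + 2 * #|~: (F :|: H)|.
  have le A m : (forall v, v \in A -> d v <= m) -> incidences A setT <= m * #|A|.
    by move=> h; rewrite mulnC -sum_nat_const leq_sum // => v vA; rewrite setIT; exact: h.
  rewrite -[X in incidences X _](setUCr (F :|: H)) !incidencesUl -?setI_eq0 ?setICr ?dj //.
  rewrite !leq_add // le // => v; rewrite !inE; try by move/eqP->.
  by have := deg_le4 v; lia.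
have := edges; move: HF; rewrite incidencesC -FH; lia.
Qed.

(* The triangles on vertices of degree 4 partition these vertices. *)
Lemma C4free_absurd : False.
Proof.
(* [P v] holds the two neighbours that form with v the triangle inside [F]; the other triangle at v
   contains its neighbour of degree 3. *)
pose P v := [set u in N v :&: F | N u :&: N v \subset F].
have cP v : v \in F -> #|P v| = 2.
  move=> vF; have [/eqP/cards1P[w Ew] sub] := four_nbh vF.
  have wN : w \in N v :&: H by rewrite Ew inE.
  have [wv wH] := setIP wN.
  have /eqP/cards1P[u0 Eu] := four_common vF wv.
  have [u0w u0v] : u0 \in N w /\ u0 \in N v by apply/setIP; rewrite Eu inE.
  have u0F : u0 \in F by apply: (subsetP (mixed_triangle vF wN)); rewrite Eu inE.
  have -> : P v = (N v :&: F) :\ u0.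
    apply/setP => u; rewrite [in LHS]inE in_setD1 [in RHS]andbC; case uNF: (u \in N v :&: F) => //=.
    have [uN uF] := setIP uNF.
    case: eqVneq => [->|uu0] /=.
      apply/negbTE/subsetPn; exists w; first by rewrite in_setI wv inE e_sym -nbhP u0w.
      by move: wH; rewrite !inE => /eqP->.
    apply/subsetP => t tu; have [tN tv] := setIP tu.
    move: (subsetP sub _ tv); rewrite in_setU => /orP[//|tH].
    have tw : t = w by apply/set1P; rewrite -Ew in_setI tv.
    case/negP: uu0; rewrite -in_set1 -Eu in_setI uN andbT inE -tw e_sym -nbhP; exact: tN.
  have := cardsD1 u0 (N v :&: F); rewrite in_setI u0v u0F /=.
  have cN : #|N v| = #|N v :&: F| + #|N v :&: H|.
    rewrite -cardsUI -setIUr setIACA (setIidPl sub) [F :&: H](_ : _ = set0) ?setI0 ?cards0 ?addn0 //.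
    by apply/setP => x; rewrite !inE; case: eqP => // ->.
  move: cN; rewrite Ew cards1; move: vF; rewrite inE => /eqP; rewrite /d => ->; lia.
have PP v u : v \in F -> u \in P v -> [/\ u \in F, v \in P u & P v \subset u |: P u].
  move=> vF; rewrite [in X in X -> _]inE => /andP[/setIP[uN uF] sub].
  have /eqP/cards1P[t Et] := four_common vF uN.
  have tut : t \in N u :&: N v by rewrite Et inE.
  have [tu tv] := setIP tut; have tF := subsetP sub _ tut.
  have vu : v \in N u by rewrite inE e_sym -nbhP.
  have uP : u \in P v by rewrite inE in_setI uN uF.
  have tP : t \in P v.
    rewrite inE in_setI tv tF /=; have tN : t \in N v := tv.
    have /eqP/cards1P[t' Et'] := four_common vF tN.
    have : u \in N t :&: N v by rewrite in_setI uN inE e_sym -nbhP tu.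
    by rewrite Et' inE => /eqP<-; apply/subsetP => x /set1P->.
  have ut : u != t by apply: contraTneq tu => <-; rewrite inE e_irr.
  have EP : P v = [set u; t].
    apply/esym/eqP; rewrite eqEcard cP // cards2 ut andbT.
    by apply/subsetP => x /set2P[]->.
  have vPu : v \in P u.
    by rewrite inE in_setI vu vF setIC /=.
  split=> //; rewrite EP; apply/subsetP => x /set2P[]->; first exact: setU11.
  apply/setU1P; right; rewrite inE in_setI tu tF /=.
  have /eqP/cards1P[t' Et'] := four_common uF tu.
  have : v \in N t :&: N u by rewrite in_setI vu inE e_sym -nbhP tv.
  by rewrite Et' inE => /eqP<-; apply/subsetP => y /set1P->.
pose B v := v |: P v.
have cB v : v \in F -> #|B v| = 3.
  by move=> vF; rewrite /B cardsU1 cP // !inE e_irr.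
have BE v u : v \in F -> u \in B v -> B u = B v.
  move=> vF; rewrite in_setU1 => /predU1P[-> //|uP]; have [uF vPu sub] := PP _ _ vF uP.
  apply/esym/eqP; rewrite eqEcard !cB // leqnn andbT /B subUset sub andbT sub1set.
  by rewrite in_setU1 vPu orbT.
have BF v : v \in F -> B v \subset F.
  by move=> vF; apply/subsetP => u; rewrite in_setU1 => /predU1P[-> //|/(PP _ _ vF)[]].
have part : partition [set B v | v in F] F.
  apply/and3P; split.
  - rewrite eqEsubset; apply/andP; split.
      by apply/bigcupsP => _ /imsetP[v vF ->]; exact: BF.
    apply/subsetP => v vF; apply/bigcupP; exists (B v); first exact: imset_f.
    by rewrite in_setU1 eqxx.
  - apply/trivIsetP => _ _ /imsetP[v vF ->] /imsetP[u uF ->] ne.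
    rewrite -setI_eq0; apply: contraNT ne => /set0Pn[x /setIP[xv xu]].
    by rewrite -(BE _ _ vF xv) (BE _ _ uF xu).
  - by apply/imsetP => -[v _ /setP/(_ v)]; rewrite in_setU1 eqxx inE.
(* Blocks of three cannot partition eight vertices. *)
have := card_uniform_partition (n := 3) _ part; rewrite card_four => h.
have /h : {in [set B v | v in F], forall A, #|A| = 3} by move=> _ /imsetP[v vF ->]; exact: cB.
by lia.
Qed.

End FourCycleFree.

(** * A monochromatic 4-cycle in three colours *)

Section Monochromatic.
Import mathcomp.boot.fintype mathcomp.boot.finset.
Local Open Scope nat_scope.

(** Of the 132 ordered pairs of distinct vertices some colour has at least 44. By [C4free_absurd]
    two vertices then have two common neighbours in that colour. *)
Lemma monochromatic_C4 (T : finType) (k : T -> T -> 'I_3) : (forall x y, k x y = k y x) ->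
  #|T| = 12 -> exists x1 x2 x3 x4 (i : 'I_3), [/\ uniq [:: x1; x2; x3; x4],
    k x1 x2 = i, k x2 x3 = i, k x3 x4 = i & k x4 x1 = i].
Proof.
move=> ksym T12; pose e i := [rel x y | (x != y) && (k x y == i)].
pose inc i := \sum_(x in [set: T]) #|[set y | e i x y] :&: setT|.
have tot : \sum_i inc i = 132.
  rewrite exchange_big /= (eq_bigr (fun=> 11)) ?sum_nat_const ?cardsT ?T12 // => x _.
  rewrite (eq_bigr (fun i => \sum_(y | y != x) (k x y == i))) => [|i _]; last first.
    rewrite setIT -sum1_card big_mkcond [RHS]big_mkcond; apply: eq_bigr => y _.
    by rewrite inE /= eq_sym; case: eqP => //= _; case: eqP.
  rewrite exchange_big /= (eq_bigr (fun=> 1)) => [|y _]; last first.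
    by rewrite (bigD1 (k x y)) //= eqxx big1 // => i; rewrite eq_sym => /negPf->.
  rewrite sum1_card; transitivity #|predC1 x|; last by rewrite cardC1 T12.
  by apply: eq_card => y; rewrite !inE.
have [i hi] : exists i, 44 <= inc i.
  apply/existsP; rewrite -[X in is_true X]negbK negb_exists; apply/negP => /forallP h.
  have : \sum_i inc i <= \sum_(i < 3) 43.
    by apply: leq_sum => i _; have := h i; rewrite -ltnNge ltnS.
  by rewrite tot sum_nat_const card_ord.
apply: contrapT => no; apply: (@C4free_absurd T (e i)) => //.
- by move=> x y /=; rewrite eq_sym ksym.
- by move=> x /=; rewrite eqxx.
move=> u v uv; rewrite leqNgt; apply/negP => /card_gt1P[x [y [/setIP[xu xv] /setIP[yu yv] xy]]].
move: xu xv yu yv; rewrite !inE => /andP[ux /eqP kux] /andP[vx /eqP kvx] /andP[uy /eqP kuy] /andP[vy /eqP kvy].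
apply: no; exists u, x, v, y, i; split=> //; rewrite ?[k x v]ksym ?[k y u]ksym //.
by rewrite /= !inE !negb_or ux uv uy xy eq_sym vx vy.
Qed.

End Monochromatic.

(* Interval arithmetic with integer endpoints *)
Delimit Scope Z_scope with BZ.

(** At scale s = 2^k an interval encloses s times a real number. Integer arithmetic is exact,
    products carry scale s^2, and only [ishr] rounds. *)
Definition itv : Type := (Z * Z)%type.

Section IntervalOperations.
Local Open Scope Z_scope.
Implicit Types x y : itv.

Definition iadd x y : itv := let (a, b) := x in let (c, d) := y in (a + c, b + d).
Definition iopp x : itv := let (a, b) := x in (- b, - a).
Definition isub x y : itv := let (a, b) := x in let (c, d) := y in (a - d, b - c).
Definition idbl x : itv := let (a, b) := x in (Z.double a, Z.double b).
Definition imul x y : itv :=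
  let (a, b) := x in let (c, d) := y in
  if 0 <=? a then
    if 0 <=? c then (a * c, b * d)
    else if d <=? 0 then (b * c, a * d) else (b * c, b * d)
  else if b <=? 0 then
    if 0 <=? c then (a * d, b * c)
    else if d <=? 0 then (b * d, a * c) else (a * d, a * c)
  else
    if 0 <=? c then (a * d, b * d)
    else if d <=? 0 then (b * c, a * c)
    else (Z.min (a * d) (b * c), Z.max (a * c) (b * d)).
Definition isqr x : itv :=
  let (a, b) := x in
  if 0 <=? a then (a * a, b * b)
  else if b <=? 0 then (b * b, a * a) else (0, Z.max (a * a) (b * b)).
Definition iabs x : itv :=
  let (a, b) := x in
  if 0 <=? a then x else if b <=? 0 then (- b, - a) else (0, Z.max (- a) b).
(** Divides by 2^k with outward rounding: [Z.shiftr] rounds down, and the two negations make it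
    round the upper end up. *)
Definition ishr (k : Z) x : itv :=
  let (a, b) := x in (Z.shiftr a k, - Z.shiftr (- b) k).
(** The refutation test: two enclosures of the same real number must intersect. *)
Definition imeet x y : bool :=
  let (a, b) := x in let (c, d) := y in (a <=? d) && (c <=? b).

End IntervalOperations.

Section IntervalSoundness.
Variable R : realFieldType.
Implicit Types (x y : R) (I J : itv) (a b : Z).

Definition zr (a : Z) : R := (int_of_Z a)%:~R.

Lemma zrD a b : zr (a + b)%BZ = zr a + zr b.
Proof. by rewrite /zr -intrD; congr (_ %:~R); lia. Qed.

Lemma zrM a b : zr (a * b)%BZ = zr a * zr b.
Proof. by rewrite /zr -intrM; congr (_ %:~R); lia. Qed.

Lemma zrN a : zr (- a)%BZ = - zr a.
Proof. by rewrite /zr -intrN; congr (_ %:~R); lia. Qed.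

Lemma zrB a b : zr (a - b)%BZ = zr a - zr b.
Proof. by rewrite -zrN -zrD. Qed.

Lemma zr_double a : zr (Z.double a) = 2 * zr a.
Proof. by rewrite Z.double_spec zrM. Qed.

Lemma zr_le a b : (zr a <= zr b) = (a <=? b)%BZ.
Proof. by rewrite ler_int; lia. Qed.

Lemma zr_lt a b : (zr a < zr b) = (a <? b)%BZ.
Proof. by rewrite ltr_int; lia. Qed.

Lemma zr_min a b : zr (Z.min a b) = Num.min (zr a) (zr b).
Proof.
by case: (Z.min_spec a b) => -[h ->]; [rewrite min_l|rewrite min_r]; rewrite ?zr_le //; lia.
Qed.

Lemma zr_max a b : zr (Z.max a b) = Num.max (zr a) (zr b).
Proof.
by case: (Z.max_spec a b) => -[h ->]; [rewrite max_r|rewrite max_l]; rewrite ?zr_le //; lia.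
Qed.

Definition inI I x : Prop := zr I.1 <= x /\ x <= zr I.2.

Lemma inI_add I J x y : inI I x -> inI J y -> inI (iadd I J) (x + y).
Proof. by case: I J => [a b] [c d] [/= ? ?] [/= ? ?]; split; rewrite /= zrD lerD. Qed.

Lemma inI_opp I x : inI I x -> inI (iopp I) (- x).
Proof. by case: I => [a b] [/= ? ?]; split; rewrite /= zrN lerN2. Qed.

Lemma inI_sub I J x y : inI I x -> inI J y -> inI (isub I J) (x - y).
Proof. by case: I J => [a b] [c d] [/= ? ?] [/= ? ?]; split; rewrite /= zrB lerB. Qed.

Lemma inI_dbl I x : inI I x -> inI (idbl I) (2 * x).
Proof. by case: I => [a b] [/= ? ?]; split; rewrite /= zr_double; lra. Qed.

Lemma inI_mul I J x y : inI I x -> inI J y -> inI (imul I J) (x * y).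
Proof.
case: I J => [a b] [c d] [/= ax xb] [/= cy yd].
have zr0 : zr 0 = 0 by [].
have h e : (0 <=? e)%BZ = (0 <= zr e) by rewrite -zr_le.
have h' e : (e <=? 0)%BZ = (zr e <= 0) by rewrite -zr_le.
rewrite /imul !h !h' /inI.
case: (lerP 0 (zr a)) => a0; first case: (lerP 0 (zr c)) => c0.
- by rewrite /= !zrM; split; nra.
- by case: (lerP (zr d) 0) => d0; rewrite /= !zrM; split; nra.
case: (lerP (zr b) 0) => b0; case: (lerP 0 (zr c)) => c0.
- by rewrite /= !zrM; split; nra.
- by case: (lerP (zr d) 0) => d0; rewrite /= !zrM; split; nra.
- by rewrite /= !zrM; split; nra.
case: (lerP (zr d) 0) => d0; rewrite /= ?zr_min ?zr_max !zrM; first by split; nra.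
rewrite ge_min le_max; case: (lerP 0 x) => x0; case: (lerP 0 y) => y0;
 split; apply/orP; first [by left; nra | by right; nra].
Qed.

Lemma inI_sqr I x : inI I x -> inI (isqr I) (x ^+ 2).
Proof.
case: I => [a b] [/= ax xb].
have h e : (0 <=? e)%BZ = (0 <= zr e) by rewrite -zr_le.
have h' e : (e <=? 0)%BZ = (zr e <= 0) by rewrite -zr_le.
rewrite !h !h' /inI.
case: (lerP 0 (zr a)) => a0; first by rewrite /= !zrM; split; nra.
case: (lerP (zr b) 0) => b0; first by rewrite /= !zrM; split; nra.
rewrite /= zr_max !zrM le_max; split; first exact: sqr_ge0.
by case: (lerP 0 x) => x0; apply/orP; [right|left]; nra.
Qed.

Lemma inI_abs I x : inI I x -> inI (iabs I) `|x|.
Proof.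
case: I => [a b] [/= ax xb].
have h e : (0 <=? e)%BZ = (0 <= zr e) by rewrite -zr_le.
have h' e : (e <=? 0)%BZ = (zr e <= 0) by rewrite -zr_le.
rewrite !h !h' /inI.
case: (lerP 0 (zr a)) => a0; first by rewrite /= ger0_norm; [split|lra].
case: (lerP (zr b) 0) => b0; first by rewrite /= !zrN ler0_norm; [split|]; lra.
rewrite /= zr_max !zrN le_max; split; first exact: normr_ge0.
by case: (ger0P x) => x0; apply/orP; [right|left]; lra.
Qed.

Lemma inI_shr k s I x : (0 <= k)%BZ -> s = (2 ^ k)%BZ -> inI I x -> inI (ishr k I) (x / zr s).
Proof.
move=> k0 ->; have s0 : 0 < zr (2 ^ k) by rewrite (zr_lt 0); lia.
have hs a : zr (Z.shiftr a k) * zr (2 ^ k) <= zr a.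
  by rewrite -zrM zr_le Z.shiftr_div_pow2 //; have := Z.mul_div_le a (2 ^ k); lia.
case: I => [a b] [/= ax xb]; split; rewrite /= ?zrN.
  by rewrite ler_pdivlMr //; apply: le_trans (hs _) _.
by rewrite ler_pdivrMr // mulNr lerNr; apply: le_trans (hs _) _; rewrite zrN lerN2.
Qed.

Lemma inI_meet I J x y : inI I x -> inI J y -> x = y -> imeet I J.
Proof.
case: I J => [a b] [c d] [/= ax xb] [/= cy yd] xy; subst y.
by rewrite -!zr_le (le_trans ax) //= (le_trans cy).
Qed.

Lemma inI0 : inI (0, 0)%BZ 0. Proof. by []. Qed.

End IntervalSoundness.

(** * Symbolic labels and their tables of values *)

(* A label stands for one of the signed values +-a, +-b, +-c. *)
Inductive label := La | Na | Lb | Nb | Lc | Nc.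

Definition labels := [:: La; Na; Lb; Nb; Lc; Nc].

Definition label_code l : nat :=
  match l with
  | La => 0 | Na => 1 | Lb => 2
  | Nb => 3 | Lc => 4 | Nc => 5
  end.

Lemma label_codeK : cancel label_code (nth La labels). Proof. by case. Qed.

HB.instance Definition _ := Equality.copy label (can_type label_codeK).

Lemma mem_labels l : l \in labels. Proof. by case: l. Qed.

Definition lopp l :=
  match l with La => Na | Na => La | Lb => Nb | Nb => Lb | Lc => Nc | Nc => Lc end.

Notation quad := (label * label * label * label)%type.

(* Sums of two labels, up to sign: 2a, 2b, 2c, a + b, a - b, ... *)
Inductive pairsum := W2a | W2b | W2c | Wab | Wab' | Wac | Wac' | Wbc | Wbc'.
Inductive spairsum := WZ | WP of pairsum | WN of pairsum.

Definition wsum l m :=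
  match l, m with
  | La, La => WP W2a | La, Na => WZ | La, Lb => WP Wab
  | La, Nb => WP Wab' | La, Lc => WP Wac | La, Nc => WP Wac'
  | Na, La => WZ | Na, Na => WN W2a | Na, Lb => WN Wab'
  | Na, Nb => WN Wab | Na, Lc => WN Wac' | Na, Nc => WN Wac
  | Lb, La => WP Wab | Lb, Na => WN Wab' | Lb, Lb => WP W2b
  | Lb, Nb => WZ | Lb, Lc => WP Wbc | Lb, Nc => WP Wbc'
  | Nb, La => WP Wab' | Nb, Na => WN Wab | Nb, Lb => WZ
  | Nb, Nb => WN W2b | Nb, Lc => WN Wbc' | Nb, Nc => WN Wbc
  | Lc, La => WP Wac | Lc, Na => WN Wac' | Lc, Lb => WP Wbc
  | Lc, Nb => WN Wbc' | Lc, Lc => WP W2c | Lc, Nc => WZ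
  | Nc, La => WP Wac' | Nc, Na => WN Wac | Nc, Lb => WP Wbc'
  | Nc, Nb => WN Wbc | Nc, Lc => WZ | Nc, Nc => WN W2c
  end.
Definition wdif l m := wsum l (lopp m).

(** Indexed by the nine nonzero pair sums up to sign. Values are computed once per box and then
    looked up for every candidate. *)
Record tab9 (A : Type) := T9 {
  t2a : A; t2b : A; t2c : A; tab : A; tab' : A; tac : A; tac' : A; tbc : A; tbc' : A }.

Definition tget A (t : tab9 A) w :=
  match w with
  | W2a => t2a t | W2b => t2b t | W2c => t2c t | Wab => tab t | Wab' => tab' t
  | Wac => tac t | Wac' => tac' t | Wbc => tbc t | Wbc' => tbc' t
  end.
Definition tmap A B (f : A -> B) t :=
  T9 (f (t2a t)) (f (t2b t)) (f (t2c t)) (f (tab t)) (f (tab' t))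
     (f (tac t)) (f (tac' t)) (f (tbc t)) (f (tbc' t)).

Lemma tget_map A B (f : A -> B) t w : tget (tmap f t) w = f (tget t w).
Proof. by case: w. Qed.

Record tab3 := T3 { ta : itv; tb : itv; tc : itv }.
Definition get3 t l :=
  match l with
  | La => ta t | Na => iopp (ta t) | Lb => tb t
  | Nb => iopp (tb t) | Lc => tc t | Nc => iopp (tc t)
  end.
Definition tmap3 (f : itv -> itv) t := T3 (f (ta t)) (f (tb t)) (f (tc t)).

Record tab6 (A : Type) := T6 { t61 : A; t62 : A; t63 : A; t64 : A; t65 : A; t66 : A }.
Definition mk6 A (f : label -> A) := T6 (f La) (f Na) (f Lb) (f Nb) (f Lc) (f Nc).
Definition get6 A (t : tab6 A) l :=
  match l with
  | La => t61 t | Na => t62 t | Lb => t63 t | Nb => t64 t | Lc => t65 t | Nc => t66 t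
  end.

Lemma get6_mk A (f : label -> A) l : get6 (mk6 f) l = f l.
Proof. by case: l. Qed.

Definition gets t s : itv :=
  match s with WZ => (0, 0)%BZ | WP w => tget t w | WN w => iopp (tget t w) end.
Definition getq t s : itv :=
  match s with WZ => (0, 0)%BZ | WP w | WN w => tget t w end.
Definition prodt t t' := tmap (fun x => tmap (imul x) t') t.
Definition getp t s s' : itv :=
  match s, s' with
  | WZ, _ | _, WZ => (0, 0)%BZ
  | WP w, WP w' | WN w, WN w' => tget (tget t w) w'
  | WP w, WN w' | WN w, WP w' => iopp (tget (tget t w) w')
  end.
Definition wtab a b c :=
  T9 (idbl a) (idbl b) (idbl c) (iadd a b) (isub a b)
     (iadd a c) (isub a c) (iadd b c) (isub b c).

Section LabelValues.
Variables (R : realFieldType) (a b c : R).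

Definition lval l : R :=
  match l with La => a | Na => - a | Lb => b | Nb => - b | Lc => c | Nc => - c end.
Definition wval w : R :=
  match w with
  | W2a => 2 * a | W2b => 2 * b | W2c => 2 * c | Wab => a + b | Wab' => a - b
  | Wac => a + c | Wac' => a - c | Wbc => b + c | Wbc' => b - c
  end.
Definition sval s : R :=
  match s with WZ => 0 | WP w => wval w | WN w => - wval w end.

Lemma lval_opp l : lval (lopp l) = - lval l.
Proof. by case: l; rewrite /= ?opprK. Qed.

Lemma sval_sum l m : sval (wsum l m) = lval l + lval m.
Proof. by case: l; case: m => /=; ring. Qed.

Lemma sval_dif l m : sval (wdif l m) = lval l - lval m.
Proof. by rewrite sval_sum lval_opp. Qed.

(** In this family of predicates [k] is the factor carried by the table: a power of the scale,
    possibly times real weights. *)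
Definition in3 t (k : R) := forall l, inI (get3 t l) (k * lval l).
Definition in9 t (k : R) := forall w, inI (tget t w) (k * wval w).
Definition in9q t (k : R) := forall w, inI (tget t w) (k * wval w ^+ 2).
Definition in99 t (k : R) := forall w w', inI (tget (tget t w) w') (k * (wval w * wval w')).

Lemma in3_T3 k A B C : inI A (k * a) -> inI B (k * b) -> inI C (k * c) -> in3 (T3 A B C) k.
Proof. by move=> ? ? ? [] //=; rewrite mulrN; exact: inI_opp. Qed.

Lemma in3_map f t k k' :
  in3 t k -> (forall I x, inI I (k * x) -> inI (f I) (k' * x)) -> in3 (tmap3 f t) k'.
Proof.
move=> h hf; have h1 l := hf _ _ (h l).
by apply: in3_T3; [exact: (h1 La)|exact: (h1 Lb)|exact: (h1 Lc)].
Qed.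

Lemma in9_map f t k k' :
  in9 t k -> (forall I x, inI I (k * x) -> inI (f I) (k' * x)) -> in9 (tmap f t) k'.
Proof. by move=> h hf w; rewrite tget_map; exact: hf. Qed.

Lemma in9q_map f t k k' :
  in9q t k -> (forall I x, inI I (k * x) -> inI (f I) (k' * x)) -> in9q (tmap f t) k'.
Proof. by move=> h hf w; rewrite tget_map; exact: hf. Qed.

Lemma in9_sqr f t k k' :
  in9 t k -> (forall I x, inI I (k * x) -> inI (f I) (k' * x ^+ 2)) -> in9q (tmap f t) k'.
Proof. by move=> h hf w; rewrite tget_map; exact: hf. Qed.

Lemma in99_map f t k k' :
  in99 t k -> (forall I x, inI I (k * x) -> inI (f I) (k' * x)) -> in99 (tmap (tmap f) t) k'.
Proof. by move=> h hf w w'; rewrite !tget_map; exact: hf. Qed.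

Lemma in99_prod t t' k k' : in9 t k -> in9 t' k' -> in99 (prodt t t') (k * k').
Proof. by move=> h h' w w'; rewrite !tget_map mulrACA; apply: inI_mul. Qed.

Lemma in9_wtab A B C k : inI A (k * a) -> inI B (k * b) -> inI C (k * c) -> in9 (wtab A B C) k.
Proof.
move=> ? ? ? [] /=; rewrite ?mulrBr ?mulrDr ?[k * (2 * _)]mulrCA;
  by [exact: inI_dbl|exact: inI_add|exact: inI_sub].
Qed.

Lemma inI_gets t k s : in9 t k -> inI (gets t s) (k * sval s).
Proof. by case: s => [|w|w] h /=; rewrite ?mulr0 ?mulrN //; exact: inI_opp. Qed.

Lemma inI_getq t k s : in9q t k -> inI (getq t s) (k * sval s ^+ 2).
Proof. by case: s => [|w|w] h /=; rewrite ?expr0n ?mulr0 ?sqrrN //. Qed.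

Lemma inI_getp t k s s' : in99 t k -> inI (getp t s s') (k * (sval s * sval s')).
Proof.
by case: s => [|w|w]; case: s' => [|w'|w'] h /=; rewrite ?mul0r ?mulr0 ?mulrNN ?mulrN ?mulNr ?mulrN //;
  exact: inI_opp.
Qed.

End LabelValues.

(** * Discarding vertices that lie in no 8-clique *)

(* Elements of a clique of size n receive n distinct colours in any proper
   colouring, so a vertex seeing fewer than 7 colours lies in no 8-clique. *)
Section Core.
Variables (D : Type) (compat : D -> D -> bool) (data : quad -> D).

Definition mex (s : seq nat) := find (fun n => n \notin s) (iota 0 (size s).+1).

Lemma mex_notin s : mex s \notin s.
Proof.
have hs : has (fun n => n \notin s) (iota 0 (size s).+1).
  apply/negPn; rewrite -all_predC; apply/negP => /allP h.
  suff: ((size s).+1 <= size s)%N by rewrite ltnn.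
  rewrite -[leqLHS](size_iota 0); apply: uniq_leq_size (iota_uniq _ _) _ => n /h /=.
  by rewrite negbK.
have := nth_find 0%N hs; rewrite nth_iota ?add0n //.
by move: hs; rewrite has_find size_iota.
Qed.

Notation vertex := (quad * D * nat * seq nat)%type.
Definition vquad (v : vertex) := let: (q, _, _, _) := v in q.
Definition vdata (v : vertex) := let: (_, d, _, _) := v in d.
Definition vcol (v : vertex) := let: (_, _, g, _) := v in g.
Definition vseen (v : vertex) := let: (_, _, _, s) := v in s.
Definition vadd g (v : vertex) : vertex := let: (q, d, h, s) := v in (q, d, h, g :: s).

(** Greedy colouring by insertion: a new vertex takes the least colour absent among the compatible
    ones already present, and the same pass adds this colour to the colours they have seen. *)
Fixpoint colour (l : seq quad) : seq vertex :=
  if l is q :: l then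
    let d := data q in
    let t := [seq (compat d (vdata v), v) | v <- colour l] in
    let s := [seq vcol p.2 | p <- t & p.1] in
    let g := mex s in
    (q, d, g, s) :: [seq if p.1 then vadd g p.2 else p.2 | p <- t]
  else [::].

Definition core l :=
  [seq vquad v | v <- colour l & (6 < size (undup (vseen v)))%N].

Variable P : quad -> quad -> Prop.
Hypothesis P_sym : forall y z, P y z -> P z y.
Hypothesis P_compat : forall y z, P y z -> compat (data y) (data z).

Lemma map_vquad_colour l : [seq vquad v | v <- colour l] = l.
Proof.
elim: l => //= q l ih; congr cons.
rewrite -map_comp -map_comp -[RHS]ih; apply: eq_map => -[[[q' d'] g'] s'] /=.
by case: ifP.
Qed.

Lemma In_map A B (f : A -> B) l y :
  List.In y (map f l) -> exists2 x, List.In x l & y = f x.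
Proof. by elim: l => //= x l ih [<-|/ih[z]]; [exists x|exists z]; auto. Qed.

Lemma colour_data l v : List.In v (colour l) -> vdata v = data (vquad v).
Proof.
elim: l v => //= q l ih v [<- //|h].
have [p hp ->] := In_map h; have [w hw ->] := In_map hp; move: (ih _ hw).
by rewrite /=; case: ifP => //= _; case: w {hw hp} => [[[? ?] ?] ?].
Qed.

Lemma colour_proper l v w : List.In v (colour l) -> List.In w (colour l) ->
  vquad v != vquad w -> P (vquad v) (vquad w) ->
  vcol w \in vseen v /\ vcol v != vcol w.
Proof.
elim: l v w => //= q l ih v w.
set t := [seq (_, _) | _ <- _]; set s := [seq _ | _ <- _ & _].
have seen u : List.In u (colour l) -> compat (data q) (vdata u) -> vcol u \in s.
  rewrite /s /t; elim: (colour l) => //= u' l' ihl [->|/ihl h] hc.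
    by rewrite hc inE eqxx.
  by case: ifP => //=; rewrite ?inE h ?orbT.
have new u : List.In u (colour l) -> P q (vquad u) -> vcol u \in s /\ mex s != vcol u.
  move=> hu hP; have hs := seen u hu; rewrite (colour_data hu) in hs.
  split; first exact/hs/P_compat.
  by apply: contraNneq (mex_notin s) => ->; exact/hs/P_compat.
have addE b u : [/\ vquad (if b then vadd (mex s) u else u) = vquad u,
    vcol (if b then vadd (mex s) u else u) = vcol u
  & {subset vseen u <= vseen (if b then vadd (mex s) u else u)}].
  by case: u => [[[q' d] g] s']; case: b; split=> //= x; rewrite inE orbC => ->.
case=> [<-|hv]; last (have [p hp ->] := In_map hv; have [v' hv' ->] := In_map hp);
  case=> [<-|hw]; try (have [p' hp' ->] := In_map hw; have [w' hw' ->] := In_map hp'); rewrite /=.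
- by rewrite eqxx.
- have [-> -> _] := addE (compat (data q) (vdata w')) w'.
  by move=> _; exact: new.
- have [-> -> _] := addE (compat (data q) (vdata v')) v'.
  move=> _ /P_sym hP; have [_ h] := new _ hv' hP; split; last by rewrite eq_sym.
  by rewrite (colour_data hv') (P_compat hP); case: v' {hv' hP h} => [[[]]] /= *; rewrite inE eqxx.
have [-> -> hsub] := addE (compat (data q) (vdata v')) v'.
have [-> -> _] := addE (compat (data q) (vdata w')) w'.
by move=> hne hP; have [h1 h2] := ih _ _ hv' hw' hne hP; split=> //; exact: hsub.
Qed.

Lemma mem_vertex l y : y \in l -> exists2 v, List.In v (colour l) & vquad v = y.
Proof.
rewrite -{1}(map_vquad_colour l); elim: (colour l) => //= v t ih.
by rewrite inE => /predU1P[->|/ih[w hw <-]]; [exists v|exists w]; auto.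
Qed.

(** [P] is the true relation, of which [compat] is only a consequence. The other members of [Y], at
    least seven, have distinct colours, and y sees all of them. *)
Lemma core_sound l (Y : seq quad) : uniq Y -> (7 < size Y)%N ->
    {in Y &, forall y z, y != z -> P y z} -> {subset Y <= l} -> {subset Y <= core l}.
Proof.
move=> uY sY PY Yl y yY.
(* [l] may contain a quadruple several times with different colours, so one occurrence is fixed for
   each member of [Y]. *)
pose f z := if [pick v : 'I_(size (colour l)) |
  vquad (nth (z, data z, 0%N, [::]) (colour l) v) == z] is Some v
  then vcol (nth (z, data z, 0%N, [::]) (colour l) v) else 0%N.
have fP z : z \in Y -> exists2 v, List.In v (colour l) & vquad v = z /\ vcol v = f z.
  move=> zY; rewrite /f; case: pickP => [i /eqP hi|h].
    eexists; last by split; [exact: hi|].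
    by elim: (colour l) i {hi} => [[]//|v t ih [[|i] hi]] /=; [left|right; exact: (ih (Ordinal (hi : (i < size t)%N)))].
  have [v hv vz] := mem_vertex (Yl _ zY).
  suff [i hi] : exists i : 'I_(size (colour l)), nth (z, data z, 0%N, [::]) (colour l) i = v.
    by have := h i; rewrite hi vz eqxx.
  elim: (colour l) hv => //= w t ih [<-|/ih[i hi]]; first by exists ord0.
  by exists (lift ord0 i).
have [v hv [vy _]] := fP _ yY.
have sub : {subset [seq f z | z <- rem y Y] <= undup (vseen v)}.
  move=> g /mapP[z]; rewrite mem_rem_uniq // !inE => /andP[zy zY] ->.
  have [w hw [wz <-]] := fP _ zY; rewrite mem_undup.
  by have [] := colour_proper hv hw; rewrite ?vy ?wz 1?eq_sym //; apply: PY; rewrite // eq_sym.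
have inj : {in rem y Y &, injective f}.
  move=> z z'; rewrite !mem_rem_uniq // !inE => /andP[_ zY] /andP[_ z'Y] fz.
  apply/eqP/negPn/negP => zz'.
  have [w hw [wz fw]] := fP _ zY; have [w' hw' [wz' fw']] := fP _ z'Y.
  have [|| _] := colour_proper hw hw'; rewrite ?wz ?wz' //; first exact: PY.
  by rewrite fw fw' fz eqxx.
have sz : (6 < size (undup (vseen v)))%N.
  apply: leq_trans (uniq_leq_size _ sub); last by rewrite map_inj_in_uniq // rem_uniq.
  by rewrite size_map size_rem //; case: (size Y) sY.
rewrite -vy /core; elim: (colour l) hv => //= w t ih [->|/ih].
  by rewrite sz /= inE eqxx.
by case: ifP => //= _; rewrite inE orbC => ->.
Qed.

End Core.

(** * Interval tests and the branch-and-bound search *)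

Section Engine.
Variables (sg : bool) (lu lv : label).
Local Open Scope Z_scope.

(** Tests whether [cycle_eqn] can hold in the box; the two sides are compared at scale s^2 if
    balanced and s^4 if unbalanced. *)
Definition eqnok (s : Z) (a b c : itv) : bool :=
  let u := get3 (T3 a b c) lu in let v := get3 (T3 a b c) lv in
  let one := (s, s) in let a2 := isqr a in
  if sg then imeet (imul (iadd one u) (iadd one v)) (idbl (idbl a2))
  else
    let s2 := (s * s, s * s) in let q := isub s2 (idbl a2) in let t := q.2 in
    [&& 0 <=? t - s * u.1, 0 <=? t + s * u.2, 0 <=? t - s * v.1, 0 <=? t + s * v.2 &
     let u2 := isqr u in let v2 := isqr v in
     imeet (isqr q) (isub (imul s2 (iadd u2 v2)) (imul u2 v2))].

(** Only b and c are bisected. The interval of a is narrowed by cutting off slabs of about a quarter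
    of its width at either end as long as they fail [eqnok]. *)
Fixpoint shave (n : nat) (s : Z) (a b c : itv) : option itv :=
  if n is n.+1 then
    if eqnok s a b c then
      let (l, h) := a in
      let w := h - l in
      if w <=? 1 then Some a else
      let q := Z.max 1 (Z.shiftr w 2) in
      if eqnok s (l, l + q) b c then
        if eqnok s (h - q, h) b c then Some a
        else shave n s (l, h - q) b c
      else shave n s (l + q, h) b c
    else None
  else Some a.

(** [zexcl0] to [zexcl3] are sufficient integer tests for [excl0] to [excl3], which [not_excluded]
    rules out geometrically. *)
Definition zexcl0 (s : Z) (a b c : itv) : bool :=
  let s3 := 3 * (s * s) in
  [&& 11 * (a.2 * a.2) <? s3, 11 * (b.2 * b.2) <? s3 & 11 * (c.2 * c.2) <? s3]
  || [&& s <? 2 * a.1, s <? 2 * b.1 & s <? 2 * c.1].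
Definition zexcl1 (s : Z) (g x y : itv) : bool :=
  let t := 2 * (g.1 * g.1) - s * s in
  [&& 0 <? t, x.2 * s <? t, y.2 * s <? t &
   let e := s * (s - g.1) in
   [|| (e <? 2 * (x.1 * x.1)) && (e <? 2 * (y.1 * y.1)), (3 * x.2 <? s) && (3 * y.2 <? s),
       (x.2 <? y.1) && (2 * e <? (y.1 - x.2) * (y.1 - x.2))
     | (y.2 <? x.1) && (2 * e <? (x.1 - y.2) * (x.1 - y.2))]].
Definition zexcl2 (s : Z) (x y z : itv) : bool :=
  (x.2 * s <? 2 * (y.1 * y.1) - s * s) && (x.2 * s <? 2 * (z.1 * z.1) - s * s).
Definition zexcl3 (s : Z) (x y z : itv) : bool :=
  [&& 20 * x.2 <? s, 20 * y.2 <? s, 7 * s <? 10 * z.1 & 25 * z.2 <? 18 * s].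
Definition rprune (s : Z) (a b c : itv) : bool :=
  let a := iabs a in let b := iabs b in let c := iabs c in
  [|| zexcl0 s a b c, zexcl1 s a b c, zexcl1 s b a c, zexcl1 s c a b,
      zexcl2 s a b c, zexcl2 s b a c, zexcl2 s c a b,
      zexcl3 s a b c, zexcl3 s a c b | zexcl3 s b c a].

Notation dspan := (spairsum * spairsum * itv * itv)%type.
(** Encloses a fixed multiple of <y,z> by a diagonal form in three coordinates: the sum y1 + y3, the
    difference y1 - y3 and a third one, stored plain in one component and weighted in the next. Its
    absolute value must meet that of the same multiple of a, b or c. *)
Definition dcompat (k : Z) (tg : tab3) (p1 p2 : tab9 (tab9 itv)) (x y : dspan) : bool :=
  let: (s1, d1, e1, _) := x in let: (s2, d2, _, e2) := y in
  let f := iabs (ishr k (iadd (iadd (getp p1 s1 s2) (getp p2 d1 d2)) (imul e1 e2))) in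
  [|| imeet f (ta tg), imeet f (tb tg) | imeet f (tc tg)].
(** Fewer than eight candidates contain no 8-clique; with more than [mx] candidates the colouring is
    skipped. *)
Definition ocore D (cp : D -> D -> bool) (data : quad -> D) (mx : nat) (cs : seq quad) :=
  if (7 < size cs)%N then if (mx < size cs)%N then cs else core cp data cs else [::].

Record ptab := PTab {
  pw0 : tab9 itv; ppvw : tab9 itv; ppuw : tab9 itv; paw : tab9 itv;
  pn1 : tab9 itv; pn2 : tab9 itv; pn3 : tab9 itv; pn5 : tab9 itv; pn6 : tab9 itv;
  pkk1 : itv; pkk2 : itv;
  pp1 : tab9 (tab9 itv); pp2 : tab9 (tab9 itv); pm3 : tab9 itv; ptg : tab3 }.

Definition mk_ptab (k s : Z) (a b c : itv) : ptab :=
  let one := (s, s) in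
  let u := get3 (T3 a b c) lu in let v := get3 (T3 a b c) lv in
  let pu := iadd one u in let mu := isub one u in
  let pv := iadd one v in let mv := isub one v in
  let w0 := wtab a b c in
  let sq := tmap (fun w => ishr k (isqr w)) w0 in
  let mumv := ishr k (imul mu mv) in let pumv := ishr k (imul pu mv) in
  let pumu := ishr k (imul pu mu) in let pvmu := ishr k (imul pv mu) in
  let pvmv := ishr k (imul pv mv) in
  let kk1 := idbl (imul pu mumv) in
  let kk := ishr k kk1 in
  PTab w0 (tmap (imul pv) w0) (tmap (imul pu) w0) (tmap (imul (idbl a)) w0)
    (tmap (imul mumv) sq) (tmap (imul pumv) sq) (tmap (imul pumu) sq)
    (tmap (imul pvmv) sq) (tmap (imul pvmu) sq)
    kk1 (idbl (imul pv mumv))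
    (prodt w0 (tmap (fun w => ishr k (imul w mumv)) w0))
    (prodt w0 (tmap (fun w => ishr k (imul w pumv)) w0))
    (tmap (fun w => ishr k (imul w pumu)) w0)
    (tmap3 (fun x => iabs (ishr k (imul kk x))) (T3 a b c)).

Definition ptest (t : ptab) (y : quad) : bool :=
  let: (y1, y2, y3, y4) := y in
  let s13 := wsum y1 y3 in let s24 := wsum y2 y4 in
  let d13 := wdif y1 y3 in let d24 := wdif y2 y4 in
  [&& imeet (gets (ppvw t) s13) (gets (paw t) s24),
      imeet (gets (ppuw t) s24) (gets (paw t) s13),
      imeet (pkk1 t) (iadd (iadd (getq (pn1 t) s13) (getq (pn2 t) d13)) (getq (pn3 t) d24))
    & imeet (pkk2 t) (iadd (iadd (getq (pn1 t) s24) (getq (pn5 t) d13)) (getq (pn6 t) d24))].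

Definition pdata (t : ptab) (y : quad) : dspan :=
  let: (y1, y2, y3, y4) := y in
  let d24 := wdif y2 y4 in
  (wsum y1 y3, wdif y1 y3, gets (pw0 t) d24, gets (pm3 t) d24).

Definition pcompat k t := dcompat k (ptg t) (pp1 t) (pp2 t).

(* The unbalanced 4-cycle: e2 and e4 (resp. e1 and e3) are the inner products
   with the component of x2 and x4 (resp. x1 and x3) orthogonal to x1 and x3
   (resp. x2 and x4), scaled to avoid divisions. *)
Record mtab := MTab {
  mw0 : tab9 itv; maw : tab9 itv;
  my1 : tab3; my2 : tab3; my3 : tab3; my4 : tab3;
  ma1 : tab3; ma2 : tab9 itv; ma3 : tab3; ma4 : tab9 itv;
  mc1 : tab3; mc2 : tab9 itv; mc3 : tab3; mc4 : tab9 itv;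
  mn1 : tab6 (tab6 itv); mn2 : tab6 (tab6 itv);
  mnh1 : tab6 (tab6 itv); mnh2 : tab6 (tab6 itv);
  mbig1 : bool; mbig2 : bool; mh1 : itv; mh2 : itv; mflat : bool;
  mp1 : tab9 (tab9 itv); mp2 : tab9 (tab9 itv); mp3 : tab9 (tab9 itv); mp4 : tab9 (tab9 itv);
  ml1 : tab6 itv; ml2 : tab6 itv;
  mq1 : tab9 (tab9 itv); mq2 : tab9 (tab9 itv); mtg : tab3 }.

(** h2, h4, k2, k4 measure how far each vector of the cycle is from the plane of its two neighbours.
    [big1] and [big2] select the larger lower bound on either diagonal; [mflat] signals that those
    of h2 and h4 are both below about 1/8. *)
Definition mk_mtab (k s : Z) (a b c : itv) : mtab :=
  let one := (s, s) in let l3 := T3 a b c in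
  let u := get3 l3 lu in let v := get3 l3 lv in
  let pu := iadd one u in let mu := isub one u in
  let pv := iadd one v in let mv := isub one v in
  let w0 := wtab a b c in
  let sq := tmap (fun w => ishr k (isqr w)) w0 in
  let a2 := idbl (ishr k (isqr a)) in
  let h2 := isub pu a2 in let h4 := isub mu a2 in
  let k2 := isub pv a2 in let k4 := isub mv a2 in
  let pumu2 := idbl (ishr k (imul pu mu)) in let pvmv2 := idbl (ishr k (imul pv mv)) in
  let aw := tmap (fun w => ishr k (imul a w)) w0 in
  let y2 := tmap3 (fun y => ishr k (imul y pu)) l3 in
  let y4 := tmap3 (fun y => ishr k (imul y mu)) l3 in
  let y1 := tmap3 (fun y => ishr k (imul y mv)) l3 in
  let y3 := tmap3 (fun y => ishr k (imul y pv)) l3 in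
  let vmu := ishr k (imul v mu) in let upv := ishr k (imul u pv) in
  let big1 := h4.1 <=? h2.1 in let big2 := k2.1 <=? k4.1 in
  let hh := if big1 then h2 else h4 in let hm := if big1 then idbl mu else idbl pu in
  let kh := if big2 then k4 else k2 in let km := if big2 then idbl pv else idbl mv in
  let sqmu := tmap (fun q => ishr k (imul q mu)) sq in
  let sqpu := tmap (fun q => ishr k (imul q pu)) sq in
  let sqmv := tmap (fun q => ishr k (imul q mv)) sq in
  let sqpv := tmap (fun q => ishr k (imul q pv)) sq in
  let n1 := mk6 (fun y => mk6 (fun z =>
    isub pumu2 (iadd (getq sqmu (wsum y z)) (getq sqpu (wdif y z))))) in
  let n2 := mk6 (fun y => mk6 (fun z =>
    isub pvmv2 (iadd (getq sqmv (wsum y z)) (getq sqpv (wdif y z))))) in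
  let p1 := prodt w0 (tmap (fun w => ishr k (imul w mu)) w0) in
  let p2 := prodt w0 (tmap (fun w => ishr k (imul w pu)) w0) in
  let kk := ishr k (imul pumu2 hh) in
  MTab w0 aw y1 y2 y3 y4
    (tmap3 (imul vmu) y2) (tmap (imul vmu) aw) (tmap3 (imul h2) y4) (tmap (imul h2) aw)
    (tmap3 (imul upv) y1) (tmap (imul upv) aw) (tmap3 (imul k4) y3) (tmap (imul k4) aw)
    n1 n2
    (mk6 (fun y => mk6 (fun z => imul (get6 (get6 n1 y) z) hh)))
    (mk6 (fun y => mk6 (fun z => imul (get6 (get6 n2 y) z) kh)))
    big1 big2 hm km (Z.max h2.1 h4.1 <? Z.shiftr s 3)
    p1 p2
    (prodt w0 (tmap (fun w => ishr k (imul w mv)) w0))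
    (prodt w0 (tmap (fun w => ishr k (imul w pv)) w0))
    (mk6 (fun y => ishr k (imul pumu2 (get3 l3 y))))
    (mk6 (fun y => ishr k (imul pvmv2 (get3 l3 y))))
    (tmap (tmap (fun x => imul hh (ishr k x))) p1)
    (tmap (tmap (fun x => imul hh (ishr k x))) p2)
    (tmap3 (fun x => iabs (ishr k (imul kk x))) l3).

Definition me1 (t : mtab) (y1 y2 y3 y4 : label) : itv :=
  if mbig1 t then isub (get3 (my2 t) y2) (gets (maw t) (wsum y1 y3))
  else iadd (get3 (my4 t) y4) (gets (maw t) (wdif y1 y3)).
Definition me2 (t : mtab) (y1 y2 y3 y4 : label) : itv :=
  if mbig2 t then isub (get3 (my1 t) y1) (gets (maw t) (wdif y2 y4))
  else isub (get3 (my3 t) y3) (gets (maw t) (wsum y2 y4)).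

Definition mtest (k : Z) (t : mtab) (y : quad) : bool :=
  let: (y1, y2, y3, y4) := y in
  let s13 := wsum y1 y3 in let s24 := wsum y2 y4 in
  let d13 := wdif y1 y3 in let d24 := wdif y2 y4 in
  [&& 0 <=? (get6 (get6 (mn1 t) y1) y3).2, 0 <=? (get6 (get6 (mn2 t) y2) y4).2,
      imeet (get6 (get6 (mnh1 t) y1) y3) (imul (mh1 t) (ishr k (isqr (me1 t y1 y2 y3 y4)))),
      imeet (get6 (get6 (mnh2 t) y2) y4) (imul (mh2 t) (ishr k (isqr (me2 t y1 y2 y3 y4)))),
      imeet (isub (get3 (ma1 t) y2) (gets (ma2 t) s13)) (iadd (get3 (ma3 t) y4) (gets (ma4 t) d13))
    & imeet (isub (get3 (mc1 t) y1) (gets (mc2 t) d24)) (isub (get3 (mc3 t) y3) (gets (mc4 t) s24))].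

Definition mdata (k : Z) (t : mtab) (y : quad) : dspan :=
  let: (y1, y2, y3, y4) := y in
  let e := me1 t y1 y2 y3 y4 in (wsum y1 y3, wdif y1 y3, e, ishr k (imul e (mh1 t))).

Notation dflat := (spairsum * spairsum * spairsum * spairsum * itv * itv)%type.
Definition fdata (t : mtab) (y : quad) : dflat :=
  let: (y1, y2, y3, y4) := y in
  let pos (x : itv) := (Z.max 0 x.1, x.2) in
  (wsum y1 y3, wdif y1 y3, wsum y2 y4, wdif y2 y4,
   pos (get6 (get6 (mn1 t) y1) y3), pos (get6 (get6 (mn2 t) y2) y4)).

(** For nearly coplanar cycles: the products of normal components enter only through their squares,
    as in the first two clauses of [mdot], so that no factor h2 or h4 occurs. *)
Definition fcompat (k : Z) (t : mtab) (x y : dflat) : bool :=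
  let: (a1, a2, a3, a4, m1, m2) := x in let: (b1, b2, b3, b4, n1, n2) := y in
  let p := ishr k (iadd (getp (mp1 t) a1 b1) (getp (mp2 t) a2 b2)) in
  let p' := ishr k (iadd (getp (mp3 t) a3 b3) (getp (mp4 t) a4 b4)) in
  let m := imul m1 n1 in let m' := imul m2 n2 in
  has (fun l => imeet (isqr (isub (get6 (ml1 t) l) p)) m
             && imeet (isqr (isub (get6 (ml2 t) l) p')) m') labels.

Definition step (mx : nat) (k s : Z) (a b c : itv) (cs : seq quad) : seq quad :=
  if sg then
    let t := mk_ptab k s a b c in
    ocore (pcompat k t) (pdata t) mx (filter (ptest t) cs)
  else
    let t := mk_mtab k s a b c in
    let cs := filter (mtest k t) cs in
    if mflat t then ocore (fcompat k t) (fdata t) mx cs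
    else ocore (dcompat k (mtg t) (mq1 t) (mq2 t)) (mdata k t) mx cs.

Variables (mx : nat -> nat) (ord : bool) (leaf : Z -> Z -> itv -> itv -> itv -> seq quad -> bool).

(** [n] is the remaining depth. Splits alternate between b and c, and the scale doubles before each
    split of b, so that the two intervals keep their width in units. [mx n] = 0 skips the filter,
    and [m.+1] runs it with limit [m] on the colouring. [ord] discards boxes with b < c. *)
Fixpoint search (n : nat) (par : bool) (k s : Z) (a b c : itv) (cs : seq quad) : bool :=
  if shave 12 s a b c is Some a then
    if rprune s a b c || (ord && (b.2 <? c.1)) then true else
    let cs := if mx n is m.+1 then step m k s a b c cs else cs in
    if cs is [::] then true else
    if n is n.+1 then
      if par then
        let a := idbl a in let b := idbl b in let c := idbl c in
        let m := Z.shiftr (b.1 + b.2) 1 in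
        search n false (k + 1) (2 * s) a (b.1, m) c cs
        && search n false (k + 1) (2 * s) a (m, b.2) c cs
      else
        let m := Z.shiftr (c.1 + c.2) 1 in
        search n true k s a b (c.1, m) cs && search n true k s a b (m, c.2) cs
    else leaf k s a b c cs
  else true.

End Engine.

(** The first label is unsigned, since the sign of the vector representing a line is free. *)
Definition allq : seq quad :=
  flatten [seq flatten [seq flatten [seq [seq (l1, l2, l3, l4) | l4 <- labels] | l3 <- labels]
    | l2 <- labels] | l1 <- [:: La; Lb; Lc]].

(** The filter runs at remaining depth 20 and at the odd depths below it; the limit on the colouring
    grows from 20 to 60 as boxes shrink. *)
Definition budget n : nat :=
  if (n <= 20)%N then
    if ~~ odd n && (n != 20) then 0 else if (n <= 14)%N then 61 else if (n <= 16)%N then 41 else 21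
  else 0.

(** * Soundness of the tests on boxes *)

Section EngineSoundness.
Variables (R : realFieldType) (sg : bool) (lu lv : label) (a b c : R).
Notation lval := (lval a b c).
Notation u := (lval lu).
Notation v := (lval lv).

(** The vanishing of the Gram determinant of the cycle; in the balanced case the nonzero factor (1 -
    u)(1 - v) is cancelled. The inequalities of the unbalanced case say that 1 +- u - 2 a^2 and 1 +-
    v - 2 a^2 are non-negative. *)
Definition cycle_eqn : Prop :=
  if sg then (1 + u) * (1 + v) = 4 * a ^+ 2
  else [/\ (1 - 2 * a ^+ 2) ^+ 2 = u ^+ 2 + v ^+ 2 - u ^+ 2 * v ^+ 2,
           u <= 1 - 2 * a ^+ 2, - u <= 1 - 2 * a ^+ 2,
           v <= 1 - 2 * a ^+ 2 & - v <= 1 - 2 * a ^+ 2].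

Section Scale.
Variables (k s : Z).
Hypotheses (k_ge0 : (0 <= k)%BZ) (sE : s = (2 ^ k)%BZ).
Notation S := (zr R s).

Lemma scale_gt0 : 0 < S. Proof. by rewrite (zr_lt _ 0) sE; lia. Qed.
Let S0 : S != 0. Proof. exact/lt0r_neq0/scale_gt0. Qed.

Lemma inI_eq I (x y : R) : inI I x -> x = y -> inI I y. Proof. by move=> h <-. Qed.

Lemma inI_scale : inI (s, s) S. Proof. by []. Qed.

Lemma inI_get3 A B C l : inI A (S * a) -> inI B (S * b) -> inI C (S * c) ->
  inI (get3 (T3 A B C) l) (S * lval l).
Proof. by move=> *; apply: in3_T3. Qed.

Lemma eqnok_sound A B C : inI A (S * a) -> inI B (S * b) -> inI C (S * c) ->
  cycle_eqn -> eqnok sg lu lv s A B C.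
Proof.
move=> hA hB hC; have hu := inI_get3 lu hA hB hC; have hv := inI_get3 lv hA hB hC.
rewrite /cycle_eqn /eqnok; case: sg => [h|[h h1 h2 h3 h4]].
  apply: inI_meet; first by apply: inI_mul; apply: inI_add; [exact: inI_scale|exact: hu|exact: inI_scale|exact: hv].
    by apply/inI_dbl/inI_dbl/inI_sqr/hA.
  transitivity (S ^+ 2 * ((1 + u) * (1 + v))); first ring.
  by rewrite h; ring.
have hs2 : inI (s * s, s * s)%BZ (S * S) by split; rewrite /= zrM.
have hq := inI_sub hs2 (inI_dbl (inI_sqr hA)).
move: hu hv hq; move: (get3 _ lu) (get3 _ lv) (isub _ _) => U V q hu hv hq.
have S_gt0 := scale_gt0.
apply/and5P; split; rewrite -?(zr_le R) ?zrB ?zrD ?zrM.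
- by have [_ ?] := hq; have [? _] := hu; rewrite (_ : zr R 0 = 0) //; nra.
- by have [_ ?] := hq; have [_ ?] := hu; rewrite (_ : zr R 0 = 0) //; nra.
- by have [_ ?] := hq; have [? _] := hv; rewrite (_ : zr R 0 = 0) //; nra.
- by have [_ ?] := hq; have [_ ?] := hv; rewrite (_ : zr R 0 = 0) //; nra.
apply: inI_meet; first exact: inI_sqr hq.
  by apply: inI_sub; [apply: inI_mul hs2 _; apply: inI_add|apply: inI_mul]; apply: inI_sqr; [exact: hu|exact: hv|exact: hu|exact: hv].
transitivity (S ^+ 4 * (1 - 2 * a ^+ 2) ^+ 2); first ring.
by rewrite h; ring.
Qed.

Lemma shave_sound n A B C : inI A (S * a) -> inI B (S * b) -> inI C (S * c) -> cycle_eqn ->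
  exists2 A', shave sg lu lv n s A B C = Some A' & inI A' (S * a).
Proof.
move=> hA hB hC he; elim: n A hA => /= [|n ih] A hA; first by exists A.
rewrite (eqnok_sound hA) //; case: A hA => l h hA.
case: ifP => _; first by exists (l, h).
set q := Z.max _ _; case: ifPn => [_|/negP h1].
  case: ifPn => [_|/negP h2]; first by exists (l, h).
  apply: ih; have [h3 h4] := hA; split=> //=.
  by rewrite leNgt; apply/negP => hlt; apply: h2; apply: eqnok_sound => //; split=> //; exact: ltW.
apply: ih; have [h3 h4] := hA; split=> //=.
by rewrite leNgt; apply/negP => hlt; apply: h1; apply: eqnok_sound => //; split=> //; exact: ltW.
Qed.

(** For 12 lines Welch's bound forbids all squares below 3/11, and a cluster argument all values
    above 1/2. In [excl1] and [excl2] the expression 2 g^2 - 1 is the cosine of twice the angle with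
    cosine g: values below it cannot occur between two vectors at product g with a third. *)
Definition excl0 (x y z : R) : Prop :=
  [/\ 11 * x ^+ 2 < 3, 11 * y ^+ 2 < 3 & 11 * z ^+ 2 < 3] \/ [/\ 1 < 2 * x, 1 < 2 * y & 1 < 2 * z].
Definition excl1 (g x y : R) : Prop :=
  [/\ x < 2 * g ^+ 2 - 1, y < 2 * g ^+ 2 - 1 &
   [\/ 1 - g < 2 * x ^+ 2 /\ 1 - g < 2 * y ^+ 2, 3 * x < 1 /\ 3 * y < 1,
       x < y /\ 2 * (1 - g) < (y - x) ^+ 2 | y < x /\ 2 * (1 - g) < (x - y) ^+ 2]].
Definition excl2 (x y z : R) : Prop := x < 2 * y ^+ 2 - 1 /\ x < 2 * z ^+ 2 - 1.
Definition excl3 (x y z : R) : Prop := [/\ 20 * x < 1, 20 * y < 1, 7 < 10 * z & 25 * z < 18].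
Definition excluded (x y z : R) : Prop :=
  excl0 x y z \/ [\/ excl1 x y z, excl1 y x z | excl1 z x y]
  \/ [\/ excl2 x y z, excl2 y x z | excl2 z x y]
  \/ [\/ excl3 x y z, excl3 x z y | excl3 y z x].

Lemma inI_unit I (x : R) : inI (iabs I) (S * x) ->
  exists p q, [/\ zr R (iabs I).1 = S * p, zr R (iabs I).2 = S * q, 0 <= p, p <= x & x <= q].
Proof.
move=> [h1 h2]; exists (zr R (iabs I).1 / S), (zr R (iabs I).2 / S).
have S_gt0 := scale_gt0; rewrite ![S * _]mulrC !divfK //; split=> //; last first.
- by rewrite ler_pdivlMr // mulrC.
- by rewrite ler_pdivrMr // mulrC.
apply: divr_ge0 (ltW S_gt0).
case: I {h1 h2} => l h; rewrite /iabs; case: ifP => [|h1]; first by rewrite -(zr_le R).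
case: ifP => // h2; rewrite /= (zr_le _ 0); lia.
Qed.

Definition bounds I (x : R) := exists p q,
  [/\ zr R I.1 = S * p, zr R I.2 = S * q, 0 <= p, p <= x & x <= q].

Lemma zexcl_sound I J K (x y z : R) : bounds I x -> bounds J y -> bounds K z ->
  [/\ zexcl0 s I J K -> excl0 x y z, zexcl1 s I J K -> excl1 x y z,
      zexcl2 s I J K -> excl2 x y z & zexcl3 s I J K -> excl3 x y z].
Proof.
move=> [x1 [x2 [e1 e2 x10 lx ux]]] [y1 [y2 [e3 e4 y10 ly uy]]] [z1 [z2 [e5 e6 z10 lz uz]]].
have S_gt0 := scale_gt0.
have lt3 (x' y' p q : R) : x' < y' -> S * S * (q - p) = y' - x' -> p < q.
  by rewrite -subr_gt0 => + h; rewrite -h pmulr_rgt0 ?mulr_gt0 // subr_gt0.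
have lt1 (x' y' p q : R) : x' < y' -> S * (q - p) = y' - x' -> p < q.
  by rewrite -subr_gt0 => + h; rewrite -h pmulr_rgt0 // subr_gt0.
have sqle (p q : R) : 0 <= p -> p <= q -> p ^+ 2 <= q ^+ 2.
  by move=> p0 pq; rewrite lerXn2r // ?nnegrE // (le_trans p0).
have x0 := le_trans x10 lx; have y0 := le_trans y10 ly; have z0 := le_trans z10 lz.
have := (sqle _ _ x10 lx, sqle _ _ x0 ux, sqle _ _ y10 ly, sqle _ _ y0 uy, sqle _ _ z10 lz, sqle _ _ z0 uz).
move=> [[[[[]]]]] sx1 sx2 sy1 sy2 sz1 sz2.
have E : (zr R 2 = 2) * (zr R 3 = 3) * (zr R 7 = 7) * (zr R 10 = 10) * (zr R 11 = 11) * (zr R 18 = 18) * (zr R 20 = 20) * (zr R 25 = 25) by [].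
split.
- rewrite /zexcl0 -!(zr_lt R) !zrM e1 e2 e3 e4 e5 e6 !E {e1 e2 e3 e4 e5 e6 E}.
  case/orP=> /and3P[h1 h2 h3]; [left|right].
    have {}h1 : 11 * x2 ^+ 2 < 3 by apply: lt3 h1 _; ring.
    have {}h2 : 11 * y2 ^+ 2 < 3 by apply: lt3 h2 _; ring.
    have {}h3 : 11 * z2 ^+ 2 < 3 by apply: lt3 h3 _; ring.
    by split; lra.
  have {}h1 : 1 < 2 * x1 by apply: lt1 h1 _; ring.
  have {}h2 : 1 < 2 * y1 by apply: lt1 h2 _; ring.
  have {}h3 : 1 < 2 * z1 by apply: lt1 h3 _; ring.
  by split; lra.
- rewrite /zexcl1 -!(zr_lt R) !(zrM, zrB) ?e1 ?e2 ?e3 ?e4 ?e5 ?e6 !E {e1 e2 e3 e4 e5 e6 E}.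
  case/and4P=> _ h1 h2 h3.
  have {}h1 : y2 < 2 * x1 ^+ 2 - 1 by apply: lt3 h1 _; ring.
  have {}h2 : z2 < 2 * x1 ^+ 2 - 1 by apply: lt3 h2 _; ring.
  split; [lra|lra|].
  case/or4P: h3 => /andP[h3 h4].
  + have {}h3 : 1 - x1 < 2 * y1 ^+ 2 by apply: lt3 h3 _; ring.
    have {}h4 : 1 - x1 < 2 * z1 ^+ 2 by apply: lt3 h4 _; ring.
    by constructor 1; lra.
  + have {}h3 : 3 * y2 < 1 by apply: lt1 h3 _; ring.
    have {}h4 : 3 * z2 < 1 by apply: lt1 h4 _; ring.
    by constructor 2; split; lra.
  + constructor 3; have {}h3 : _ := lt1 _ _ _ _ h3 (mulrBr _ _ _).
    have {}h4 : 2 * (1 - x1) < (z1 - y2) ^+ 2 by apply: lt3 h4 _; ring.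
    have h5 : (z1 - y2) ^+ 2 <= (z - y) ^+ 2 by apply: sqle; lra.
    by split; lra.
  + constructor 4; have {}h3 : _ := lt1 _ _ _ _ h3 (mulrBr _ _ _).
    have {}h4 : 2 * (1 - x1) < (y1 - z2) ^+ 2 by apply: lt3 h4 _; ring.
    have h5 : (y1 - z2) ^+ 2 <= (y - z) ^+ 2 by apply: sqle; lra.
    by split; lra.
- rewrite /zexcl2 -!(zr_lt R) !(zrM, zrB) ?e1 ?e2 ?e3 ?e4 ?e5 ?e6 !E {e1 e2 e3 e4 e5 e6 E} => /andP[h1 h2].
  have {}h1 : x2 < 2 * y1 ^+ 2 - 1 by apply: lt3 h1 _; ring.
  have {}h2 : x2 < 2 * z1 ^+ 2 - 1 by apply: lt3 h2 _; ring.
  by split; lra.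
- rewrite /zexcl3 -!(zr_lt R) !(zrM, zrB) ?e1 ?e2 ?e3 ?e4 ?e5 ?e6 !E {e1 e2 e3 e4 e5 e6 E}.
  case/and4P=> h1 h2 h3 h4.
  have {}h1 : 20 * x2 < 1 by apply: lt1 h1 _; ring.
  have {}h2 : 20 * y2 < 1 by apply: lt1 h2 _; ring.
  have {}h3 : 7 < 10 * z1 by apply: lt1 h3 _; ring.
  have {}h4 : 25 * z2 < 18 by apply: lt1 h4 _; ring.
  by split; lra.
Qed.

Lemma rprune_sound A B C : inI A (S * a) -> inI B (S * b) -> inI C (S * c) ->
  rprune s A B C -> excluded `|a| `|b| `|c|.
Proof.
move=> /inI_abs + /inI_abs + /inI_abs; rewrite !normrM !(gtr0_norm scale_gt0).
move=> /inI_unit hA /inI_unit hB /inI_unit hC; rewrite /rprune.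
have [? ? ? ?] := zexcl_sound hA hB hC; have [_ ? ? _] := zexcl_sound hB hA hC.
have [_ ? ? _] := zexcl_sound hC hA hB; have [_ _ _ ?] := zexcl_sound hA hC hB.
have [_ _ _ ?] := zexcl_sound hB hC hA.
rewrite /excluded => /orP[h|]; first by left; auto.
rewrite !orbA -!orbA => h; right; move: h.
by case/orP=> [?|/or3P[?|?|/or3P[?|?|/or3P[?|?|/orP[]?]]]]; [left; constructor 1|left; constructor 2|left; constructor 3
  |right; left; constructor 1|right; left; constructor 2|right; left; constructor 3
  |right; right; constructor 1|right; right; constructor 2|right; right; constructor 3]; auto.
Qed.
End Scale.
End EngineSoundness.

(** * Polynomial conditions on quadruples of labels *)

Section StepSoundness.
Variables (R : realFieldType) (sg : bool) (lu lv : label) (a b c : R).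
Notation lval := (lval a b c).
Notation sval := (sval a b c).
Notation u := (lval lu).
Notation v := (lval lv).

(** In a balanced cycle x2 + x4 is a multiple of x1 + x3, whence the first two relations. The third
    is the unit length in the orthogonal basis x1 + x3, x1 - x3, x2 - x4, and the fourth replaces x1
    + x3 by x2 + x4. *)
Definition pfact (y : quad) : Prop :=
  let: (y1, y2, y3, y4) := y in
  let s13 := lval y1 + lval y3 in let s24 := lval y2 + lval y4 in
  let d13 := lval y1 - lval y3 in let d24 := lval y2 - lval y4 in
  [/\ (1 + v) * s13 = 2 * a * s24, (1 + u) * s24 = 2 * a * s13,
      2 * (1 + u) * (1 - u) * (1 - v) = s13 ^+ 2 * (1 - u) * (1 - v)
        + d13 ^+ 2 * (1 + u) * (1 - v) + d24 ^+ 2 * (1 + u) * (1 - u)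
    & 2 * (1 + v) * (1 - u) * (1 - v) = s24 ^+ 2 * (1 - u) * (1 - v)
        + d13 ^+ 2 * (1 + v) * (1 - v) + d24 ^+ 2 * (1 + v) * (1 - u)].

Definition pdot (y z : quad) : R :=
  let: (y1, y2, y3, y4) := y in let: (z1, z2, z3, z4) := z in
  (lval y1 + lval y3) * (lval z1 + lval z3) * (1 - u) * (1 - v)
  + (lval y1 - lval y3) * (lval z1 - lval z3) * (1 + u) * (1 - v)
  + (lval y2 - lval y4) * (lval z2 - lval z4) * (1 + u) * (1 - u).

(** For a unit vector y this is 2 (1 + u)(1 - u) times the squared length of the component
    orthogonal to x1 and x3; [norm2] is the analogue for x2 and x4. *)
Definition norm1 (y1 y3 : R) :=
  2 * (1 + u) * (1 - u) - (y1 + y3) ^+ 2 * (1 - u) - (y1 - y3) ^+ 2 * (1 + u).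
Definition norm2 (y2 y4 : R) :=
  2 * (1 + v) * (1 - v) - (y2 + y4) ^+ 2 * (1 - v) - (y2 - y4) ^+ 2 * (1 + v).
Definition perp1 (y1 y2 y4 : R) := (1 - v) * y1 - a * (y2 - y4).
Definition perp2 (y1 y2 y3 : R) := (1 + u) * y2 - a * (y1 + y3).
Definition perp3 (y2 y3 y4 : R) := (1 + v) * y3 - a * (y2 + y4).
Definition perp4 (y1 y3 y4 : R) := (1 - u) * y4 + a * (y1 - y3).

(** The component of y normal to x1 and x3 can be measured along x2 or x4 ([perp2], [perp4]), and
    that normal to x2 and x4 along x1 or x3. The measurements must agree with the norm and with each
    other. Denominators are cleared because h2, h4, k2, k4 may vanish. *)
Definition mfact (y : quad) : Prop :=
  let: (l1, l2, l3, l4) := y in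
  let y1 := lval l1 in let y2 := lval l2 in let y3 := lval l3 in let y4 := lval l4 in
  let h2 := 1 + u - 2 * a ^+ 2 in let h4 := 1 - u - 2 * a ^+ 2 in
  let k2 := 1 + v - 2 * a ^+ 2 in let k4 := 1 - v - 2 * a ^+ 2 in
  let n1 := norm1 y1 y3 in let n2 := norm2 y2 y4 in
  let e1 := perp1 y1 y2 y4 in let e2 := perp2 y1 y2 y3 in
  let e3 := perp3 y2 y3 y4 in let e4 := perp4 y1 y3 y4 in
  [/\ 0 <= n1 /\ 0 <= n2, n1 * h2 = 2 * (1 - u) * e2 ^+ 2 /\ n1 * h4 = 2 * (1 + u) * e4 ^+ 2,
      n2 * k4 = 2 * (1 + v) * e1 ^+ 2 /\ n2 * k2 = 2 * (1 - v) * e3 ^+ 2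
    & v * (1 - u) * e2 = h2 * e4 /\ u * (1 + v) * e1 = k4 * e3].

(** The polarisation of [norm1] for two vectors with product x. The normal space is a line, so its
    square is the product of the two values of [norm1] (see [mdot]). *)
Definition plan1 (y z : quad) (x : R) : R :=
  let: (y1, y2, y3, y4) := y in let: (z1, z2, z3, z4) := z in
  2 * (1 + u) * (1 - u) * x - (lval y1 + lval y3) * (lval z1 + lval z3) * (1 - u)
  - (lval y1 - lval y3) * (lval z1 - lval z3) * (1 + u).
Definition plan2 (y z : quad) (x : R) : R :=
  let: (y1, y2, y3, y4) := y in let: (z1, z2, z3, z4) := z in
  2 * (1 + v) * (1 - v) * x - (lval y2 + lval y4) * (lval z2 + lval z4) * (1 - v)
  - (lval y2 - lval y4) * (lval z2 - lval z4) * (1 + v).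

Definition mdot (y z : quad) (x : R) : Prop :=
  let: (y1, y2, y3, y4) := y in let: (z1, z2, z3, z4) := z in
  [/\ plan1 y z x ^+ 2 = norm1 (lval y1) (lval y3) * norm1 (lval z1) (lval z3),
      plan2 y z x ^+ 2 = norm2 (lval y2) (lval y4) * norm2 (lval z2) (lval z4),
      (1 + u - 2 * a ^+ 2) * plan1 y z x = 2 * (1 - u)
        * perp2 (lval y1) (lval y2) (lval y3) * perp2 (lval z1) (lval z2) (lval z3)
    & (1 - u - 2 * a ^+ 2) * plan1 y z x = 2 * (1 + u)
        * perp4 (lval y1) (lval y3) (lval y4) * perp4 (lval z1) (lval z3) (lval z4)].

(* What a unit vector y, given by the labels of its inner products with the
   4-cycle, satisfies, and what it means for two of them to have product x. *)
Definition qfact (y : quad) : Prop := if sg then pfact y else mfact y.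
Definition qdot (y z : quad) (x : R) : Prop :=
  if sg then pdot y z = 2 * (1 + u) * (1 - u) * (1 - v) * x else mdot y z x.

Section Scale.
Variables (k s : Z).
Hypotheses (k_ge0 : (0 <= k)%BZ) (sE : s = (2 ^ k)%BZ).
Notation S := (zr R s).
Let S_gt0 : 0 < S := scale_gt0 R k_ge0 sE.
Let S0 : S != 0. Proof. exact: lt0r_neq0. Qed.

Lemma inI_shr' I (x : R) : inI I (S * x) -> inI (ishr k I) x.
Proof. by move=> /(inI_shr k_ge0 sE); rewrite mulrAC divff // mul1r. Qed.

Lemma inI_mulshr I J (x y : R) : inI I (S * x) -> inI J (S * y) ->
  inI (ishr k (imul I J)) (S * (x * y)).
Proof. by move=> hI hJ; apply: inI_shr'; apply: inI_eq (inI_mul hI hJ) _; ring. Qed.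

Lemma inI_sqrshr I (x : R) : inI I (S * x) -> inI (ishr k (isqr I)) (S * x ^+ 2).
Proof. by move=> hI; apply: inI_shr'; apply: inI_eq (inI_sqr hI) _; ring. Qed.

Section Box.
Variables A B C : itv.
Hypotheses (hA : inI A (S * a)) (hB : inI B (S * b)) (hC : inI C (S * c)).

Let hl : in3 a b c (T3 A B C) S. Proof. exact: in3_T3. Qed.
Let w0_in : in9 a b c (wtab A B C) S. Proof. exact: in9_wtab. Qed.
Let one_in : inI (s, s) S. Proof. by []. Qed.
Let pu_in : inI (iadd (s, s) (get3 (T3 A B C) lu)) (S * (1 + u)).
Proof. by rewrite mulrDr mulr1; apply: inI_add. Qed.
Let mu_in : inI (isub (s, s) (get3 (T3 A B C) lu)) (S * (1 - u)).
Proof. by rewrite mulrBr mulr1; apply: inI_sub. Qed.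
Let pv_in : inI (iadd (s, s) (get3 (T3 A B C) lv)) (S * (1 + v)).
Proof. by rewrite mulrDr mulr1; apply: inI_add. Qed.
Let mv_in : inI (isub (s, s) (get3 (T3 A B C) lv)) (S * (1 - v)).
Proof. by rewrite mulrBr mulr1; apply: inI_sub. Qed.
Let sq_in : in9q a b c (tmap (fun w => ishr k (isqr w)) (wtab A B C)) S.
Proof. by apply: in9_sqr w0_in _ => I x; exact: inI_sqrshr. Qed.

Lemma in9_mull t J (x y : R) : in9 a b c t x -> inI J y -> in9 a b c (tmap (imul J) t) (y * x).
Proof. by move=> ht hJ; apply: in9_map ht _ => I z h; rewrite -mulrA; exact: inI_mul. Qed.

Lemma in9q_mull t J (x y : R) : in9q a b c t x -> inI J y -> in9q a b c (tmap (imul J) t) (y * x).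
Proof. by move=> ht hJ; apply: in9q_map ht _ => I z h; rewrite -mulrA; exact: inI_mul. Qed.

Lemma in3_mull t J (x y : R) : in3 a b c t x -> inI J y -> in3 a b c (tmap3 (imul J) t) (y * x).
Proof. by move=> ht hJ; apply: in3_map ht _ => I z h; rewrite -mulrA; exact: inI_mul. Qed.

Lemma in9_mulr t J (x y : R) : in9 a b c t (S * x) -> inI J (S * y) ->
  in9 a b c (tmap (fun w => ishr k (imul w J)) t) (S * (x * y)).
Proof.
move=> ht hJ; apply: in9_map ht _ => I z h; apply: inI_shr'.
by apply: inI_eq (inI_mul h hJ) _; ring.
Qed.

Lemma in9q_mulr t J (x y : R) : in9q a b c t (S * x) -> inI J (S * y) ->
  in9q a b c (tmap (fun w => ishr k (imul w J)) t) (S * (x * y)).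
Proof.
move=> ht hJ; apply: in9q_map ht _ => I z h; apply: inI_shr'.
by apply: inI_eq (inI_mul h hJ) _; ring.
Qed.

Lemma in3_mulr t J (x y : R) : in3 a b c t (S * x) -> inI J (S * y) ->
  in3 a b c (tmap3 (fun w => ishr k (imul w J)) t) (S * (x * y)).
Proof.
move=> ht hJ; apply: in3_map ht _ => I z h; apply: inI_shr'.
by apply: inI_eq (inI_mul h hJ) _; ring.
Qed.

Lemma meet_target t t0 f (x : R) l : in3 a b c t0 S -> inI (iabs f) `|S * (x * lval l)| ->
    (forall I y, inI I (S * y) -> inI (t I) `|S * (x * y)|) ->
  [|| imeet (iabs f) (ta (tmap3 t t0)), imeet (iabs f) (tb (tmap3 t t0)) | imeet (iabs f) (tc (tmap3 t t0))].
Proof.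
move=> h0 hf ht; have h l' := ht _ _ (h0 l').
have [h1 h2 h3] := And3 (h La) (h Lb) (h Lc).
case: l hf => /=; rewrite ?mulrN ?normrN => hf;
  by rewrite ?(inI_meet hf h1 erefl) ?(inI_meet hf h2 erefl) ?(inI_meet hf h3 erefl) ?orbT.
Qed.

Let onew : in9 a b c (wtab A B C) (S * 1). Proof. by rewrite mulr1. Qed.
Let onel : in3 a b c (T3 A B C) (S * 1). Proof. by rewrite mulr1. Qed.
Let oneq : in9q a b c (tmap (fun w => ishr k (isqr w)) (wtab A B C)) (S * 1).
Proof. by rewrite mulr1. Qed.

Lemma ptest_sound y : pfact y -> ptest (mk_ptab lu lv k s A B C) y.
Proof.
have mumv := inI_mulshr mu_in mv_in; have pumv := inI_mulshr pu_in mv_in.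
have pumu := inI_mulshr pu_in mu_in; have pvmu := inI_mulshr pv_in mu_in.
have pvmv := inI_mulshr pv_in mv_in.
move: y => [[[y1 y2] y3] y4] [h1 h2 h3 h4]; apply/and4P; split.
- apply: inI_meet (inI_gets _ (in9_mull w0_in pv_in)) (inI_gets _ (in9_mull w0_in (inI_dbl hA))) _.
  by rewrite !sval_sum; transitivity (S ^+ 2 * ((1 + v) * (lval y1 + lval y3))); [ring|rewrite h1; ring].
- apply: inI_meet (inI_gets _ (in9_mull w0_in pu_in)) (inI_gets _ (in9_mull w0_in (inI_dbl hA))) _.
  by rewrite !sval_sum; transitivity (S ^+ 2 * ((1 + u) * (lval y2 + lval y4))); [ring|rewrite h2; ring].
- apply: inI_meet (inI_dbl (inI_mul pu_in mumv)) (inI_add (inI_add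
   (inI_getq _ (in9q_mull sq_in mumv)) (inI_getq _ (in9q_mull sq_in pumv))) (inI_getq _ (in9q_mull sq_in pumu))) _.
  rewrite !sval_dif !sval_sum; transitivity (S ^+ 2 * (2 * (1 + u) * (1 - u) * (1 - v))); first ring.
  by rewrite h3; ring.
- apply: inI_meet (inI_dbl (inI_mul pv_in mumv)) (inI_add (inI_add
   (inI_getq _ (in9q_mull sq_in mumv)) (inI_getq _ (in9q_mull sq_in pvmv))) (inI_getq _ (in9q_mull sq_in pvmu))) _.
  rewrite !sval_dif !sval_sum; transitivity (S ^+ 2 * (2 * (1 + v) * (1 - u) * (1 - v))); first ring.
  by rewrite h4; ring.
Qed.

Lemma pcompat_in y z :
  let: (s1, d1, e1, _) := pdata (mk_ptab lu lv k s A B C) y in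
  let: (s2, d2, _, e2) := pdata (mk_ptab lu lv k s A B C) z in
  inI (ishr k (iadd (iadd (getp (pp1 (mk_ptab lu lv k s A B C)) s1 s2)
                          (getp (pp2 (mk_ptab lu lv k s A B C)) d1 d2)) (imul e1 e2)))
    (S * pdot y z).
Proof.
have mumv := inI_mulshr mu_in mv_in; have pumv := inI_mulshr pu_in mv_in.
have pumu := inI_mulshr pu_in mu_in.
move: y z => [[[y1 y2] y3] y4] [[[z1 z2] z3] z4]; cbv beta iota delta [pdata].
apply: inI_shr'; apply: inI_eq (inI_add (inI_add
  (inI_getp _ _ (in99_prod w0_in (in9_mulr onew mumv)))
  (inI_getp _ _ (in99_prod w0_in (in9_mulr onew pumv))))
  (inI_mul (inI_gets _ w0_in) (inI_gets _ (in9_mulr onew pumu)))) _.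
by rewrite !sval_dif !sval_sum /pdot; ring.
Qed.

Lemma ptarget_in l :
  inI (ishr k (imul (ishr k (pkk1 (mk_ptab lu lv k s A B C))) (get3 (T3 A B C) l)))
    (S * (2 * (1 + u) * (1 - u) * (1 - v) * lval l)).
Proof.
have mumv := inI_mulshr mu_in mv_in; apply: inI_shr'.
apply: inI_eq (inI_mul (inI_shr' (x := S * (2 * (1 + u) * (1 - u) * (1 - v))) _) (hl l)) _; last ring.
by apply: inI_eq (inI_dbl (inI_mul pu_in mumv)) _; ring.
Qed.

Lemma pcompat_sound y z l : pdot y z = 2 * (1 + u) * (1 - u) * (1 - v) * lval l ->
  pcompat k (mk_ptab lu lv k s A B C) (pdata (mk_ptab lu lv k s A B C) y)
    (pdata (mk_ptab lu lv k s A B C) z).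
Proof.
move=> yz; have := pcompat_in y z; rewrite /pcompat /dcompat.
case: (pdata _ y) => [[[s1 d1] e1] e1']; case: (pdata _ z) => [[[s2 d2] e2] e2'].
rewrite yz => /inI_abs hf; have mumv := inI_mulshr mu_in mv_in.
apply: (meet_target hl hf) => I x hI; apply/inI_abs/inI_shr'.
apply: inI_eq (inI_mul (inI_shr' (x := S * (2 * (1 + u) * (1 - u) * (1 - v))) _) hI) _; last ring.
by apply: inI_eq (inI_dbl (inI_mul pu_in mumv)) _; ring.
Qed.

Let a2_in : inI (idbl (ishr k (isqr A))) (S * (2 * a ^+ 2)).
Proof. by apply: inI_eq (inI_dbl (inI_sqrshr hA)) _; ring. Qed.
Let sub_a2 I x : inI I (S * x) -> inI (isub I (idbl (ishr k (isqr A)))) (S * (x - 2 * a ^+ 2)).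
Proof. by move=> h; rewrite mulrBr; apply: inI_sub. Qed.
Let t := mk_mtab lu lv k s A B C.
Let aw_in : in9 a b c (maw t) (S * a).
Proof.
apply: in9_map w0_in _ => I x h; apply: inI_shr'.
by apply: inI_eq (inI_mul hA h) _; ring.
Qed.
Let y1_in : in3 a b c (my1 t) (S * (1 - v)).
Proof. by have := in3_mulr onel mv_in; rewrite mul1r. Qed.
Let y2_in : in3 a b c (my2 t) (S * (1 + u)).
Proof. by have := in3_mulr onel pu_in; rewrite mul1r. Qed.
Let y3_in : in3 a b c (my3 t) (S * (1 + v)).
Proof. by have := in3_mulr onel pv_in; rewrite mul1r. Qed.
Let y4_in : in3 a b c (my4 t) (S * (1 - u)).
Proof. by have := in3_mulr onel mu_in; rewrite mul1r. Qed.

Lemma mn1_in y1 y3 : inI (get6 (get6 (mn1 t) y1) y3) (S * norm1 (lval y1) (lval y3)).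
Proof.
rewrite /mn1 /= !get6_mk; apply: inI_eq (inI_sub (inI_dbl (inI_mulshr pu_in mu_in))
 (inI_add (inI_getq _ (in9q_mulr oneq mu_in)) (inI_getq _ (in9q_mulr oneq pu_in)))) _.
by rewrite !sval_dif !sval_sum /norm1; ring.
Qed.

Lemma mn2_in y2 y4 : inI (get6 (get6 (mn2 t) y2) y4) (S * norm2 (lval y2) (lval y4)).
Proof.
rewrite /mn2 /= !get6_mk; apply: inI_eq (inI_sub (inI_dbl (inI_mulshr pv_in mv_in))
 (inI_add (inI_getq _ (in9q_mulr oneq mv_in)) (inI_getq _ (in9q_mulr oneq pv_in)))) _.
by rewrite !sval_dif !sval_sum /norm2; ring.
Qed.

Let big1 (x y : R) := if mbig1 t then x else y.
Let big2 (x y : R) := if mbig2 t then x else y.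

Lemma me1_in y1 y2 y3 y4 : inI (me1 t y1 y2 y3 y4)
  (S * big1 (perp2 (lval y1) (lval y2) (lval y3)) (perp4 (lval y1) (lval y3) (lval y4))).
Proof.
rewrite /me1 /big1; case: (mbig1 t).
  by apply: inI_eq (inI_sub (y2_in _) (inI_gets _ aw_in)) _; rewrite sval_sum /perp2; ring.
by apply: inI_eq (inI_add (y4_in _) (inI_gets _ aw_in)) _; rewrite sval_dif /perp4; ring.
Qed.

Lemma me2_in y1 y2 y3 y4 : inI (me2 t y1 y2 y3 y4)
  (S * big2 (perp1 (lval y1) (lval y2) (lval y4)) (perp3 (lval y2) (lval y3) (lval y4))).
Proof.
rewrite /me2 /big2; case: (mbig2 t).
  by apply: inI_eq (inI_sub (y1_in _) (inI_gets _ aw_in)) _; rewrite sval_dif /perp1; ring.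
by apply: inI_eq (inI_sub (y3_in _) (inI_gets _ aw_in)) _; rewrite sval_sum /perp3; ring.
Qed.

Lemma inI_if (d : bool) I J (x y : R) : inI I x -> inI J y -> inI (if d then I else J) (if d then x else y).
Proof. by case: d. Qed.

Let h1_in : inI (mh1 t) (S * big1 (2 * (1 - u)) (2 * (1 + u))).
Proof. by rewrite /big1; case E: (mbig1 t); rewrite /t /mh1 /= in E *; rewrite E mulrCA; exact: inI_dbl. Qed.
Let h2_in : inI (mh2 t) (S * big2 (2 * (1 + v)) (2 * (1 - v))).
Proof. by rewrite /big2; case E: (mbig2 t); rewrite /t /mh2 /= in E *; rewrite E mulrCA; exact: inI_dbl. Qed.

Let HH : itv := if mbig1 t then isub (iadd (s, s) (get3 (T3 A B C) lu)) (idbl (ishr k (isqr A)))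
  else isub (isub (s, s) (get3 (T3 A B C) lu)) (idbl (ishr k (isqr A))).
Let KH : itv := if mbig2 t then isub (isub (s, s) (get3 (T3 A B C) lv)) (idbl (ishr k (isqr A)))
  else isub (iadd (s, s) (get3 (T3 A B C) lv)) (idbl (ishr k (isqr A))).
Let HH_in : inI HH (S * big1 (1 + u - 2 * a ^+ 2) (1 - u - 2 * a ^+ 2)).
Proof. by rewrite /HH /big1; case: (mbig1 t); exact: sub_a2. Qed.
Let KH_in : inI KH (S * big2 (1 - v - 2 * a ^+ 2) (1 + v - 2 * a ^+ 2)).
Proof. by rewrite /KH /big2; case: (mbig2 t); exact: sub_a2. Qed.
Let mnh1_in y1 y3 : inI (get6 (get6 (mnh1 t) y1) y3)
  (S * norm1 (lval y1) (lval y3) * (S * big1 (1 + u - 2 * a ^+ 2) (1 - u - 2 * a ^+ 2))).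
Proof. by have := inI_mul (mn1_in y1 y3) HH_in; rewrite /mnh1 /mn1 /= !get6_mk. Qed.
Let mnh2_in y2 y4 : inI (get6 (get6 (mnh2 t) y2) y4)
  (S * norm2 (lval y2) (lval y4) * (S * big2 (1 - v - 2 * a ^+ 2) (1 + v - 2 * a ^+ 2))).
Proof. by have := inI_mul (mn2_in y2 y4) KH_in; rewrite /mnh2 /mn2 /= !get6_mk. Qed.

Lemma mtest_sound y : mfact y -> mtest k t y.
Proof.
move: y => [[[y1 y2] y3] y4] [[n1 n2] [f1 f2] [f3 f4] [r1 r2]].
have vmu := inI_mulshr (hl lv) mu_in; have upv := inI_mulshr (hl lu) pv_in.
have ge0 I (x : R) : inI I (S * x) -> 0 <= x -> (0 <=? I.2)%BZ.
  by move=> [_ h] x0; rewrite -(zr_le R); apply: le_trans h; rewrite mulr_ge0 // ltW.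
apply/andP; split; first exact: ge0 (mn1_in y1 y3) n1.
apply/andP; split; first exact: ge0 (mn2_in y2 y4) n2.
apply/and4P; split.
- apply: inI_meet (mnh1_in y1 y3) (inI_mul h1_in (inI_sqrshr (me1_in y1 y2 y3 y4))) _.
  by rewrite /big1; case: (mbig1 t); rewrite [LHS]mulrACA; [rewrite f1|rewrite f2]; ring.
- apply: inI_meet (mnh2_in y2 y4) (inI_mul h2_in (inI_sqrshr (me2_in y1 y2 y3 y4))) _.
  by rewrite /big2; case: (mbig2 t); rewrite [LHS]mulrACA; [rewrite f3|rewrite f4]; ring.
- apply: inI_meet (inI_sub (in3_mull y2_in vmu _) (inI_gets _ (in9_mull aw_in vmu)))
    (inI_add (in3_mull y4_in (sub_a2 pu_in) _) (inI_gets _ (in9_mull aw_in (sub_a2 pu_in)))) _.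
  rewrite !sval_dif !sval_sum; transitivity (S ^+ 2 * (v * (1 - u) * perp2 (lval y1) (lval y2) (lval y3))).
    by rewrite /perp2; ring.
  by rewrite r1 /perp4; ring.
- apply: inI_meet (inI_sub (in3_mull y1_in upv _) (inI_gets _ (in9_mull aw_in upv)))
    (inI_sub (in3_mull y3_in (sub_a2 mv_in) _) (inI_gets _ (in9_mull aw_in (sub_a2 mv_in)))) _.
  rewrite !sval_dif !sval_sum; transitivity (S ^+ 2 * (u * (1 + v) * perp1 (lval y1) (lval y2) (lval y4))).
    by rewrite /perp1; ring.
  by rewrite r2 /perp3; ring.
Qed.

Let p1_in : in99 a b c (mp1 t) (S * (S * (1 - u))).
Proof. by have := in99_prod w0_in (in9_mulr onew mu_in); rewrite mul1r. Qed.
Let p2_in : in99 a b c (mp2 t) (S * (S * (1 + u))).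
Proof. by have := in99_prod w0_in (in9_mulr onew pu_in); rewrite mul1r. Qed.
Let p3_in : in99 a b c (mp3 t) (S * (S * (1 - v))).
Proof. by have := in99_prod w0_in (in9_mulr onew mv_in); rewrite mul1r. Qed.
Let p4_in : in99 a b c (mp4 t) (S * (S * (1 + v))).
Proof. by have := in99_prod w0_in (in9_mulr onew pv_in); rewrite mul1r. Qed.

Lemma mcompat_sound y z l : mdot y z (lval l) ->
  dcompat k (mtg t) (mq1 t) (mq2 t) (mdata k t y) (mdata k t z).
Proof.
move: y z => [[[y1 y2] y3] y4] [[[z1 z2] z3] z4] [_ _ d2 d4].
pose hh := big1 (1 + u - 2 * a ^+ 2) (1 - u - 2 * a ^+ 2).
have q_in p x : in99 a b c p (S * (S * x)) ->
    in99 a b c (tmap (tmap (fun x => imul HH (ishr k x))) p) (S * S * (hh * x)).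
  move=> hp; apply: in99_map hp _ => I w hI.
  apply: inI_eq (inI_mul HH_in (inI_shr' (x := S * x * w) _)) _; last by rewrite /hh; ring.
  by apply: inI_eq hI _; ring.
have kk_in := inI_mulshr (inI_eq (inI_dbl (inI_mulshr pu_in mu_in)) (mulrCA _ _ _)) HH_in.
apply: (meet_target (x := 2 * ((1 + u) * (1 - u)) * hh) (l := l) hl).
  apply/inI_abs/inI_shr'.
  apply: inI_eq (inI_add (inI_add (inI_getp _ _ (q_in _ _ p1_in)) (inI_getp _ _ (q_in _ _ p2_in)))
    (inI_mul (me1_in y1 y2 y3 y4) (inI_mulshr (me1_in z1 z2 z3 z4) h1_in))) _.
  rewrite !sval_dif !sval_sum; move: d2 d4; rewrite /plan1 /hh /big1.
  by case: (mbig1 t) => [d _|_ d]; [have := congr1 (fun x => S ^+ 2 * x) d|have := congr1 (fun x => S ^+ 2 * x) d];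
   move=> e; apply/eqP; rewrite -subr_eq0; move/eqP: e; rewrite -subr_eq0 => /eqP e; apply/eqP; rewrite -[RHS]oppr0 -{}e; ring.
move=> I x hI; apply/inI_abs/inI_shr'; by apply: inI_eq (inI_mul kk_in hI) _; rewrite /hh; ring.
Qed.

Lemma inI_pos I (x : R) : 0 <= x -> inI I (S * x) -> inI (Z.max 0 I.1, I.2) (S * x).
Proof. by move=> x0 [h1 h2]; split=> //=; rewrite zr_max ge_max h1 andbT mulr_ge0 // ltW. Qed.

Lemma fcompat_sound y z l : mfact y -> mfact z -> mdot y z (lval l) ->
  fcompat k t (fdata t y) (fdata t z).
Proof.
move: y z => [[[y1 y2] y3] y4] [[[z1 z2] z3] z4] [[yn1 yn2] _ _ _] [[zn1 zn2] _ _ _] [d1 d2 _ _].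
apply/hasP; exists l; rewrite ?mem_labels //.
apply/andP; split.
- apply: inI_meet (inI_sqr (inI_sub _ (inI_shr' (x := S * ((1 - u) * ((lval y1 + lval y3) * (lval z1 + lval z3))
     + (1 + u) * ((lval y1 - lval y3) * (lval z1 - lval z3)))) _)))
   (inI_mul (inI_pos yn1 (mn1_in _ _)) (inI_pos zn1 (mn1_in _ _))) _.
  + rewrite /ml1 /= get6_mk; exact: inI_mulshr (inI_eq (inI_dbl (inI_mulshr pu_in mu_in)) (mulrCA _ _ _)) (hl l).
  + by apply: inI_eq (inI_add (inI_getp _ _ p1_in) (inI_getp _ _ p2_in)) _; rewrite !sval_dif !sval_sum; ring.
  by rewrite [RHS]mulrACA -d1 /plan1; ring.
- apply: inI_meet (inI_sqr (inI_sub _ (inI_shr' (x := S * ((1 - v) * ((lval y2 + lval y4) * (lval z2 + lval z4))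
     + (1 + v) * ((lval y2 - lval y4) * (lval z2 - lval z4)))) _)))
   (inI_mul (inI_pos yn2 (mn2_in _ _)) (inI_pos zn2 (mn2_in _ _))) _.
  + rewrite /ml2 /= get6_mk; exact: inI_mulshr (inI_eq (inI_dbl (inI_mulshr pv_in mv_in)) (mulrCA _ _ _)) (hl l).
  + by apply: inI_eq (inI_add (inI_getp _ _ p3_in) (inI_getp _ _ p4_in)) _; rewrite !sval_dif !sval_sum; ring.
  by rewrite [RHS]mulrACA -d2 /plan2; ring.
Qed.

Lemma qdot_sym y z (x : R) : qdot y z x -> qdot z y x.
Proof.
rewrite /qdot; case: sg; move: y z => [[[y1 y2] y3] y4] [[[z1 z2] z3] z4].
  by move=> <-; rewrite /pdot; ring.
have p1 : plan1 (z1, z2, z3, z4) (y1, y2, y3, y4) x = plan1 (y1, y2, y3, y4) (z1, z2, z3, z4) x by rewrite /plan1; ring.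
have p2 : plan2 (z1, z2, z3, z4) (y1, y2, y3, y4) x = plan2 (y1, y2, y3, y4) (z1, z2, z3, z4) x by rewrite /plan2; ring.
by move=> [h1 h2 h3 h4]; split; rewrite ?p1 ?p2 ?h1 ?h2 ?h3 ?h4; ring.
Qed.

Lemma step_sound mx cs (Y : seq quad) : uniq Y -> (7 < size Y)%N -> (forall y, y \in Y -> qfact y) ->
    {in Y &, forall y z, y != z -> exists l, qdot y z (lval l)} ->
  {subset Y <= cs} -> {subset Y <= step sg lu lv mx k s A B C cs}.
Proof.
move=> uY sY TY PY Ycs.
pose P y z := [/\ y \in Y, z \in Y & exists l, qdot y z (lval l)].
have PP : {in Y &, forall y z, y != z -> P y z} by move=> y z yY zY /(PY y z yY zY).
have Psym y z : P y z -> P z y.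
  by move=> [? ? [l /qdot_sym ?]]; split=> //; exists l.
have ocore_sound D (cp : D -> D -> bool) data cs' : {subset Y <= cs'} ->
    (forall y z, P y z -> cp (data y) (data z)) -> {subset Y <= ocore cp data mx cs'}.
  move=> Ycs' hcp; have sz := leq_trans sY (uniq_leq_size uY Ycs').
  by rewrite /ocore sz; case: ifP => // _; exact: (core_sound Psym hcp uY sY PP).
rewrite /step; case E: sg; cbv zeta.
  apply: ocore_sound => [y yY|y z [_ _ [l]]].
    by rewrite mem_filter Ycs // ptest_sound //; have := TY y yY; rewrite /qfact E.
  by rewrite /qdot E; exact: pcompat_sound.
have TY' y : y \in Y -> mfact y by move=> /TY; rewrite /qfact E.
have Ycs' : {subset Y <= filter (mtest k t) cs}.
  by move=> y yY; rewrite mem_filter Ycs // mtest_sound //; exact: TY'.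
case: ifP => _; apply: ocore_sound => // y z [yY zY [l]]; rewrite /qdot E.
  by apply: fcompat_sound; exact: TY'.
exact: mcompat_sound.
Qed.

End Box.
End Scale.
End StepSoundness.

(** * Soundness of the search *)

Section SearchSoundness.
Variables (R : realFieldType) (sg : bool) (lu lv : label) (a b c : R) (Y : seq quad).
Notation lval := (lval a b c).
Variables (mx : nat -> nat) (ord : bool) (leaf : Z -> Z -> itv -> itv -> itv -> seq quad -> bool).
Hypotheses (eqn : cycle_eqn sg lu lv a b c) (nexcl : ~ excluded `|a| `|b| `|c|).
Hypothesis ordE : ord -> c <= b.
Hypotheses (uY : uniq Y) (sY : (7 < size Y)%N).
Hypothesis factY : forall y, y \in Y -> qfact sg lu lv a b c y.
Hypothesis dotY : {in Y &, forall y z, y != z -> exists l, qdot sg lu lv a b c y z (lval l)}.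

(** A successful search discards only boxes that miss (a, b, c), so the true parameters arrive at an
    accepted leaf. For a constantly false [leaf] this is a contradiction. *)
Definition leaf_reached : Prop := exists k s A B C cs,
  [/\ (0 <= k)%BZ /\ s = (2 ^ k)%BZ, inI A (zr R s * a), inI B (zr R s * b), inI C (zr R s * c)
    & {subset Y <= cs} /\ leaf k s A B C cs].

Lemma inI_halves (I : itv) (x : R) m : inI I x -> inI (I.1, m) x \/ inI (m, I.2) x.
Proof.
move=> [h1 h2]; case: (leP x (zr R m)) => h; [left|right]; split=> //=; exact: ltW.
Qed.

Lemma searchE n par k s A B C cs :
  search sg lu lv mx ord leaf n par k s A B C cs =
  if shave sg lu lv 12 s A B C is Some A then
    if rprune s A B C || (ord && (B.2 <? C.1)%BZ) then true else
    let cs := if mx n is m.+1 then step sg lu lv m k s A B C cs else cs in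
    if cs is [::] then true else
    if n is n.+1 then
      if par then
        let m := Z.shiftr ((idbl B).1 + (idbl B).2) 1 in
        search sg lu lv mx ord leaf n false (k + 1) (2 * s) (idbl A) ((idbl B).1, m) (idbl C) cs
        && search sg lu lv mx ord leaf n false (k + 1) (2 * s) (idbl A) (m, (idbl B).2) (idbl C) cs
      else
        let m := Z.shiftr (C.1 + C.2) 1 in
        search sg lu lv mx ord leaf n true k s A B (C.1, m) cs
        && search sg lu lv mx ord leaf n true k s A B (m, C.2) cs
    else leaf k s A B C cs
  else true.
Proof. by case: n. Qed.

Lemma search_sound n par k s A B C cs : (0 <= k)%BZ -> s = (2 ^ k)%BZ ->
    inI A (zr R s * a) -> inI B (zr R s * b) -> inI C (zr R s * c) -> {subset Y <= cs} ->
  search sg lu lv mx ord leaf n par k s A B C cs -> leaf_reached.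
Proof.
elim: n par k s A B C cs => [|n ih] par k s A B C cs k0 sE hA hB hC Ycs; rewrite searchE.
all: have [A' -> hA'] := shave_sound k0 sE 12 hA hB hC eqn.
all: case: ifP => [/orP[/(rprune_sound k0 sE hA' hB hC) //|/andP[/ordE cb]]|_].
1,3: rewrite -(zr_lt R) => h; have s0 := scale_gt0 R k0 sE; case: hB hC => [_ h1] [h2 _].
1,2: by move: (lt_le_trans (le_lt_trans h1 h) h2); rewrite ltr_pM2l // ltNge cb.
all: cbv zeta; set cs' := (X in if X is [::] then _ else _); rewrite -?/cs'.
all: have {Ycs} Ycs' : {subset Y <= cs'}
    by rewrite /cs'; case: (mx _) => // m; exact: (step_sound k0 sE hA' hB hC _ uY sY factY dotY Ycs).
all: case: cs' Ycs' => [|q cs'] Ycs'; first by case: (Y) sY Ycs' => // y ? _ /(_ y (mem_head _ _)).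
  by move=> hl; exists k, s, A', B, C, (q :: cs'); split.
case: par => /andP[h1 h2].
  have k1 : (0 <= k + 1)%BZ by lia.
  have sE1 : (2 * s)%BZ = (2 ^ (k + 1))%BZ by rewrite sE Z.pow_add_r //; lia.
  have dbl I (x : R) : inI I (zr R s * x) -> inI (idbl I) (zr R (2 * s) * x).
    by move=> h; rewrite zrM -mulrA; exact: inI_dbl.
  case: (inI_halves (Z.shiftr ((idbl B).1 + (idbl B).2) 1) (dbl _ _ hB)) => hB'.
    exact: (ih _ _ _ _ _ _ _ k1 sE1 (dbl _ _ hA') hB' (dbl _ _ hC) Ycs' h1).
  exact: (ih _ _ _ _ _ _ _ k1 sE1 (dbl _ _ hA') hB' (dbl _ _ hC) Ycs' h2).
case: (inI_halves (Z.shiftr (C.1 + C.2) 1) hC) => hC'.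
  exact: (ih _ _ _ _ _ _ _ k0 sE hA' hB hC' Ycs' h1).
exact: (ih _ _ _ _ _ _ _ k0 sE hA' hB hC' Ycs' h2).
Qed.

End SearchSoundness.

Lemma mem_allq l1 l2 l3 l4 : l1 \in [:: La; Lb; Lc] -> (l1, l2, l3, l4) \in allq.
Proof.
move=> h1; apply/flatten_mapP; exists l1 => //; apply/flatten_mapP; exists l2; rewrite ?mem_labels //.
by apply/flatten_mapP; exists l3; rewrite ?mem_labels //; apply/mapP; exists l4; rewrite ?mem_labels.
Qed.

(** * The exceptional case: recognising the matrix C *)

Definition hint : Type := (seq quad * (label * label * label) * seq (nat * bool))%type.

(* The 8-element cliques completing a balanced 4-cycle to 12 lines, with the
   signed values of alpha, beta, gamma and, for each row of the matrix C, the
   position (first the 4-cycle, then the clique) and sign of its vector. *)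
Definition hints : seq hint :=
  let a := La in let b := Na in let c := Lb in let d := Nb in let e := Lc in let f := Nc in [::
  ([:: (a, a, e, e); (a, e, f, c); (c, e, d, f); (c, f, e, a); (e, a, c, f); (e, c, f, d); (e, d, b, f); (e, e, a, a)],
   (b, e, c), [:: (0, false); (3, true); (4, true); (5, true); (1, true); (11, false); (10, false); (8, false); (9, false); (7, false); (2, false); (6, false)]);
  ([:: (a, c, f, e); (a, e, e, a); (c, a, e, f); (c, f, d, e); (e, a, a, e); (e, d, f, c); (e, f, b, d); (e, f, c, a)],
   (b, e, c), [:: (0, false); (1, true); (5, true); (4, true); (3, true); (8, false); (10, false); (11, false); (9, false); (6, false); (2, false); (7, false)]);
  ([:: (a, c, f, e); (a, e, f, c); (c, a, e, f); (c, f, e, a); (e, a, c, f); (e, d, b, f); (e, f, b, d); (e, f, c, a)],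
   (b, e, c), [:: (0, false); (1, true); (5, true); (3, true); (4, true); (8, false); (11, false); (10, false); (9, false); (2, false); (6, false); (7, false)]);
  ([:: (a, b, c, e); (a, d, f, b); (c, c, f, f); (c, e, a, b); (c, f, f, c); (e, a, b, c); (e, d, d, e); (e, e, d, d)],
   (c, a, f), [:: (0, false); (2, false); (7, false); (8, false); (6, false); (4, false); (3, false); (1, false); (5, false); (10, true); (11, true); (9, true)]);
  ([:: (a, b, f, d); (a, e, c, b); (c, b, a, e); (c, c, f, f); (c, f, f, c); (e, c, b, a); (e, d, d, e); (e, e, d, d)],
   (c, a, f), [:: (0, false); (2, false); (6, false); (7, false); (8, false); (5, false); (1, false); (3, false); (4, false); (11, true); (10, true); (9, true)]);
  ([:: (a, b, c, f); (a, d, e, b); (c, c, e, e); (c, e, e, c); (c, f, a, b); (e, b, a, d); (e, c, c, e); (e, e, c, c)],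
   (c, a, e), [:: (0, false); (2, false); (8, false); (7, false); (6, false); (4, false); (3, false); (1, false); (5, false); (10, false); (11, false); (9, false)]);
  ([:: (a, b, e, d); (a, f, c, b); (c, b, a, f); (c, c, e, e); (c, e, e, c); (e, c, c, e); (e, d, a, b); (e, e, c, c)],
   (c, a, e), [:: (0, false); (2, false); (6, false); (7, false); (8, false); (5, false); (1, false); (3, false); (4, false); (11, false); (9, false); (10, false)])].

(** The entries [La] on the diagonal are placeholders for 1; as labels only the entries off the
    diagonal matter. *)
Definition Cpat : seq (seq label) :=
  let a := La in let a' := Na in let b := Lb in let b' := Nb in let g := Lc in let g' := Nc in
  [:: [:: a; a; a; a; a; b; b; b; b; g; g; g]; [:: a; a; b; g; g; a; b; b; g; a; a; b];
      [:: a; b; a; g; a'; g; b'; g'; a; b; b'; a]; [:: a; g; g; a; b; b; a; g; b; a; b; a];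
      [:: a; g; a'; b; a; b'; g; a; g'; b; a; b']; [:: b; a; g; b; b'; a; g'; b'; a; g; a'; a];
      [:: b; b; b'; a; g; g'; a; a; b'; g; a; a']; [:: b; b; g'; g; a; b'; a; a; a'; a; g; b'];
      [:: b; g; a; b; g'; a; b'; a'; a; a; b'; g]; [:: g; a; b; a; b; g; g; a; a; a; b; b];
      [:: g; a; b'; b; a; a'; a; g; b'; b; a; g']; [:: g; b; a; a; b'; a; a'; b'; g; b; g'; a]].

Definition quad_nth (y : quad) (n : nat) : label :=
  let: (y1, y2, y3, y4) := y in nth y4 [:: y1; y2; y3] n.

Definition relabel (m : label * label * label) l : label :=
  let: (la, lb, lc) := m in
  match l with La => la | Na => lopp la | Lb => lb | Nb => lopp lb | Lc => lc | Nc => lopp lc end.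

Section Leaf.
Local Open Scope Z_scope.
Variables (k : Z) (t : ptab) (l3 : tab3).

Definition pairlabel (y z : quad) (l : label) : bool :=
  let: (s1, d1, e1, _) := pdata t y in let: (s2, d2, _, e2) := pdata t z in
  let f := ishr k (iadd (iadd (getp (pp1 t) s1 s2) (getp (pp2 t) d1 d2)) (imul e1 e2)) in
  imeet f (ishr k (imul (ishr k (pkk1 t)) (get3 l3 l))).

Local Close Scope Z_scope.

(** In the exceptional cycle both diagonals are b, and positions of equal parity are opposite. *)
Definition baselabel (i j : nat) : label := if odd (i + j) then La else Lb.

(** Positions below 4 belong to the cycle, the others to [K] after a shift by 4. The product of two
    members of [K] counts as identified when no label other than [l] is consistent with its
    enclosure. *)
Definition itemlabel (K : seq quad) (i j : nat) (l : label) : bool :=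
  let q n := nth (La, La, La, La) K (n - 4) in
  if (i < 4)%N then if (j < 4)%N then baselabel i j == l else quad_nth (q j) i == l
  else if (j < 4)%N then quad_nth (q i) j == l
  else all (fun l' => pairlabel (q i) (q j) l' ==> (l' == l)) labels.

Definition check_hint (K : seq quad) (h : hint) : bool :=
  let: (K', m, o) := h in
  if K' == K then all (fun j => all (fun i =>
    let: (e, x) := nth (0, false) o i in let: (f, y) := nth (0, false) o j in
    let l := relabel m (nth La (nth [::] Cpat i) j) in
    itemlabel K e f (if x (+) y then lopp l else l)) (iota 0 j)) (iota 0 12) else false.

(** The second conjunct makes the 8-clique maximal, which is what limits the system to 4 + 8
    lines. *)
Definition check_clique (cs K : seq quad) : bool :=
  has (check_hint K) hints
  && ~~ has (fun y => (y \notin K) && all (fun z => pcompat k t (pdata t y) (pdata t z)) K) cs.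

Fixpoint cliques (cs : seq quad) (n : nat) (l acc : seq quad) : bool :=
  if n is n'.+1 then
    if l is y :: l' then
      (if all (fun z => pcompat k t (pdata t z) (pdata t y)) acc then cliques cs n' l' (y :: acc) else true)
      && cliques cs n l' acc
    else true
  else check_clique cs (rev acc).

End Leaf.

Definition special_leaf (k s : Z) (a b c : itv) (cs : seq quad) : bool :=
  let cs := undup cs in cliques k (mk_ptab Lb Lb k s a b c) (T3 a b c) cs 8 cs [::].

(** The exceptional search has 17 levels; the shift by 9 aligns them with the first 17 of the 26
    levels of the others. *)
Definition special_budget n := budget (n + 9).

Section LeafSoundness.
Variables (R : realFieldType) (a b c : R) (Y : seq quad) (D : quad -> quad -> R).
Notation lval := (lval a b c).
Hypotheses (uY : uniq Y) (sY : (7 < size Y)%N).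
Hypothesis dotY : {in Y &, forall y z, y != z -> exists2 l, D y z = lval l &
  pdot Lb Lb a b c y z = 2 * (1 + b) * (1 - b) * (1 - b) * lval l}.

Definition itemdot (K : seq quad) (i j : nat) : R :=
  let q n := nth (La, La, La, La) K (n - 4) in
  if (i < 4)%N then if (j < 4)%N then lval (baselabel i j) else lval (quad_nth (q j) i)
  else if (j < 4)%N then lval (quad_nth (q i) j) else D (q i) (q j).

(* The signed vectors at positions o, among the 4-cycle and K, have the
   off-diagonal inner products of C(m.1, m.2, m.3). *)
Definition hint_holds (K : seq quad) (h : hint) : Prop :=
  let: (K', m, o) := h in
  [/\ K' = K & forall i j, (i < j < 12)%N ->
    let: (e, x) := nth (0, false)%N o i in let: (f, y) := nth (0, false)%N o j in
    (-1) ^+ (x (+) y) * itemdot K e f = lval (relabel m (nth La (nth [::] Cpat i) j))].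

Variables (k s : Z) (A B C : itv).
Hypotheses (k_ge0 : (0 <= k)%BZ) (sE : s = (2 ^ k)%BZ).
Hypotheses (hA : inI A (zr R s * a)) (hB : inI B (zr R s * b)) (hC : inI C (zr R s * c)).
Let t := mk_ptab Lb Lb k s A B C.

Lemma itemlabel_sound K e f l : {subset K <= Y} -> uniq K -> e != f -> (e < 12)%N -> (f < 12)%N ->
  size K = 8 -> itemlabel k t (T3 A B C) K e f l -> itemdot K e f = lval l.
Proof.
move=> KY uK ef e12 f12 sK; rewrite /itemlabel /itemdot.
case: ifP => e4; first by case: ifP => _ /eqP->.
case: ifP => f4; first by move=> /eqP->.
set y := nth _ _ _; set z := nth _ _ _.
have yK : y \in K by rewrite mem_nth // sK; lia.
have zK : z \in K by rewrite mem_nth // sK; lia.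
have yz : y != z by rewrite nth_uniq ?sK //; lia.
have [l' -> hl] := dotY (KY _ yK) (KY _ zK) yz.
move/allP/(_ l' (mem_labels _)) => /implyP h; congr (lval _); apply/eqP/h.
have := pcompat_in Lb Lb k_ge0 sE hA hB hC y z; rewrite -/t /pairlabel.
case: (pdata t y) => [[[s1 d1] e1] e1']; case: (pdata t z) => [[[s2 d2] e2] e2'] hf.
apply: inI_meet hf (ptarget_in Lb Lb k_ge0 sE hA hB hC l') _.
by rewrite hl.
Qed.

Lemma check_hint_sound K h : {subset K <= Y} -> uniq K -> size K = 8 ->
  h \in hints -> check_hint k t (T3 A B C) K h -> hint_holds K h.
Proof.
move=> KY uK sK hh; have {hh} : all (fun i => ((nth (0, false)%N h.2 i).1 < 12)%N) (iota 0 12)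
  && uniq (map fst h.2) && (size h.2 == 12%N).
  by move: h hh; apply/allP; vm_compute.
case/andP=> [/andP[/allP h12 uo] /eqP so]; move: h h12 uo so => [[K' m] o]; rewrite [(_, _, _).2]/= => h12 uo so.
rewrite /check_hint; case: eqP => //.
move=> EK /allP hall; split=> // i j /andP[ij j12].
have i12 : (i < 12)%N := ltn_trans ij j12.
have /hall/allP/(_ i) : j \in iota 0 12 by rewrite mem_iota.
rewrite mem_iota => /(_ ij).
have := h12 i; have := h12 j; rewrite !mem_iota => /(_ j12) + /(_ i12).
have : (nth (0, false)%N o i).1 != (nth (0, false)%N o j).1.
  have nE n : (n < 12)%N -> (nth (0, false)%N o n).1 = nth 0%N (map fst o) n.
    by move=> n12; rewrite (nth_map (0, false)%N) // so.
  by rewrite !nE // nth_uniq ?size_map ?so // neq_ltn ij.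
case: (nth _ o i) => e x; case: (nth _ o j) => f y /= ef f12 e12 hl.
rewrite (itemlabel_sound KY uK ef e12 f12 sK hl).
by case: (x (+) y); rewrite ?lval_opp ?expr1 ?mulN1r ?opprK ?expr0 ?mul1r.
Qed.

Lemma compatY y z : y \in Y -> z \in Y -> y != z -> pcompat k t (pdata t y) (pdata t z).
Proof. by move=> yY zY /(dotY yY zY)[l _]; apply: pcompat_sound. Qed.

Lemma cliques_sound cs n l acc K : cliques k t (T3 A B C) cs n l acc -> subseq K l -> size K = n ->
  {subset acc <= Y} -> {subset K <= Y} -> uniq (rev acc ++ K) ->
  check_clique k t (T3 A B C) cs (rev acc ++ K).
Proof.
elim: n l acc K => [|n ihn] l acc K; first by move=> + _ /size0nil->; rewrite cats0; case: l.
elim: l acc K => [|y l ihl] acc K; first by move=> _ /eqP->.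
move=> /= /andP[h1 h2]; case: K => // z K; case: eqP => [->|_] sub [sK] accY KY u; last first.
  by apply: ihl => //=; rewrite sK.
rewrite -cat_rcons -rev_cons; apply: (ihn l) => //.
- move: h1; suff -> : all (fun z => pcompat k t (pdata t z) (pdata t y)) acc by [].
  apply/allP => x xacc; apply: compatY; [exact: accY|apply: KY; exact: mem_head|].
  by apply: contraTneq u => <-; rewrite cat_uniq /= mem_rev xacc andbF.
- by move=> x; rewrite inE => /predU1P[->|/accY//]; apply: KY; exact: mem_head.
- by move=> x xK; apply: KY; rewrite inE xK orbT.
- by rewrite rev_cons cat_rcons.
Qed.

(** The first eight members of [Y] in the order of the candidates form a clique that was checked. A
    ninth would be compatible with all of them, against maximality. *)
Lemma special_leaf_sound cs : {subset Y <= cs} -> special_leaf k s A B C cs ->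
  size Y = 8 /\ exists K h, [/\ perm_eq K Y, h \in hints & hint_holds K h].
Proof.
rewrite /special_leaf -/t => Ycs hcl; pose K := filter (mem Y) (undup cs).
have uK : uniq K by rewrite filter_uniq // undup_uniq.
have pK : perm_eq K Y.
  by apply: uniq_perm => // x; rewrite mem_filter mem_undup /=; case xY: (x \in Y) => //=; rewrite Ycs.
have sK8 : size (take 8 K) = 8 by rewrite size_takel // (perm_size pK).
have KY : {subset take 8 K <= Y} by move=> x /mem_take; rewrite (perm_mem pK).
have u8 : uniq (take 8 K) by rewrite take_uniq.
have := cliques_sound hcl (subseq_trans (take_subseq K 8) (filter_subseq _ _)) sK8 (fun _ => ltac:(done)) KY u8.
case/andP=> /hasP[h hh hc] hno.
have s8 : size Y = 8.
  apply/eqP; rewrite eqn_leq sY andbT leqNgt; apply: contra hno => s9.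
  have d9 : (8 < size K)%N by rewrite (perm_size pK).
  pose y := nth (La, La, La, La) K 8.
  have yK : y \notin take 8 K.
    by move: uK; rewrite -{1}(cat_take_drop 8 K) cat_uniq (drop_nth (La, La, La, La) d9) /= negb_or => /and3P[_ /andP[]].
  have yY : y \in Y by rewrite -(perm_mem pK) mem_nth.
  apply/hasP; exists y; first by rewrite mem_undup Ycs.
  rewrite yK; apply/allP => z zK; apply: compatY => //; first exact: KY.
  by apply: contraNneq yK => ->.
split=> //; exists K, h; rewrite -{2}(@take_oversize _ 8 K) ?(perm_size pK) ?s8 //.
by split=> //; exact: check_hint_sound.
Qed.

End LeafSoundness.

(** * Inner products in three-dimensional space *)

Section Dot.
Variable R : realType.
Notation V := 'rV[R]_3.
Implicit Types (x y z : V) (a b : R).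

Lemma dotE x y : dotp x y = x 0 0 * y 0 0 + x 0 1 * y 0 1 + x 0 2%:R * y 0 2%:R.
Proof.
rewrite /dotp !big_ord_recl big_ord0 addr0 addrA.
by congr (_ * _ + _ * _ + _ * _); congr (_ 0 _); exact/val_inj.
Qed.

Lemma row3P x y : x 0 0 = y 0 0 -> x 0 1 = y 0 1 -> x 0 2%:R = y 0 2%:R -> x = y.
Proof.
move=> h0 h1 h2; apply/rowP => i; case: i => -[|[|[|//]]] hi.
- by rewrite (_ : Ordinal hi = 0) //; exact/val_inj.
- by rewrite (_ : Ordinal hi = 1) //; exact/val_inj.
- by rewrite (_ : Ordinal hi = 2%:R) //; exact/val_inj.
Qed.

Lemma dotC x y : dotp x y = dotp y x.
Proof. by rewrite !dotE; ring. Qed.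
Lemma dotDl x y z : dotp (x + y) z = dotp x z + dotp y z.
Proof. by rewrite !dotE !mxE; ring. Qed.
Lemma dotDr x y z : dotp x (y + z) = dotp x y + dotp x z.
Proof. by rewrite !dotE !mxE; ring. Qed.
Lemma dotNl x y : dotp (- x) y = - dotp x y.
Proof. by rewrite !dotE !mxE; ring. Qed.
Lemma dotNr x y : dotp x (- y) = - dotp x y.
Proof. by rewrite !dotE !mxE; ring. Qed.
Lemma dotZl a x y : dotp (a *: x) y = a * dotp x y.
Proof. by rewrite !dotE !mxE; ring. Qed.
Lemma dotZr a x y : dotp x (a *: y) = a * dotp x y.
Proof. by rewrite !dotE !mxE; ring. Qed.
Definition dot_lin := (dotDl, dotDr, dotNl, dotNr, dotZl, dotZr).

Lemma dot_ge0 x : 0 <= dotp x x.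
Proof. by rewrite dotE -!expr2 !addr_ge0 ?sqr_ge0. Qed.

Lemma dot_eq0 x : dotp x x = 0 -> x = 0.
Proof.
rewrite dotE -!expr2 => /eqP; rewrite !paddr_eq0 ?addr_ge0 ?sqr_ge0 // !sqrf_eq0.
by case/andP=> /andP[/eqP h0 /eqP h1] /eqP h2; apply: row3P; rewrite !mxE.
Qed.

(** The expansion in an orthogonal basis with denominators cleared, so that it also holds when one
    of s, t, d vanishes. Otherwise the matrix F with rows s, t, d has F F^T diagonal, and inverting
    this on the other side gives the identity. *)
Lemma parseval s t d y z : dotp s t = 0 -> dotp s d = 0 -> dotp t d = 0 ->
  dotp y z * (dotp s s * dotp t t * dotp d d) =
  dotp y s * dotp z s * (dotp t t * dotp d d) + dotp y t * dotp z t * (dotp s s * dotp d d)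
  + dotp y d * dotp z d * (dotp s s * dotp t t).
Proof.
move=> st sd td.
have [s0|s0] := eqVneq (dotp s s) 0.
  by rewrite (dot_eq0 s0) !dotE !mxE; ring.
have [t0|t0] := eqVneq (dotp t t) 0.
  by rewrite (dot_eq0 t0) !dotE !mxE; ring.
have [d0|d0] := eqVneq (dotp d d) 0.
  by rewrite (dot_eq0 d0) !dotE !mxE; ring.
pose F : 'M[R]_3 := \matrix_(i < 3) nth 0 [:: s; t; d] i.
pose n := \row_(i < 3) nth 0 [:: dotp s s; dotp t t; dotp d d] i.
pose m := \row_(i < 3) nth 0 [:: (dotp s s)^-1; (dotp t t)^-1; (dotp d d)^-1] i.
have dotM (p q : V) : p *m q^T = (dotp p q)%:M.
  by apply/matrixP => i j; rewrite !ord1 !mxE /= mulr1n; apply: eq_bigr => k _; rewrite mxE.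
have FF : F *m F^T = diag_mx n.
  apply/matrixP => i j; rewrite !mxE.
  have -> : \sum_k F i k * F^T k j = dotp (nth 0 [:: s; t; d] i) (nth 0 [:: s; t; d] j).
    by apply: eq_bigr => k _; rewrite !mxE.
  case: i j => -[|[|[|//]]] ? [[|[|[|//]]] ?] /=;
    by rewrite ?mulr1n ?mulr0n // ?st ?sd ?td // dotC ?st ?sd ?td.
have nm : diag_mx n *m diag_mx m = 1%:M.
  rewrite mulmx_diag; apply/matrixP => i j; rewrite !mxE; case: (i == j); rewrite // ?mulr1n.
  by case: i => -[|[|[|//]]] ? /=; rewrite divff.
have FmF : F^T *m diag_mx m *m F = 1%:M by apply: mulmx1C; rewrite mulmxA FF nm.
have <- : (y *m (F^T *m diag_mx m *m F) *m z^T) 0 0 = dotp y z.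
  by rewrite FmF mulmx1 dotM mxE mulr1n.
rewrite !mulmxA -[_ *m F *m z^T]mulmxA.
have -> : y *m F^T *m diag_mx m *m (F *m z^T) = (\sum_i (y *m F^T) 0 i * m 0 i * (F *m z^T) i 0)%:M.
  by apply/matrixP => i j; rewrite !ord1 !mxE mulr1n; apply: eq_bigr => k _; rewrite mul_mx_diag !mxE.
rewrite mxE mulr1n.
have yF i : (y *m F^T) 0 i = dotp y (nth 0 [:: s; t; d] i).
  by rewrite !mxE; apply: eq_bigr => k _; rewrite !mxE.
have zF i : (F *m z^T) i 0 = dotp z (nth 0 [:: s; t; d] i).
  by rewrite !mxE; apply: eq_bigr => k _; rewrite !mxE mulrC.
rewrite !big_ord_recl big_ord0 !yF !zF !mxE /=.
by field; rewrite s0 t0 d0.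
Qed.

Lemma dot_sum0 s t d y : dotp s t = 0 -> dotp s d = 0 -> dotp t d = 0 ->
    s != 0 -> t != 0 -> d != 0 -> dotp y s = 0 -> dotp y t = 0 -> dotp y d = 0 -> y = 0.
Proof.
move=> st sd td s0 t0 d0 ys yt yd; apply: dot_eq0.
have n0 x : x != 0 -> dotp x x != 0 by apply: contraNneq => /dot_eq0->.
have := parseval y y st sd td; rewrite ys yt yd !mul0r !add0r => /eqP.
by rewrite !mulf_eq0 (negPf (n0 _ s0)) (negPf (n0 _ t0)) (negPf (n0 _ d0)) !orbF => /eqP.
Qed.

Lemma cauchy x y : dotp x y ^+ 2 <= dotp x x * dotp y y.
Proof.
rewrite -subr_ge0 !dotE.
have -> : (x 0 0 * x 0 0 + x 0 1 * x 0 1 + x 0 2%:R * x 0 2%:R) *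
   (y 0 0 * y 0 0 + y 0 1 * y 0 1 + y 0 2%:R * y 0 2%:R) -
   (x 0 0 * y 0 0 + x 0 1 * y 0 1 + x 0 2%:R * y 0 2%:R) ^+ 2 =
   (x 0 0 * y 0 1 - x 0 1 * y 0 0) ^+ 2 + (x 0 0 * y 0 2%:R - x 0 2%:R * y 0 0) ^+ 2
   + (x 0 1 * y 0 2%:R - x 0 2%:R * y 0 1) ^+ 2 by ring.
by rewrite !addr_ge0 ?sqr_ge0.
Qed.

End Dot.

(** * Geometry of the 4-cycle *)

Section Cycle.
Variable R : realType.
Notation V := 'rV[R]_3.

(** The product of the four side products does not change when vectors are negated, so its sign
    distinguishes the two kinds of cycle; [sg] is true for balanced ones. *)
Record cycle (sg : bool) (a u v : R) (x1 x2 x3 x4 : V) : Prop := Cycle {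
  cyc11 : dotp x1 x1 = 1; cyc22 : dotp x2 x2 = 1; cyc33 : dotp x3 x3 = 1; cyc44 : dotp x4 x4 = 1;
  cyc12 : dotp x1 x2 = a; cyc23 : dotp x2 x3 = a; cyc34 : dotp x3 x4 = a;
  cyc41 : dotp x4 x1 = if sg then a else - a;
  cyc13 : dotp x1 x3 = u; cyc24 : dotp x2 x4 = v; cyc_u : `|u| < 1; cyc_v : `|v| < 1 }.

Lemma cycleE sg a u v x1 x2 x3 x4 : cycle sg a u v x1 x2 x3 x4 ->
  let a' := if sg then a else - a in
  ((dotp x1 x1 = 1) * (dotp x2 x2 = 1) * (dotp x3 x3 = 1) * (dotp x4 x4 = 1)) *
  ((dotp x1 x2 = a) * (dotp x2 x1 = a) * (dotp x2 x3 = a) * (dotp x3 x2 = a)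
   * (dotp x3 x4 = a) * (dotp x4 x3 = a) * (dotp x4 x1 = a') * (dotp x1 x4 = a')) *
  ((dotp x1 x3 = u) * (dotp x3 x1 = u) * (dotp x2 x4 = v) * (dotp x4 x2 = v)).
Proof. by case=> *; do !split=> //; rewrite dotC. Qed.

Lemma cycle_rot a u v x1 x2 x3 x4 : cycle true a u v x1 x2 x3 x4 -> cycle true a v u x2 x3 x4 x1.
Proof. by case=> *; split=> //; rewrite dotC. Qed.

(** Rotation moves the negative side; negating x1 restores its place and reverses the diagonal u. *)
Lemma cycle_rotN a u v x1 x2 x3 x4 : cycle false a u v x1 x2 x3 x4 ->
  cycle false a v (- u) x2 x3 x4 (- x1).
Proof.
case=> h1 h2 h3 h4 h12 h23 h34 h41 h13 h24 hu hv; by split; rewrite ?dot_lin ?opprK ?normrN ?h41 ?h12 ?opprK // dotC h13.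
Qed.

Lemma cycle_reflN a u v x1 x2 x3 x4 : cycle false a u v x1 x2 x3 x4 ->
  cycle false a v u x4 x3 x2 x1.
Proof. by case=> *; split=> //; rewrite dotC. Qed.

Section Balanced.
Variables (a u v : R) (x1 x2 x3 x4 : V).
Hypothesis C : cycle true a u v x1 x2 x3 x4.
Let E := cycleE C.
Let s := x1 + x3.
Let t := x1 - x3.
Let d := x2 - x4.
Let pu : 1 + u != 0. Proof. by have := cyc_u C; rewrite ltr_norml => /andP[? ?]; apply: lt0r_neq0; lra. Qed.
Let mu : 1 - u != 0. Proof. by have := cyc_u C; rewrite ltr_norml => /andP[? ?]; apply: lt0r_neq0; lra. Qed.
Let pv : 1 + v != 0. Proof. by have := cyc_v C; rewrite ltr_norml => /andP[? ?]; apply: lt0r_neq0; lra. Qed.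
Let mv : 1 - v != 0. Proof. by have := cyc_v C; rewrite ltr_norml => /andP[? ?]; apply: lt0r_neq0; lra. Qed.
Let two : (2 : R) != 0. Proof. by rewrite pnatr_eq0. Qed.
Let st : dotp s t = 0. Proof. by rewrite /s /t !dot_lin !E; ring. Qed.
Let sd : dotp s d = 0. Proof. by rewrite /s /d !dot_lin !E; ring. Qed.
Let td : dotp t d = 0. Proof. by rewrite /t /d !dot_lin !E; ring. Qed.
Let ss : dotp s s = 2 * (1 + u). Proof. by rewrite /s !dot_lin !E; ring. Qed.
Let tt' : dotp t t = 2 * (1 - u). Proof. by rewrite /t !dot_lin !E; ring. Qed.
Let dd : dotp d d = 2 * (1 - v). Proof. by rewrite /d !dot_lin !E; ring. Qed.

Lemma balanced_dot y z : dotp y z * (2 * (1 + u) * (1 - u) * (1 - v)) =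
  dotp y s * dotp z s * (1 - u) * (1 - v) + dotp y t * dotp z t * (1 + u) * (1 - v)
  + dotp y d * dotp z d * (1 + u) * (1 - u).
Proof.
have := parseval y z st sd td; rewrite ss tt' dd => h.
have four : (4 : R) != 0 by rewrite pnatr_eq0.
by apply: (mulfI four); transitivity (dotp y z * (2 * (1 + u) * (2 * (1 - u)) * (2 * (1 - v)))); [ring|rewrite h; ring].
Qed.

(** This is [balanced_dot] for x2 with itself. *)
Lemma balanced_eqn : (1 + u) * (1 + v) = 4 * a ^+ 2.
Proof.
have := balanced_dot x2 x2; rewrite /s /t /d !dot_lin !E => h.
apply: (mulfI mu); apply: (mulfI mv); apply/eqP; rewrite -subr_eq0; apply/eqP.
transitivity (1 * (2 * (1 + u) * (1 - u) * (1 - v)) - ((a + a) * (a + a) * (1 - u) * (1 - v) + (a - a) * (a - a) * (1 + u) * (1 - v) + (1 - v) * (1 - v) * (1 + u) * (1 - u))); first ring.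
by rewrite h; ring.
Qed.

Lemma balanced_a : a != 0.
Proof.
by apply: contraNneq pu => a0; have := balanced_eqn; rewrite a0 expr0n /= mulr0 => /eqP; rewrite mulf_eq0 (negPf pv) orbF.
Qed.

(** x2 + x4 is orthogonal to x1 - x3 and to x2 - x4, hence a multiple of x1 + x3. *)
Lemma balanced_rel1 y : (1 + u) * (dotp y x2 + dotp y x4) = 2 * a * (dotp y x1 + dotp y x3).
Proof.
have := balanced_dot y (x2 + x4); rewrite /s /t /d !dot_lin !E => h.
apply: (mulfI mu); apply: (mulfI mv); apply: (mulfI two).
transitivity ((dotp y x2 + dotp y x4) * (2 * (1 + u) * (1 - u) * (1 - v))); first ring.
by rewrite h; ring.
Qed.

Lemma balanced_rel2 y : (1 + v) * (dotp y x1 + dotp y x3) = 2 * a * (dotp y x2 + dotp y x4).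
Proof.
apply: (mulfI balanced_a); apply: (mulfI two).
transitivity ((1 + v) * (2 * a * (dotp y x1 + dotp y x3))); first ring.
rewrite -balanced_rel1; transitivity ((1 + u) * (1 + v) * (dotp y x2 + dotp y x4)); first ring.
by rewrite balanced_eqn; ring.
Qed.

Lemma balanced_norm2 y : dotp y y = 1 ->
  2 * (1 + v) * (1 - u) * (1 - v) = (dotp y x2 + dotp y x4) ^+ 2 * (1 - u) * (1 - v)
   + (dotp y x1 - dotp y x3) ^+ 2 * (1 + v) * (1 - v) + (dotp y x2 - dotp y x4) ^+ 2 * (1 + v) * (1 - u).
Proof.
move=> yy; have := balanced_dot y y; rewrite yy /s /t /d !dot_lin mul1r => h.
apply: (mulfI pu); transitivity ((1 + v) * (2 * (1 + u) * (1 - u) * (1 - v))); first ring.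
have e : (1 + u) * (dotp y x2 + dotp y x4) ^+ 2 = (1 + v) * (dotp y x1 + dotp y x3) ^+ 2.
  apply: (mulfI pu); transitivity (((1 + u) * (dotp y x2 + dotp y x4)) ^+ 2); first ring.
  rewrite balanced_rel1; transitivity (4 * a ^+ 2 * (dotp y x1 + dotp y x3) ^+ 2); first ring.
  by rewrite -balanced_eqn; ring.
rewrite h; transitivity ((1 + v) * (dotp y x1 + dotp y x3) ^+ 2 * (1 - u) * (1 - v)
  + (1 + v) * (1 + u) * ((dotp y x1 - dotp y x3) ^+ 2 * (1 - v) + (dotp y x2 - dotp y x4) ^+ 2 * (1 - u))); first ring.
by rewrite -e; ring.
Qed.

Lemma balanced_inj y z : dotp y x1 = dotp z x1 -> dotp y x2 = dotp z x2 ->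
  dotp y x3 = dotp z x3 -> dotp y x4 = dotp z x4 -> y = z.
Proof.
move=> h1 h2 h3 h4; apply/eqP; rewrite -subr_eq0; apply/eqP.
have n0 (x : V) k : dotp x x = 2 * k -> k != 0 -> x != 0.
  by move=> xx; apply: contraNneq => x0; move/eqP: xx; rewrite x0 dotE !mxE !mul0r !addr0 eq_sym mulf_eq0 (negPf two).
apply: (dot_sum0 st sd td); rewrite ?(n0 _ _ ss) ?(n0 _ _ tt') ?(n0 _ _ dd) //;
  by rewrite /s /t /d !dot_lin ?h1 ?h2 ?h3 ?h4; ring.
Qed.

End Balanced.

Section Unbalanced.
Variables (a u v : R) (x1 x2 x3 x4 : V).
Hypothesis C : cycle false a u v x1 x2 x3 x4.
Let E := cycleE C.
Let s := x1 + x3.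
Let t := x1 - x3.
Let e := (1 + u) *: x2 - a *: (x1 + x3).
Let pu0 : 0 < 1 + u. Proof. by have := cyc_u C; rewrite ltr_norml => /andP[? ?]; lra. Qed.
Let pu : 1 + u != 0. Proof. exact: lt0r_neq0. Qed.
Let mu : 1 - u != 0. Proof. by have := cyc_u C; rewrite ltr_norml => /andP[? ?]; apply: lt0r_neq0; lra. Qed.
Let two : (2 : R) != 0. Proof. by rewrite pnatr_eq0. Qed.
Let st : dotp s t = 0. Proof. by rewrite /s /t !dot_lin !E; ring. Qed.
Let se : dotp s e = 0. Proof. by rewrite /s /e !dot_lin !E; ring. Qed.
Let te : dotp t e = 0. Proof. by rewrite /t /e !dot_lin !E; ring. Qed.
Let ss : dotp s s = 2 * (1 + u). Proof. by rewrite /s !dot_lin !E; ring. Qed.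
Let tt' : dotp t t = 2 * (1 - u). Proof. by rewrite /t !dot_lin !E; ring. Qed.
Let ee : dotp e e = (1 + u) * (1 + u - 2 * a ^+ 2). Proof. by rewrite /e !dot_lin !E; ring. Qed.
Notation H := (1 + u - 2 * a ^+ 2).

Lemma unbalanced_H : 0 <= H.
Proof. by rewrite -(pmulr_rge0 _ pu0) -ee dot_ge0. Qed.

(** The third basis vector [e] is 1 + u times the component of x2 orthogonal to x1 and x3. Its
    squared length (1 + u) H may be zero, hence the factor H on the left. *)
Lemma unbalanced_dot y z :
  H * (2 * (1 + u) * (1 - u) * dotp y z - dotp y s * dotp z s * (1 - u) - dotp y t * dotp z t * (1 + u))
  = 2 * (1 - u) * dotp y e * dotp z e.
Proof.
have := parseval y z st se te; rewrite ss tt' ee => h.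
apply: (mulfI pu); apply: (mulfI two).
apply/eqP; rewrite -subr_eq0; apply/eqP.
transitivity (dotp y z * (2 * (1 + u) * (2 * (1 - u)) * ((1 + u) * H)) -
  (dotp y s * dotp z s * (2 * (1 - u) * ((1 + u) * H)) + dotp y t * dotp z t * (2 * (1 + u) * ((1 + u) * H)) +
   dotp y e * dotp z e * (2 * (1 + u) * (2 * (1 - u))))); first ring.
by rewrite h subrr.
Qed.

Lemma unbalanced_eqn : (1 - 2 * a ^+ 2) ^+ 2 = u ^+ 2 + v ^+ 2 - u ^+ 2 * v ^+ 2.
Proof.
have := unbalanced_dot x4 x4; rewrite /s /t /e !dot_lin !E => h.
apply: (mulfI pu); apply: (mulfI two); apply/eqP; rewrite -subr_eq0; apply/eqP.
move/eqP: h; rewrite -subr_eq0 => /eqP h; rewrite -[RHS]h; ring.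
Qed.

Lemma unbalanced_rel y : v * (1 - u) * dotp y e = H * ((1 - u) * dotp y x4 + a * dotp y t).
Proof.
have := unbalanced_dot y x4; rewrite /s /t /e !dot_lin !E => h.
apply: (mulfI pu); apply: (mulfI two); apply/eqP; rewrite -subr_eq0; apply/eqP.
move/eqP: h; rewrite -subr_eq0 => /eqP h; rewrite -[RHS]oppr0 -h; ring.
Qed.

Lemma unbalanced_inj y z : H != 0 -> dotp y x1 = dotp z x1 -> dotp y x2 = dotp z x2 ->
  dotp y x3 = dotp z x3 -> y = z.
Proof.
move=> H0 h1 h2 h3; apply/eqP; rewrite -subr_eq0; apply/eqP.
have n0 (x : V) k : dotp x x = k -> k != 0 -> x != 0.
  by move=> <-; apply: contraNneq => ->; rewrite dotE !mxE !mul0r !addr0.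
apply: (dot_sum0 st se te); rewrite ?(n0 _ _ ss) ?(n0 _ _ tt') ?(n0 _ _ ee) ?mulf_neq0 //;
  by rewrite /s /t /e !dot_lin ?h1 ?h2 ?h3; ring.
Qed.

End Unbalanced.
End Cycle.

(** * Vectors and their labels *)

Section Labelled.
Variables (R : realType) (sg : bool) (lu lv : label) (a b c : R).
Notation V := 'rV[R]_3.
Notation lval := (lval a b c).
Notation u := (lval lu).
Notation v := (lval lv).
Variables x1 x2 x3 x4 : V.
Hypothesis C : cycle sg a u v x1 x2 x3 x4.

Definition labelled (y : V) (q : quad) : Prop :=
  let: (l1, l2, l3, l4) := q in
  [/\ dotp y x1 = lval l1, dotp y x2 = lval l2, dotp y x3 = lval l3 & dotp y x4 = lval l4].

Hypothesis nondeg : sg = false -> ~ (u = 0 /\ v = 0).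

(** The cycle spans R^3: always if balanced, and if unbalanced unless 1 + u - 2 a^2 and 1 - u - 2
    a^2 both vanish, which forces u = v = 0. *)
Lemma labelled_inj y z q : labelled y q -> labelled z q -> y = z.
Proof.
move: q => [[[l1 l2] l3] l4] [h1 h2 h3 h4] [k1 k2 k3 k4].
case: sg C nondeg => C' nd; first by apply: (balanced_inj C'); rewrite ?h1 ?h2 ?h3 ?h4 ?k1 ?k2 ?k3 ?k4.
have [H0|] := eqVneq (1 + u - 2 * a ^+ 2) 0; last first.
  by move/(unbalanced_inj C'); apply; rewrite ?h1 ?h2 ?h3 ?k1 ?k2 ?k3.
have C2 := cycle_rotN (cycle_rotN C').
have K0 : 1 + - u - 2 * a ^+ 2 != 0.
  apply/eqP => K0; have u0 : u = 0 by lra.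
  by apply: nd => //; split=> //; have := unbalanced_eqn C'; rewrite u0; nra.
by apply: (unbalanced_inj C2 K0); rewrite ?dot_lin ?h1 ?h3 ?h4 ?k1 ?k3 ?k4.
Qed.

Lemma labelled_eqn : cycle_eqn sg lu lv a b c.
Proof.
rewrite /cycle_eqn; case: sg C => C'; first exact: balanced_eqn C'.
have C1 := cycle_rotN C'; have C2 := cycle_rotN C1; have C3 := cycle_rotN C2.
have := (unbalanced_H C', unbalanced_H C1, unbalanced_H C2, unbalanced_H C3).
by move=> [[[h0 h1] h2] h3]; split; [exact: unbalanced_eqn C'|lra|lra|lra|lra].
Qed.

Section Unbalanced.
Hypothesis C' : cycle false a u v x1 x2 x3 x4.
Hypothesis nd : ~ (u = 0 /\ v = 0).
Let C1 := cycle_rotN C'.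
Let C2 := cycle_rotN C1.
Let C3 := cycle_rotN C2.

Let H0 : 1 + u - 2 * a ^+ 2 != 0 \/ 1 - u - 2 * a ^+ 2 != 0.
Proof.
have [H0|] := eqVneq (1 + u - 2 * a ^+ 2) 0; [right|by left].
apply/eqP => K0; have u0 : u = 0 by lra.
by apply: nd; split=> //; have := unbalanced_eqn C'; rewrite u0; nra.
Qed.
Let K0 : 1 + v - 2 * a ^+ 2 != 0 \/ 1 - v - 2 * a ^+ 2 != 0.
Proof.
have [H1|] := eqVneq (1 + v - 2 * a ^+ 2) 0; [right|by left].
apply/eqP => H2; have v0 : v = 0 by lra.
by apply: nd; split=> //; have := unbalanced_eqn C'; rewrite v0; nra.
Qed.

Section TwoVectors.
Variables (y z : V) (q r : quad).
Hypotheses (hy : labelled y q) (hz : labelled z r).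

Lemma plan_eqs :
  let: (y1, y2, y3, y4) := q in let: (z1, z2, z3, z4) := r in
  [/\ (1 + u - 2 * a ^+ 2) * plan1 lu a b c q r (dotp y z) = 2 * (1 - u)
        * perp2 lu a b c (lval y1) (lval y2) (lval y3) * perp2 lu a b c (lval z1) (lval z2) (lval z3),
      (1 - u - 2 * a ^+ 2) * plan1 lu a b c q r (dotp y z) = 2 * (1 + u)
        * perp4 lu a b c (lval y1) (lval y3) (lval y4) * perp4 lu a b c (lval z1) (lval z3) (lval z4),
      (1 - v - 2 * a ^+ 2) * plan2 lv a b c q r (dotp y z) = 2 * (1 + v)
        * perp1 lv a b c (lval y1) (lval y2) (lval y4) * perp1 lv a b c (lval z1) (lval z2) (lval z4)
    & (1 + v - 2 * a ^+ 2) * plan2 lv a b c q r (dotp y z) = 2 * (1 - v)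
        * perp3 lv a b c (lval y2) (lval y3) (lval y4) * perp3 lv a b c (lval z2) (lval z3) (lval z4)].
Proof.
move: q r hy hz => [[[y1 y2] y3] y4] [[[z1 z2] z3] z4] [h1 h2 h3 h4] [k1 k2 k3 k4].
have := (unbalanced_dot C' y z, unbalanced_dot C1 y z, unbalanced_dot C2 y z, unbalanced_dot C3 y z).
rewrite !dot_lin h1 h2 h3 h4 k1 k2 k3 k4 => -[[[e0 e1] e2] e3].
rewrite /plan1 /plan2 /perp1 /perp2 /perp3 /perp4; split;
  apply/eqP; rewrite -subr_eq0; apply/eqP.
- by move/eqP: e0; rewrite -subr_eq0 => /eqP e0; rewrite -[RHS]e0; ring.
- by move/eqP: e2; rewrite -subr_eq0 => /eqP e2; rewrite -[RHS]e2; ring.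
- by move/eqP: e3; rewrite -subr_eq0 => /eqP e3; rewrite -[RHS]e3; ring.
- by move/eqP: e1; rewrite -subr_eq0 => /eqP e1; rewrite -[RHS]e1; ring.
Qed.
End TwoVectors.

Lemma norm_eqs y q : dotp y y = 1 -> labelled y q ->
  let: (l1, l2, l3, l4) := q in
  let y1 := lval l1 in let y2 := lval l2 in let y3 := lval l3 in let y4 := lval l4 in
  [/\ norm1 lu a b c y1 y3 * (1 + u - 2 * a ^+ 2) = 2 * (1 - u) * perp2 lu a b c y1 y2 y3 ^+ 2,
      norm1 lu a b c y1 y3 * (1 - u - 2 * a ^+ 2) = 2 * (1 + u) * perp4 lu a b c y1 y3 y4 ^+ 2,
      norm2 lv a b c y2 y4 * (1 - v - 2 * a ^+ 2) = 2 * (1 + v) * perp1 lv a b c y1 y2 y4 ^+ 2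
    & norm2 lv a b c y2 y4 * (1 + v - 2 * a ^+ 2) = 2 * (1 - v) * perp3 lv a b c y2 y3 y4 ^+ 2].
Proof.
move=> yy hy; have := plan_eqs hy hy; move: q {hy} => [[[y1 y2] y3] y4].
rewrite yy /plan1 /plan2 /norm1 /norm2 !expr2 => -[e0 e1 e2 e3].
by split; rewrite ?mulrA -?e0 -?e1 -?e2 -?e3; ring.
Qed.

Let pos (x : R) : `|x| < 1 -> 0 < 1 + x /\ 0 < 1 - x.
Proof. by rewrite ltr_norml => /andP[? ?]; split; lra. Qed.

Lemma mfact_labelled y q : dotp y y = 1 -> labelled y q -> mfact lu lv a b c q.
Proof.
move=> yy hy; have := norm_eqs yy hy; have hyq := hy; move: q hy hyq => [[[y1 y2] y3] y4] [h1 h2 h3 h4] hyq.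
move=> [e0 e1 e2 e3].
have [pu mu] := pos (cyc_u C'); have [pv mv] := pos (cyc_v C').
have := (unbalanced_H C', unbalanced_H C1, unbalanced_H C2, unbalanced_H C3).
move=> [[[g0 g1] g2] g3].
have ge0 (n h k w : R) : h != 0 -> 0 <= h -> 0 <= k -> n * h = 2 * k * w ^+ 2 -> 0 <= n.
  move=> h0 hge kge nE; rewrite -(pmulr_lge0 _ (_ : 0 < h)) ?lt_def ?h0 // nE.
  by rewrite mulr_ge0 ?sqr_ge0 // mulr_ge0.
split=> //.
- split.
    by case: H0 => h; [exact: (ge0 _ _ _ _ h g0 (ltW mu) e0)|exact: (ge0 _ _ _ _ h g2 (ltW pu) e1)].
  case: K0 => h; first exact: (ge0 _ _ _ _ h g1 (ltW mv) e3).
  by apply: (ge0 _ _ _ _ h _ (ltW pv) e2); lra.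
- have r0 := unbalanced_rel C' y; have r3 := unbalanced_rel C3 y.
  move: r0 r3; rewrite !dot_lin h1 h2 h3 h4 /perp1 /perp2 /perp3 /perp4 => r0 r3; split;
    apply/eqP; rewrite -subr_eq0; apply/eqP.
  + by move/eqP: r0; rewrite -subr_eq0 => /eqP r0; rewrite -[RHS]r0; ring.
  + by move/eqP: r3; rewrite -subr_eq0 => /eqP r3; rewrite -[RHS]oppr0 -r3; ring.
Qed.

Lemma mdot_labelled y z q r : dotp y y = 1 -> dotp z z = 1 -> labelled y q -> labelled z r ->
  mdot lu lv a b c q r (dotp y z).
Proof.
move=> yy zz hy hz; have := plan_eqs hy hz; have := norm_eqs yy hy; have := norm_eqs zz hz.
move: q r {hy hz} => [[[y1 y2] y3] y4] [[[z1 z2] z3] z4] [m0 m1 m2 m3] [n0 n1 n2 n3] [e0 e1 e2 e3].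
have sq (h k p n m w w' : R) : h != 0 -> h * p = 2 * k * w * w' -> n * h = 2 * k * w ^+ 2 ->
    m * h = 2 * k * w' ^+ 2 -> p ^+ 2 = n * m.
  move=> h0 hp hn hm; apply: (mulfI h0); apply: (mulfI h0).
  transitivity ((h * p) ^+ 2); first ring.
  rewrite hp; transitivity ((2 * k * w ^+ 2) * (2 * k * w' ^+ 2)); first ring.
  by rewrite -hn -hm; ring.
split=> //.
- by case: H0 => h; [exact: (sq _ _ _ _ _ _ _ h e0 n0 m0)|exact: (sq _ _ _ _ _ _ _ h e1 n1 m1)].
- by case: K0 => h; [exact: (sq _ _ _ _ _ _ _ h e3 n3 m3)|exact: (sq _ _ _ _ _ _ _ h e2 n2 m2)].
Qed.
End Unbalanced.

Lemma qfact_labelled y q : dotp y y = 1 -> labelled y q -> qfact sg lu lv a b c q.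
Proof.
rewrite /qfact; case: sg C nondeg => C' nd yy hy; last exact: (mfact_labelled C' (nd erefl) yy hy).
move: q hy => [[[y1 y2] y3] y4] [h1 h2 h3 h4]; split.
- by rewrite -h1 -h2 -h3 -h4; exact: balanced_rel2 C' y.
- by rewrite -h1 -h2 -h3 -h4; exact: balanced_rel1 C' y.
- by have := balanced_dot C' y y; rewrite yy !dot_lin h1 h2 h3 h4 mul1r => ->; ring.
- by have := balanced_norm2 C' yy; rewrite h1 h2 h3 h4 => ->; ring.
Qed.

Lemma qdot_labelled y z q r : dotp y y = 1 -> dotp z z = 1 -> labelled y q -> labelled z r ->
  qdot sg lu lv a b c q r (dotp y z).
Proof.
rewrite /qdot; case: sg C nondeg => C' nd yy zz hy hz; last exact: (mdot_labelled C' (nd erefl) yy zz hy hz).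
have := balanced_dot C' y z; move: q r hy hz => [[[y1 y2] y3] y4] [[[z1 z2] z3] z4] [h1 h2 h3 h4] [k1 k2 k3 k4].
by rewrite !dot_lin h1 h2 h3 h4 k1 k2 k3 k4 mulrC => ->; rewrite /pdot; ring.
Qed.

End Labelled.

Lemma size_keys (T K : eqType) (key : T -> K) (ks : seq K) (s : seq T) :
  (forall z, z \in s -> key z \in ks) ->
  (size s <= \sum_(k <- ks) count (fun z => key z == k) s)%N.
Proof.
elim: s => [|z s ih] h; first by rewrite big1.
rewrite (eq_bigr (fun k => (key z == k) + count (fun z => key z == k) s)%N) // big_split /=.
rewrite -add1n leq_add //; last by apply: ih => w ws; apply: h; rewrite inE ws orbT.
have zk : key z \in ks by apply: h; exact: mem_head.
by rewrite (big_rem _ zk) /= eqxx.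
Qed.

Lemma count_ge2 (T : eqType) (P : pred T) (s : seq T) : uniq s -> (1 < count P s)%N ->
  exists x y, [/\ x \in s, y \in s, x != y, P x & P y].
Proof.
rewrite -size_filter => us; have := mem_filter P ^~ s; have := filter_uniq P us.
case: (filter P s) => [|x [|y t]] //= /andP[xt _] h _; exists x, y.
move: (h x) (h y) xt; rewrite !inE !eqxx ?orbT /= negb_or => /esym/andP[? ?] /esym/andP[? ?] /andP[? _].
by split.
Qed.

Lemma count_ge3 (T : eqType) (P : pred T) (s : seq T) : uniq s -> (2 < count P s)%N ->
  exists x y z, [/\ [/\ x \in s, y \in s & z \in s], [/\ x != y, x != z & y != z] & [/\ P x, P y & P z]].
Proof.
rewrite -size_filter => us; have := mem_filter P ^~ s; have := filter_uniq P us.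
case: (filter P s) => [|x [|y [|z t]]] //= /and3P[xt yt _] h _; exists x, y, z.
move: (h x) (h y) (h z) xt yt; rewrite !inE !eqxx ?orbT /= !negb_or.
by move=> /esym/andP[? ?] /esym/andP[? ?] /esym/andP[? ?] /and3P[? ? _] /andP[? _]; do !split.
Qed.

(** * Line sets, Welch's bound and mirror images *)

Section LineSets.
Variable R : realType.
Notation V := 'rV[R]_3.
Implicit Types (x y z w : V) (X : seq V).

(* The possible values p, q, r of |<x, x'>| need not be distinct. *)
Definition lineset (p q r : R) X : Prop :=
  [/\ uniq X, forall x, x \in X -> dotp x x = 1
    & {in X &, forall x y, x != y -> `|dotp x y| \in [:: p; q; r]}].

Definition attained (p : R) X : Prop :=
  exists x y, [/\ x \in X, y \in X, x != y & `|dotp x y| = p].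

(* Welch's bound: sum of squared inner products >= n^2 / 3. *)
Lemma welch X (m : R) : uniq X -> (1 < size X)%N -> (forall x, x \in X -> dotp x x = 1) ->
    {in X &, forall x y, x != y -> dotp x y ^+ 2 < m} ->
  (size X)%:R < 3 * (1 + ((size X)%:R - 1) * m).
Proof.
move=> uX sX unit hm; set n := (size X)%:R.
pose M (k l : 'I_3) := \sum_(x <- X) x 0 k * x 0 l.
(* The double sum is the squared Frobenius norm of the 3 x 3 moment matrix [M], which has trace
   n. *)
have frame : \sum_(x <- X) \sum_(y <- X) dotp x y ^+ 2 =
    M 0 0 ^+ 2 + M 1 1 ^+ 2 + M 2%:R 2%:R ^+ 2 + 2 * (M 0 1 ^+ 2 + M 0 2%:R ^+ 2 + M 1 2%:R ^+ 2).
  have MM k l : M k l ^+ 2 = \sum_(x <- X) \sum_(y <- X) (x 0 k * x 0 l) * (y 0 k * y 0 l).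
    by rewrite expr2 big_distrlr.
  rewrite !MM -!big_split /= mulr_sumr -big_split /=; apply: eq_bigr => x _.
  rewrite -!big_split /= mulr_sumr -big_split /=; apply: eq_bigr => y _.
  by rewrite dotE; ring.
have tr : M 0 0 + M 1 1 + M 2%:R 2%:R = n.
  rewrite -!big_split /= (eq_big_seq (fun=> 1)) => [|x /unit]; last by rewrite dotE.
  by rewrite big_const_seq count_predT iter_addr addr0.
have lower : n ^+ 2 <= 3 * \sum_(x <- X) \sum_(y <- X) dotp x y ^+ 2.
  rewrite frame -tr; move: (M 0 0) (M 1 1) (M 2%:R 2%:R) (M 0 1) (M 0 2%:R) (M 1 2%:R) => p q r d e f.
  have := (sqr_ge0 (p - q), sqr_ge0 (p - r), sqr_ge0 (q - r), sqr_ge0 d, sqr_ge0 e, sqr_ge0 f).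
  by move=> [[[[[]]]]]; lra.
have row x : x \in X -> \sum_(y <- X) dotp x y ^+ 2 < 1 + (n - 1) * m.
  move=> xX; rewrite (big_rem _ xX) /= unit // expr1n ltrD2l.
  have sr : (size (rem x X)).+1 = size X by rewrite size_rem // prednK // ltnW.
  have -> : (n - 1) * m = \sum_(y <- rem x X) m.
    rewrite big_const_seq count_predT iter_addr addr0 -mulr_natl /n -sr; congr (_ * _).
    by rewrite -[_.+1%:R]natr1 addrK.
  have lt y : y \in rem x X -> dotp x y ^+ 2 < m.
    by rewrite mem_rem_uniq // inE => /andP[yx yX]; apply: hm; rewrite // eq_sym.
  case: (rem x X) sr lt => [|y t] sr lt; first by rewrite -sr in sX.
  rewrite !big_cons ltr_leD ?lt ?mem_head //; rewrite [leLHS]big_seq [leRHS]big_seq ler_sum // => w wt.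
  by apply/ltW/lt; rewrite inE wt orbT.
have upper : \sum_(x <- X) \sum_(y <- X) dotp x y ^+ 2 < n * (1 + (n - 1) * m).
  have -> : n * (1 + (n - 1) * m) = \sum_(x <- X) (1 + (n - 1) * m).
    by rewrite big_const_seq count_predT iter_addr addr0 mulr_natl.
  move: row; pose F x := \sum_(y <- X) dotp x y ^+ 2.
  rewrite -[\sum_(x <- X) _]/(\sum_(x <- X) F x) => row; have {}row : forall x, x \in X -> F x < 1 + (n - 1) * m := row.
  move: (1 + _) F row => c F; case: (X) sX => [//|x t] _ row.
  rewrite !big_cons ltr_leD ?row ?mem_head //; rewrite [leLHS]big_seq [leRHS]big_seq ler_sum // => w wt.
  by apply/ltW/row; rewrite inE wt orbT.
have n0 : 0 < n by rewrite ltr0n ltnW.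
by rewrite -(ltr_pM2l n0); apply: le_lt_trans (_ : n * n < _); rewrite // -expr2 -mulrCA; lra.
Qed.

(** Welch's bound for n = 4 and m = 1/9 reads 4 < 4. *)
Lemma four_far X : (forall x, x \in X -> dotp x x = 1) -> uniq X -> size X = 4 ->
  ~ {in X &, forall x y, x != y -> 3 * `|dotp x y| < 1}.
Proof.
move=> unit uX sX far; have := @welch X 9^-1 uX; rewrite sX => /(_ isT unit) h.
suff /h : {in X &, forall x y, x != y -> dotp x y ^+ 2 < 9^-1} by lra.
move=> x y xX yX xy; have := far x y xX yX xy; have := normr_ge0 (dotp x y).
rewrite -real_normK ?num_real //; move: `|_| => t ? ?; nra.
Qed.

Section Pair.
Variables (x w : V) (g : R).
Hypotheses (xx : dotp x x = 1) (ww : dotp w w = 1) (xw : dotp x w = g) (g1 : g ^+ 2 < 1).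

(** z1 and z2 are mirror images in the plane of x and w. Expand z1 in the orthogonal basis x, w - g
    x, z1 - z2. *)
Lemma mirror_dot z1 z2 i j : dotp z1 z1 = 1 -> dotp z2 z2 = 1 -> z1 != z2 ->
    dotp z1 x = i -> dotp z2 x = i -> dotp z1 w = j -> dotp z2 w = j ->
  (1 - g ^+ 2) * (1 + dotp z1 z2) = 2 * (i ^+ 2 + j ^+ 2 - 2 * g * i * j).
Proof.
move=> h1 h2 ne i1 i2 j1 j2; set d := z1 - z2.
have wx : dotp w x = g by rewrite dotC.
have xd : dotp x d = 0 by rewrite /d !dot_lin ![dotp x _]dotC i1 i2 subrr.
have wd : dotp w d = 0 by rewrite /d !dot_lin ![dotp w _]dotC j1 j2 subrr.
have dd : dotp d d = 2 * (1 - dotp z1 z2) by rewrite /d !dot_lin h1 h2 (dotC z2 z1); ring.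
have d0 : dotp d d != 0 by apply: contra ne => /eqP/dot_eq0/eqP; rewrite subr_eq0.
have z1d : dotp z1 d = dotp d d / 2 by rewrite dd /d !dot_lin h1; field.
have t : dotp z1 z2 = 1 - dotp d d / 2 by rewrite dd; field.
clearbody d; have := @parseval _ x (w - g *: x) d z1 z1.
rewrite !dot_lin xx ww xw wx xd wd h1 i1 j1 z1d t => /(_ ltac:(ring) ltac:(ring) ltac:(ring)) e.
apply: (mulfI d0); apply/eqP; rewrite -subr_eq0; apply/eqP.
move: e; move: (dotp d d) => D e.
move/eqP: e; rewrite -subr_eq0 => /eqP e; by rewrite -[RHS](mulr0 2) -e; field.
Qed.

(** If all three differed, [mirror_dot] would give z3 equal products with z1 and z2. So z3 has no
    component along z1 - z2, while z1 has one, yet their lengths and their components in the plane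
    of x and w agree. *)
Lemma mirror_unique z1 z2 z3 i j : dotp z1 z1 = 1 -> dotp z2 z2 = 1 -> dotp z3 z3 = 1 ->
    dotp z1 x = i -> dotp z2 x = i -> dotp z3 x = i ->
    dotp z1 w = j -> dotp z2 w = j -> dotp z3 w = j ->
  [\/ z1 = z2, z1 = z3 | z2 = z3].
Proof.
move=> h1 h2 h3 i1 i2 i3 j1 j2 j3.
have [->|n12] := eqVneq z1 z2; first by constructor 1.
have [->|n13] := eqVneq z1 z3; first by constructor 2.
have [->|n23] := eqVneq z2 z3; first by constructor 3.
have k0 : 1 - g ^+ 2 != 0 by rewrite lt0r_neq0 // subr_gt0.
have e12 := mirror_dot h1 h2 n12 i1 i2 j1 j2; have e13 := mirror_dot h1 h3 n13 i1 i3 j1 j3.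
have e23 := mirror_dot h2 h3 n23 i2 i3 j2 j3.
have t23 : dotp z2 z3 = dotp z1 z3 by apply: (addrI 1); apply: (mulfI k0); rewrite e23 e13.
set d := z1 - z2; have wx : dotp w x = g by rewrite dotC.
have xd : dotp x d = 0 by rewrite /d !dot_lin ![dotp x _]dotC i1 i2 subrr.
have wd : dotp w d = 0 by rewrite /d !dot_lin ![dotp w _]dotC j1 j2 subrr.
have d0 : dotp d d != 0 by apply: contra n12 => /eqP/dot_eq0/eqP; rewrite subr_eq0.
have z3d : dotp z3 d = 0 by rewrite /d !dot_lin ![dotp z3 _]dotC t23 subrr.
have z1d : dotp z1 d = dotp d d / 2.
  by rewrite /d !dot_lin h1 h2 (dotC z2 z1); field.
clearbody d; have := @parseval _ x (w - g *: x) d z3 z3; have := @parseval _ x (w - g *: x) d z1 z1.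
rewrite !dot_lin xx ww xw wx xd wd h1 h3 i1 j1 i3 j3 z3d z1d.
move=> /(_ ltac:(ring) ltac:(ring) ltac:(ring)) e1 /(_ ltac:(ring) ltac:(ring) ltac:(ring)) e3.
have : (dotp d d) ^+ 2 * (1 - g ^+ 2) = 0.
  by move: e1 e3; move: (dotp d d) => D e1 e3; lra.
by move/eqP; rewrite mulf_eq0 sqrf_eq0 (negPf d0) (negPf k0).
Qed.

(* Each line is represented by the sign for which it is lexicographically
   nonnegative on (x, w). *)
Definition flip z : V := if (dotp z x < 0) || (dotp z x == 0) && (dotp z w < 0) then - z else z.
Definition key z : R * R := (dotp (flip z) x, dotp (flip z) w).

Lemma flipE z : flip z = z \/ flip z = - z.
Proof. by rewrite /flip; case: ifP; auto. Qed.

Lemma key_ge0 z : 0 <= (key z).1.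
Proof.
rewrite /key /flip /=; case: ltP => [h|h] /=; first by rewrite dotNl; lra.
by case: ifP => [/andP[/eqP h0 _]|_]; rewrite ?dotNl ?h0 ?oppr0.
Qed.

Lemma key_norm z : (key z).1 = `|dotp z x| /\ `|(key z).2| = `|dotp z w|.
Proof.
split; first by rewrite -[LHS]ger0_norm ?key_ge0 // /key; case: (flipE z) => -> /=; rewrite ?dotNl ?normrN.
by rewrite /key; case: (flipE z) => -> /=; rewrite ?dotNl ?normrN.
Qed.

Lemma flip_dot z : dotp (flip z) (flip z) = dotp z z.
Proof. by case: (flipE z) => ->; rewrite ?dotNl ?dotNr ?opprK. Qed.

Lemma flip_inj p q r X z z' : 0 <= p < 1 -> 0 <= q < 1 -> 0 <= r < 1 -> lineset p q r X ->
  z \in X -> z' \in X -> flip z = flip z' -> z = z'.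
Proof.
move=> hp hq hr [_ unit h] zX zX' e; apply/eqP/negPn/negP => ne.
have : `|dotp z z'| = 1.
  case: (flipE z) (flipE z') e => -> [] -> e; first by rewrite e unit // normr1.
  - by rewrite e dotNl unit // normrN normr1.
  - by rewrite -e dotNr unit // normrN normr1.
  - by rewrite (oppr_inj e) unit // normr1.
by move: (h z z' zX zX' ne); rewrite !inE => /or3P[]/eqP-> k; move: hp hq hr; rewrite k ltxx !andbF.
Qed.

Lemma key_count p q r X k : 0 <= p < 1 -> 0 <= q < 1 -> 0 <= r < 1 -> lineset p q r X ->
  (count (fun z => key z == k) X <= 2)%N.
Proof.
move=> hp hq hr L; rewrite leqNgt; apply/negP => /(count_ge3 (let: And3 u _ _ := L in u)).
move=> [z1 [z2 [z3 [[X1 X2 X3] [n12 n13 n23] [/eqP k1 /eqP k2 /eqP k3]]]]].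
have [_ unit _] := L; move: k {k1 k2 k3} (k1) (k2) (k3) => [i j] [i1 j1] [i2 j2] [i3 j3].
have inj := flip_inj hp hq hr L.
have := @mirror_unique (flip z1) (flip z2) (flip z3) i j; rewrite !flip_dot !unit //.
case/(_ erefl erefl erefl i1 i2 i3 j1 j2 j3) => e.
- by rewrite (inj _ _ X1 X2 e) eqxx in n12.
- by rewrite (inj _ _ X1 X3 e) eqxx in n13.
- by rewrite (inj _ _ X2 X3 e) eqxx in n23.
Qed.

End Pair.
End LineSets.

(** Greedy choice: each chosen element discards at most m elements, itself included. *)
Lemma independent_of_sparse (T : eqType) (P : rel T) (m k : nat) (X : seq T) : symmetric P -> uniq X ->
  (forall z, z \in X -> (count (fun t => (t == z) || P z t) X <= m)%N) -> (m * k < size X)%N ->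
  exists s, [/\ size s = k.+1, uniq s, {subset s <= X} & {in s &, forall x y, x != y -> ~~ P x y}].
Proof.
move=> symP; elim: k X => [|k ih] [|a X] uX hX sX //.
  exists [:: a]; split=> // [z|z t]; rewrite !inE; first by move=> ->.
  by move=> /eqP-> /eqP->; rewrite eqxx.
pose Y := [seq t <- a :: X | ~~ ((t == a) || P a t)].
have YX : {subset Y <= a :: X} by move=> t; rewrite mem_filter => /andP[].
have uY : uniq Y by rewrite filter_uniq.
have [||s [ss us sY indep]] := ih Y uY.
- move=> z zY; apply: leq_trans (hX z (YX _ zY)); rewrite count_filter sub_count // => t /= /andP[].
  by [].
- rewrite size_filter -(ltn_add2l (count (fun t => (t == a) || P a t) (a :: X))) count_predC.
  by apply: leq_ltn_trans sX; rewrite mulnS leq_add2r; apply: hX; exact: mem_head.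
have sa t : t \in s -> t != a /\ ~~ P a t.
  by move=> /sY; rewrite mem_filter negb_or => /andP[/andP[]].
exists (a :: s); split; rewrite /= ?ss ?us ?andbT //.
- by apply/negP => /sa[]; rewrite eqxx.
- by move=> t; rewrite inE => /predU1P[->|/sY/YX//]; exact: mem_head.
move=> z t; rewrite !inE => /predU1P[->|zs] /predU1P[->|ts]; first by rewrite eqxx.
- by move=> _; case: (sa t ts).
- by move=> _; rewrite symP; case: (sa z zs).
exact: indep.
Qed.

(** * Excluded regions: one value close to 1 *)

Section Exclusion.
Variable R : realType.
Notation V := 'rV[R]_3.
Implicit Types (X : seq V).

(** Expand the squared length of z + w - (<y,z> + <y,w>) y. For equal products p the bound is 2 p^2
    - 1. *)
Lemma dot_close (y z w : V) : dotp y y = 1 -> dotp z z = 1 -> dotp w w = 1 ->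
  (dotp y z + dotp y w) ^+ 2 / 2 - 1 <= dotp z w.
Proof.
move=> yy zz ww.
have := dot_ge0 (z + w - (dotp y z + dotp y w) *: y).
rewrite !dot_lin yy zz ww (dotC z y) (dotC w y) (dotC w z); move: (dotp y z) (dotp y w) (dotp z w) => p q t.
by nra.
Qed.

Lemma dot_sep (y z w : V) : dotp y y = 1 -> dotp z z = 1 -> dotp w w = 1 ->
  (dotp y z - dotp y w) ^+ 2 <= 2 * (1 - dotp z w).
Proof.
move=> yy zz ww; have := cauchy y (z - w); rewrite !dot_lin yy zz ww (dotC w z).
by move: (dotp y z) (dotp y w) (dotp z w) => p q t; nra.
Qed.

Lemma in3P (p q r t : R) : t \in [:: p; q; r] -> [\/ t = p, t = q | t = r].
Proof. by rewrite !inE => /or3P[]/eqP->; constructor. Qed.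

Section Three.
Variables (g x y : R) (X : seq V).
Hypotheses (g01 : 0 <= g < 1) (x01 : 0 <= x < 1) (y01 : 0 <= y < 1).
Hypotheses (L : lineset g x y X) (X12 : (11 < size X)%N).

Let unit z : z \in X -> dotp z z = 1. Proof. by case: L => _ h _; exact: h. Qed.
Let uX : uniq X. Proof. by case: L. Qed.
Let vals z w : z \in X -> w \in X -> z != w -> [\/ `|dotp z w| = g, `|dotp z w| = x | `|dotp z w| = y].
Proof. by case: L => _ _ h *; apply: in3P; exact: h. Qed.

Section Pair.
Variables (z0 w0 w : V).
Hypotheses (z0X : z0 \in X) (w0X : w0 \in X) (zw0 : z0 != w0) (wE : w = w0 \/ w = - w0).
Hypothesis z0w : dotp z0 w = g.

Let ww : dotp w w = 1. Proof. by case: wE => ->; rewrite ?dotNl ?dotNr ?opprK unit. Qed.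
Let g1 : g ^+ 2 < 1. Proof. by case/andP: g01 => *; rewrite expr2; nra. Qed.
Let normw z : `|dotp z w| = `|dotp z w0|. Proof. by case: wE => ->; rewrite ?dotNr ?normrN. Qed.

Lemma pair_vals z : z \in X -> z != z0 -> z != w0 ->
  [/\ [\/ (key z0 w z).1 = g, (key z0 w z).1 = x | (key z0 w z).1 = y],
      [\/ `|(key z0 w z).2| = g, `|(key z0 w z).2| = x | `|(key z0 w z).2| = y],
      0 <= (key z0 w z).1,
      ((key z0 w z).1 - (key z0 w z).2) ^+ 2 <= 2 * (1 - g)
    & [/\ (dotp (flip z0 w z) z0 + g) ^+ 2 / 2 - 1 <= (key z0 w z).2,
          ((key z0 w z).2 + g) ^+ 2 / 2 - 1 <= (key z0 w z).1
        & (- (key z0 w z).2 + g) ^+ 2 / 2 - 1 <= - (key z0 w z).1]].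
Proof.
move=> zX nz0 nw0; have [-> ->] := key_norm z0 w z; rewrite normw.
have fu : dotp (flip z0 w z) (flip z0 w z) = 1 by rewrite flip_dot unit.
have z0u := unit z0X; split; [exact: vals|exact: vals|exact: normr_ge0| |].
  rewrite -(key_norm z0 w z).1 -z0w /key /=; exact: dot_sep.
split.
- by have := dot_close z0u fu ww; rewrite (dotC z0 (flip _ _ _)) z0w.
- have := dot_close ww fu z0u; rewrite (dotC w (flip _ _ _)) (dotC w z0) z0w.
  by rewrite -(key_norm z0 w z).1.
- have fu' : dotp (- flip z0 w z) (- flip z0 w z) = 1 by rewrite dotNl dotNr opprK.
  have := dot_close ww fu' z0u; rewrite dotNr (dotC w (flip _ _ _)) (dotC w z0) z0w dotNl.
  by rewrite -(key_norm z0 w z).1.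
Qed.

Lemma pair_size ks : (forall z, z \in X -> z != z0 -> z != w0 -> key z0 w z \in ks) ->
  (size X <= 2 + \sum_(k <- ks) count (fun z => key z0 w z == k) [seq z <- X | (z != z0) && (z != w0)])%N.
Proof.
move=> h; pose Y := [seq z <- X | (z != z0) && (z != w0)].
have sX : (size X <= 2 + size Y)%N.
  have -> : size Y = size (filter (predC (mem [:: z0; w0])) X).
    by rewrite /Y; congr size; apply: eq_filter => z; rewrite !inE negb_or.
  rewrite size_filter -(count_predC (mem [:: z0; w0]) X) leq_add2r -size_filter.
  by apply: (uniq_leq_size (s2 := [:: z0; w0])); rewrite ?filter_uniq // => z; rewrite mem_filter => /andP[].
apply: leq_trans sX _; rewrite leq_add2l; apply: size_keys => z.
by rewrite mem_filter => /andP[/andP[? ?] ?]; exact: h.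
Qed.

Lemma pair_count2 k : (count (fun z => key z0 w z == k) [seq z <- X | (z != z0) && (z != w0)] <= 2)%N.
Proof.
apply: leq_trans (key_count (unit z0X) ww z0w g1 k g01 x01 y01 L).
by rewrite count_filter sub_count // => z /= /andP[].
Qed.

(* The two mirror images making equal angles arccos g with both vectors have
   product (4 g^2 - 1 - g) / (1 + g), strictly between 2 g^2 - 1 and g. *)
Lemma pair_count_gg : x < 2 * g ^+ 2 - 1 -> y < 2 * g ^+ 2 - 1 ->
  (count (fun z => key z0 w z == (g, g)) [seq z <- X | (z != z0) && (z != w0)] <= 1)%N.
Proof.
move=> xg yg; rewrite leqNgt; apply/negP => /(count_ge2 (filter_uniq _ uX)).
move=> [z1 [z2 [+ + ne /eqP k1 /eqP k2]]]; rewrite !mem_filter => /andP[_ z1X] /andP[_ z2X].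
have := @mirror_dot _ z0 w g (unit z0X) ww z0w (flip z0 w z1) (flip z0 w z2) g g.
move: k1 k2 => [-> ->] [-> ->]; rewrite !flip_dot !unit // => /(_ erefl erefl _ erefl erefl erefl erefl) e.
have ne' : flip z0 w z1 != flip z0 w z2.
  by apply: contra ne => /eqP e'; rewrite (flip_inj g01 x01 y01 L z1X z2X e').
have t : `|dotp (flip z0 w z1) (flip z0 w z2)| = `|dotp z1 z2|.
  by case: (flipE z0 w z1) (flipE z0 w z2) => -> [] ->; rewrite ?dotNl ?dotNr ?opprK ?normrN.
move: (e ne') t; move: (dotp (flip _ _ _) _) => t {}e tn.
case/andP: g01 => g0 g1'.
have e' : (1 + g) * (1 + t) = 4 * g ^+ 2.
  have h : 1 - g != 0 by rewrite lt0r_neq0 // subr_gt0.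
  by apply: (mulfI h); transitivity ((1 - g ^+ 2) * (1 + t)); [ring|rewrite e; ring].
have gpos : 0 < g by move: x01 => /andP[? _]; nra.
have t1 : 2 * g ^+ 2 - 1 < t.
  rewrite -subr_gt0 -(pmulr_rgt0 _ (_ : 0 < 1 + g)); last lra.
  have -> : (1 + g) * (t - (2 * g ^+ 2 - 1)) = 2 * g ^+ 2 * (1 - g) + ((1 + g) * (1 + t) - 4 * g ^+ 2) by ring.
  by rewrite e' subrr addr0 mulr_gt0 ?mulr_gt0 ?exprn_gt0 ?subr_gt0.
have t2 : t < g.
  rewrite -subr_gt0 -(pmulr_rgt0 _ (_ : 0 < 1 + g)); last lra.
  have -> : (1 + g) * (g - t) = (1 - g) * (1 + 3 * g) - ((1 + g) * (1 + t) - 4 * g ^+ 2) by ring.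
  by rewrite e' subrr subr0 mulr_gt0 ?subr_gt0 //; lra.
have t0 : 0 <= t by case/andP: x01 => *; lra.
by move: tn; rewrite (ger0_norm t0) => tn; case: (vals z1X z2X ne); lra.
Qed.

(** By [dot_close] a line at product g from one of z0, w has a product at least 2 g^2 - 1 with the
    other, hence g again. Otherwise both entries come from x and y. *)
Lemma pair_key z : x < 2 * g ^+ 2 - 1 -> y < 2 * g ^+ 2 - 1 ->
    z \in X -> z != z0 -> z != w0 ->
  key z0 w z = (g, g) \/ exists i j, [/\ key z0 w z = (i, j), i = x \/ i = y,
     [\/ j = x, j = y, j = - x | j = - y] & (i - j) ^+ 2 <= 2 * (1 - g)].
Proof.
move=> xg yg zX nz0 nw0; have := pair_vals zX nz0 nw0; case: (key z0 w z) (key_norm z0 w z) => i j /= [ki _].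
have -> : dotp (flip z0 w z) z0 = (key z0 w z).1 by [].
rewrite (key_norm z0 w z).1 -ki.
move=> [hi hj i0 sep [c1 c2 c3]]; case/andP: x01 => x0 x1; case/andP: y01 => y0 y1; case/andP: g01 => g0 g1'.
have hj' : `|j| = j \/ `|j| = - j by case: (ger0P j); auto.
case: hi => hi; first (left; rewrite hi in c1 *; congr (_, _)).
  by case: hj => hj; case: hj' => hj'; nra.
all: case: hj => hj; [exfalso; by case: hj' => hj'; nra| |];
  right; exists i, j; split; auto; case: hj' => hj'; rewrite -hj;
  by [constructor 1; lra|constructor 2; lra|constructor 3; lra|constructor 4; lra].
Qed.

End Pair.

Lemma attained_pair : attained g X -> exists z0 w0 w, [/\ z0 \in X, w0 \in X, z0 != w0,
  w = w0 \/ w = - w0 & dotp z0 w = g].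
Proof.
move=> [z [w [zX wX zw <-]]]; exists z, w; case: (ger0P (dotp z w)) => h.
  by exists w; split; auto.
by exists (- w); split; rewrite ?dotNr; auto.
Qed.

(** A line together with those at product g from it makes at most three lines ([pair_count_gg]).
    Since 12 > 3 * 3, four lines have all products below 1/3, against [four_far]. *)
Lemma not_excl_small : x < 2 * g ^+ 2 - 1 -> y < 2 * g ^+ 2 - 1 -> 3 * x < 1 -> 3 * y < 1 -> False.
Proof.
move=> xg yg hx hy; case/andP: (x01) => x0 x1; case/andP: (y01) => y0 y1; case/andP: (g01) => g0 g1'.
pose P (z t : V) := (z != t) && (`|dotp z t| == g).
have [||||s [ss us sX indep]] := @independent_of_sparse _ P 3 3 X.
- by move=> z t; rewrite /P eq_sym dotC.
- exact: uX.
- move=> z zX.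
  have [|/hasPn no] := boolP (has (P z) X); last first.
    rewrite (eq_in_count (a2 := pred1 z)) ?count_uniq_mem ?zX // => t /no /=.
    by case: (t == z) => //= /negPf->.
  move=> /hasP[w0 w0X /andP[zw0 /eqP zw]].
  pose w := if 0 <= dotp z w0 then w0 else - w0.
  have wE : w = w0 \/ w = - w0 by rewrite /w; case: ifP; auto.
  have z0w : dotp z w = g.
    by rewrite /w -zw; case: ger0P => h; rewrite ?dotNr.
  rewrite -size_filter -(count_predC (mem [:: z; w0])) -[3%N]/(2 + 1)%N leq_add //; last first.
    apply: leq_trans (pair_count_gg zX w0X wE z0w xg yg).
    rewrite -!size_filter; apply: uniq_leq_size => [|t]; first by rewrite !filter_uniq.
    rewrite !mem_filter /= !inE negb_or => /andP[/andP[tz tw] /andP[tP tX]].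
    rewrite (negPf tz) /= in tP; rewrite tz tw tX !andbT; case/andP: tP => _ /eqP tg.
    case: (pair_key zX w0X wE z0w xg yg tX tz tw) => [->|[i [j [ke hi _ _]]]]; first exact: eqxx.
    by have := (key_norm z w t).1; rewrite ke /= dotC tg; case: hi => ->; nra.
  rewrite -size_filter; apply: (uniq_leq_size (s2 := [:: z; w0])); first by rewrite !filter_uniq.
  by move=> t; rewrite mem_filter => /andP[].
- by apply: leq_ltn_trans X12.
apply: (@four_far _ s) => //; first by move=> t /sX; exact: unit.
move=> z t zs ts zt; have := indep z t zs ts zt; rewrite /P zt /=.
by case: (vals (sX _ zs) (sX _ ts) zt) => ->; rewrite ?eqxx //; lra.
Qed.

(** Beyond z0 and w0 there is at most one line with key (g, g) and at most two for each other key.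
    [dot_sep] leaves at most four other keys, so there are at most 2 + 1 + 8 = 11 lines. *)
Lemma not_excl1 : attained g X -> ~ excl1 g x y.
Proof.
move=> /attained_pair[z0 [w0 [w [z0X w0X zw wE z0w]]]] [xg yg cases].
have keys := pair_key z0X w0X wE z0w xg yg.
have c2 := pair_count2 z0X w0X wE z0w; have c1 := pair_count_gg z0X w0X wE z0w xg yg.
have size_le ks : (forall z, z \in X -> z != z0 -> z != w0 -> key z0 w z \in (g, g) :: ks) ->
    (size ks <= 4)%N -> False.
  move=> h sk; have := pair_size h; rewrite big_cons leqNgt => /negP; apply.
  apply: leq_ltn_trans X12; rewrite (leq_add (leqnn 2) (leq_add c1 (_ : _ <= 8)%N)) //.
  apply: leq_trans (_ : \sum_(k <- ks) 2 <= _)%N; first by apply: leq_sum => k _; exact: c2.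
  by rewrite big_const_seq count_predT iter_addn addn0 (leq_mul2l 2 _ 4).
case/andP: x01 => x0 x1; case/andP: y01 => y0 y1; case/andP: g01 => g0 g1'.
case: cases => [[hx hy]|[hx hy]|[xy hd]|[yx hd]].
- apply: (size_le [:: (x, x); (x, y); (y, x); (y, y)]) => // z zX nz nw.
  case: (keys z zX nz nw) => [->|[i [j [-> hi hj sep]]]]; first exact: mem_head.
  rewrite !inE; apply/orP; right.
  by case: hi => hi; case: hj => hj; rewrite hi hj ?eqxx ?orbT //; exfalso; move: sep; rewrite hi hj; case: (leP x y) => ?; nra.
- exact: not_excl_small xg yg hx hy.
- apply: (size_le [:: (x, x); (x, - x); (y, y)]) => // z zX nz nw.
  case: (keys z zX nz nw) => [->|[i [j [-> hi hj sep]]]]; first exact: mem_head.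
  rewrite !inE; apply/orP; right.
  by case: hi => hi; case: hj => hj; rewrite hi hj ?eqxx ?orbT //; exfalso; move: sep; rewrite hi hj; nra.
- apply: (size_le [:: (y, y); (y, - y); (x, x)]) => // z zX nz nw.
  case: (keys z zX nz nw) => [->|[i [j [-> hi hj sep]]]]; first exact: mem_head.
  rewrite !inE; apply/orP; right.
  by case: hi => hi; case: hj => hj; rewrite hi hj ?eqxx ?orbT //; exfalso; move: sep; rewrite hi hj; nra.
Qed.

End Three.
End Exclusion.

(** * Excluded regions: Welch's bound and three close neighbours *)

Section SmallExclusions.
Variable R : realType.
Notation V := 'rV[R]_3.
Implicit Types (X : seq V).

(* Three vectors in the plane orthogonal to x, with equal norms, have a
   singular Gram matrix. *)
Lemma circle_gram (x z1 z2 z3 : V) (v : R) : dotp x x = 1 -> v ^+ 2 < 1 ->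
  dotp z1 z1 = 1 -> dotp z2 z2 = 1 -> dotp z3 z3 = 1 ->
  dotp z1 x = v -> dotp z2 x = v -> dotp z3 x = v ->
  let N := 1 - v ^+ 2 in let a := dotp z1 z2 - v ^+ 2 in
  let b := dotp z1 z3 - v ^+ 2 in let c := dotp z2 z3 - v ^+ 2 in
  (N ^+ 2 - a ^+ 2) * (N ^+ 2 - b ^+ 2) = (N * c - a * b) ^+ 2.
Proof.
move=> xx v1 h1 h2 h3 e1 e2 e3 N a b c.
have N0 : N != 0 by rewrite lt0r_neq0 // subr_gt0.
have [x1 x2 x3] : [/\ dotp x z1 = v, dotp x z2 = v & dotp x z3 = v] by rewrite !(dotC x).
have [t12 t13 t23] : [/\ dotp z1 z2 = a + v ^+ 2, dotp z1 z3 = b + v ^+ 2 & dotp z2 z3 = c + v ^+ 2].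
  by rewrite /a /b /c !subrK.
have [t21 t31 t32] : [/\ dotp z2 z1 = a + v ^+ 2, dotp z3 z1 = b + v ^+ 2 & dotp z3 z2 = c + v ^+ 2].
  by rewrite -t12 -t13 -t23 !(dotC z3) (dotC z2).
have NE : v ^+ 2 = 1 - N by rewrite /N opprB addrCA subrr addr0.
clearbody a b c N.
pose p1 := z1 - v *: x; pose p2 := N *: (z2 - v *: x) - a *: (z1 - v *: x).
have d1 : dotp x p1 = 0 by rewrite /p1 !dot_lin xx x1; ring.
have d2 : dotp x p2 = 0 by rewrite /p2 !dot_lin xx x1 x2; ring.
have d3 : dotp p1 p2 = 0.
  rewrite /p1 /p2 !dot_lin xx x1 x2 e1 h1 t12; transitivity (a * (N - (1 - v ^+ 2))); first ring.
  by rewrite NE; ring.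
have n1 : dotp p1 p1 = N.
  by rewrite /p1 !dot_lin xx x1 e1 h1; transitivity (1 - v ^+ 2); [ring|rewrite NE; ring].
have n2 : dotp p2 p2 = N * (N ^+ 2 - a ^+ 2).
  rewrite /p2 !dot_lin xx x1 x2 e1 e2 h1 h2 t12 t21.
  transitivity ((N ^+ 2 + a ^+ 2) * (1 - v ^+ 2) - 2 * N * a ^+ 2); first ring.
  by rewrite NE; ring.
have f1 : dotp z3 p1 = b by rewrite /p1 !dot_lin t31 e3; ring.
have f2 : dotp z3 p2 = N * c - a * b by rewrite /p2 !dot_lin t31 t32 e3; ring.
have := parseval z3 z3 d1 d2 d3; rewrite xx n1 n2 f1 f2 h3 e3 => e.
have e4 : v * v = 1 - N by rewrite -expr2.
apply: (mulfI N0); apply/eqP; rewrite -subr_eq0; apply/eqP.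
move: e; rewrite e4 => /eqP; rewrite -subr_eq0 => /eqP e.
by rewrite -[RHS]e; ring.
Qed.

Lemma circle_cauchy (x z1 z2 : V) (v : R) : dotp x x = 1 -> dotp z1 z1 = 1 -> dotp z2 z2 = 1 ->
  dotp z1 x = v -> dotp z2 x = v -> (dotp z1 z2 - v ^+ 2) ^+ 2 <= (1 - v ^+ 2) ^+ 2.
Proof.
move=> xx h1 h2 e1 e2; have [x1 x2] : dotp x z1 = v /\ dotp x z2 = v by rewrite !(dotC x).
have n1 : dotp (z1 - v *: x) (z1 - v *: x) = 1 - v ^+ 2 by rewrite !dot_lin xx h1 e1 x1; ring.
have n2 : dotp (z2 - v *: x) (z2 - v *: x) = 1 - v ^+ 2 by rewrite !dot_lin xx h2 e2 x2; ring.
have <- : dotp (z1 - v *: x) (z2 - v *: x) = dotp z1 z2 - v ^+ 2 by rewrite !dot_lin xx e1 x2; ring.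
by have := cauchy (z1 - v *: x) (z2 - v *: x); rewrite n1 n2 -expr2.
Qed.

Section Three.
Variables (g x y : R) (X : seq V).
Hypotheses (g01 : 0 <= g < 1) (x01 : 0 <= x < 1) (y01 : 0 <= y < 1).
Hypotheses (L : lineset g x y X) (X12 : (11 < size X)%N).

Let unit z : z \in X -> dotp z z = 1. Proof. by case: L => _ h _; exact: h. Qed.
Let uX : uniq X. Proof. by case: L. Qed.
Let vals z w : z \in X -> w \in X -> z != w -> [\/ `|dotp z w| = g, `|dotp z w| = x | `|dotp z w| = y].
Proof. by case: L => _ _ h *; apply: in3P; exact: h. Qed.

(** Welch's bound for m = 3/11 reads n < 12. *)
Lemma not_excl0_small : ~ [/\ 11 * g ^+ 2 < 3, 11 * x ^+ 2 < 3 & 11 * y ^+ 2 < 3].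
Proof.
move=> [hg hx hy]; have := @welch _ X (3 / 11) uX (ltn_trans _ X12) unit.
move=> /(_ isT) h; suff /h : {in X &, forall x y, x != y -> dotp x y ^+ 2 < 3 / 11}.
  have : (12%:R : R) <= (size X)%:R by rewrite ler_nat.
  by move: (size X)%:R => n; lra.
by move=> z w zX wX zw; rewrite -real_normK ?num_real //; case: (vals zX wX zw) => ->; lra.
Qed.

(** Two planar vectors are nearly opposite to a third one, so their own product h cannot be as small
    as 21/100. *)
Lemma gram_two_far (N a b h : R) : 0 < N -> N < 51 / 100 -> h < 21 / 100 ->
    a < - (11 / 25) -> b < - (11 / 25) -> a ^+ 2 <= N ^+ 2 -> b ^+ 2 <= N ^+ 2 ->
  (N ^+ 2 - a ^+ 2) * (N ^+ 2 - b ^+ 2) <> (N * h - a * b) ^+ 2.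
Proof.
move=> N0 N1 h1 a1 b1 aN bN.
have Nh : N * h < 51 / 100 * (21 / 100).
  by apply: lt_trans (_ : N * (21 / 100) < _); rewrite (ltr_pM2l, ltr_pM2r) //; lra.
have NN : N * N < 51 / 100 * (51 / 100) by rewrite ltr_pM // ltW.
have ab : 11 / 25 * (11 / 25) < (- a) * (- b) by rewrite ltr_pM; lra.
have aa : 11 / 25 * (11 / 25) < (- a) * (- a) by rewrite ltr_pM; lra.
have bb : 11 / 25 * (11 / 25) < (- b) * (- b) by rewrite ltr_pM; lra.
have A : N ^+ 2 - a ^+ 2 < 1 / 15 by rewrite mulrNN in aa; rewrite !expr2; lra.
have B : N ^+ 2 - b ^+ 2 < 1 / 15 by rewrite mulrNN in bb; rewrite !expr2; lra.
have C : 2 / 25 < a * b - N * h by rewrite mulrNN in ab; lra.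
have Lo : (N ^+ 2 - a ^+ 2) * (N ^+ 2 - b ^+ 2) < 1 / 15 * (1 / 15) by rewrite ltr_pM // subr_ge0.
have Up : 2 / 25 * (2 / 25) < (a * b - N * h) * (a * b - N * h) by rewrite ltr_pM //; lra.
have -> : (N * h - a * b) ^+ 2 = (a * b - N * h) * (a * b - N * h) by ring.
by move=> e; move: Lo Up; rewrite e; lra.
Qed.

(** With two equal products the relation factors into c = N or N^2 + N c = 2 h^2, and neither fits
    the bounds. *)
Lemma gram_isosceles (N h c : R) : 0 < N -> N < 51 / 100 -> 1 / 5 < h -> h < N ->
    c < - (11 / 25) \/ c = h ->
  (N ^+ 2 - h ^+ 2) * (N ^+ 2 - h ^+ 2) <> (N * c - h * h) ^+ 2.
Proof.
move=> N0 N1 h0 hN hc e.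
have : (N * (N - c)) * (N ^+ 2 + N * c - 2 * h ^+ 2) = 0.
  by move/eqP: e; rewrite -subr_eq0 => /eqP e; rewrite -[RHS]e; ring.
move/eqP; rewrite !mulf_eq0 (gt_eqF N0) subr_eq0 => /orP[/eqP k|/eqP k]; first by case: hc; lra.
case: hc => hc.
  have hh : 1 / 5 * (1 / 5) < h * h by rewrite ltr_pM //; lra.
  have : N * (N + c) < N * (7 / 100) by rewrite ltr_pM2l //; lra.
  by move: k; rewrite !expr2; lra.
have : 0 < (N - h) * (N + 2 * h) by rewrite mulr_gt0; lra.
by move: k; rewrite hc !expr2; lra.
Qed.

(** Projected orthogonally to z, the three vectors lie on a circle of squared radius N = 1 - g^2,
    with pairwise products g - g^2, between 1/5 and 21/100, or below -11/25. [circle_gram] excludes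
    every combination. *)
Lemma three_neighbours (w1 w2 w3 z : V) (s : R -> Prop) : dotp z z = 1 ->
    dotp w1 w1 = 1 -> dotp w2 w2 = 1 -> dotp w3 w3 = 1 ->
    dotp w1 z = g -> dotp w2 z = g -> dotp w3 z = g -> 7 < 10 * g -> 25 * g < 18 ->
    (forall t, s t <-> t = g \/ - 1 < 20 * t /\ 20 * t < 1) ->
  s (dotp w1 w2) -> s (dotp w1 w3) -> s (dotp w2 w3) -> False.
Proof.
move=> zz h1 h2 h3 e1 e2 e3 g1 g2 sE; rewrite !sE.
have gg : g ^+ 2 < 1 by nra.
have := circle_gram zz gg h1 h2 h3 e1 e2 e3; cbv zeta.
(* Cancelling N leaves the Gram determinant, which is symmetric in a, b, c; hence the other two
   forms of the relation. *)
have tri (a b c : R) : let N := 1 - g ^+ 2 in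
    (N ^+ 2 - a ^+ 2) * (N ^+ 2 - b ^+ 2) = (N * c - a * b) ^+ 2 ->
    (N ^+ 2 - a ^+ 2) * (N ^+ 2 - c ^+ 2) = (N * b - a * c) ^+ 2 /\
    (N ^+ 2 - b ^+ 2) * (N ^+ 2 - c ^+ 2) = (N * a - b * c) ^+ 2.
  move=> N e; have N0 : N != 0 by apply: lt0r_neq0; rewrite /N; lra.
  have e' : N ^+ 3 + 2 * a * b * c - N * (a ^+ 2 + b ^+ 2 + c ^+ 2) = 0.
    apply: (mulfI N0); rewrite mulr0; move/eqP: e; rewrite -subr_eq0 => /eqP e; rewrite -[RHS]e; ring.
  split; apply/eqP; rewrite -subr_eq0; apply/eqP; rewrite -[RHS](mulr0 N) -e'; ring.
have gg1 : 7 / 10 * (7 / 10) < g * g by rewrite ltr_pM //; lra.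
have N0 : 0 < 1 - g ^+ 2 by rewrite subr_gt0.
have N1 : 1 - g ^+ 2 < 51 / 100 by rewrite expr2; lra.
have near1 : 1 / 5 < g - g ^+ 2.
  have : 0 < (25 * g - 7) * (18 - 25 * g) by rewrite mulr_gt0; lra.
  by rewrite expr2; lra.
have near0 : 0 < g - g ^+ 2 by lra.
have near2 : g - g ^+ 2 < 21 / 100.
  have : 0 < (10 * g - 7) * (10 * g - 3) by rewrite mulr_gt0; lra.
  by rewrite expr2; lra.
have far (a : R) : 20 * a < 1 -> a - g ^+ 2 < - (11 / 25) by rewrite expr2; lra.
have gE : g - g ^+ 2 < 1 - g ^+ 2 by lra.
have c12 := circle_cauchy zz h1 h2 e1 e2; have c13 := circle_cauchy zz h1 h3 e1 e3.
have c23 := circle_cauchy zz h2 h3 e2 e3; move: c12 c13 c23.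
move: (dotp w1 w2) (dotp w1 w3) (dotp w2 w3) => t12 t13 t23 c12 c13 c23 e.
have [e' e''] := tri _ _ _ e.
case=> [E12|[_ /far u12]]; case=> [E13|[_ /far u13]]; case=> [E23|[_ /far u23]]; rewrite ?E12 ?E13 ?E23 in e e' e''.
- by apply: (gram_isosceles N0 N1 near1 gE _ e); right.
- by apply: (gram_isosceles N0 N1 near1 gE _ e); left.
- by apply: (gram_isosceles N0 N1 near1 gE _ e'); left.
- exact: (gram_two_far N0 N1 near2 u13 u23 c13 c23 e'').
- by apply: (gram_isosceles N0 N1 near1 gE _ e''); left.
- exact: (gram_two_far N0 N1 near2 u12 u23 c12 c23 e').
- exact: (gram_two_far N0 N1 near2 u12 u13 c12 c13 e).
- by apply: (gram_two_far N0 N1 _ u12 u13 c12 c13 e); lra.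
Qed.

(** By [three_neighbours] a line has at most two others at product g, so four lines have all
    products below 1/20, against [four_far]. *)
Lemma not_excl3 : ~ excl3 x y g.
Proof.
move=> [hx hy g1 g2]; case/andP: (g01) => g0 g1'; case/andP: (x01) => x0 _; case/andP: (y01) => y0 _.
pose P (z t : V) := (z != t) && (`|dotp z t| == g).
have [||||s [ss us sX indep]] := @independent_of_sparse _ P 3 3 X.
- by move=> z t; rewrite /P eq_sym dotC.
- exact: uX.
- move=> z zX; have := count_predUI (pred1 z) (P z) X; rewrite count_uniq_mem ?zX // => e.
  have -> : count (fun t => (t == z) || P z t) X = count (predU (pred1 z) (P z)) X by [].
  suff h : (count (P z) X <= 2)%N.
    by apply: leq_trans (leq_addr (count (predI (pred1 z) (P z)) X) _) _; rewrite e -[3%N]/(1 + 2)%N leq_add2l.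
  rewrite leqNgt; apply/negP => /(count_ge3 uX)[w1 [w2 [w3 [[X1 X2 X3] [n12 n13 n23]]]]].
  move=> [/andP[_ /eqP g1z] /andP[_ /eqP g2z] /andP[_ /eqP g3z]].
  pose sg w := if 0 <= dotp z w then w else - w.
  have sgE w : sg w = w \/ sg w = - w by rewrite /sg; case: ifP; auto.
  have sgu w : w \in X -> dotp (sg w) (sg w) = 1.
    by move=> wX; case: (sgE w) => ->; rewrite ?dotNl ?dotNr ?opprK unit.
  have sgz w : `|dotp z w| = g -> dotp (sg w) z = g.
    by move=> <-; rewrite dotC /sg; case: ger0P => h; rewrite ?dotNr.
  have sgn w w' : `|dotp (sg w) (sg w')| = `|dotp w w'|.
    by case: (sgE w) (sgE w') => -> [] ->; rewrite ?dotNl ?dotNr ?opprK ?normrN.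
  have ok w w' : w \in X -> w' \in X -> w != w' -> `|dotp z w| = g -> `|dotp z w'| = g ->
      dotp (sg w) (sg w') = g \/ -1 < 20 * dotp (sg w) (sg w') /\ 20 * dotp (sg w) (sg w') < 1.
    move=> wX w'X ww' gw gw'; have := vals wX w'X ww'; rewrite -sgn.
    have := circle_cauchy (unit zX) (sgu _ wX) (sgu _ w'X) (sgz _ gw) (sgz _ gw').
    move: (dotp (sg w) (sg w')) => t ct; case: (ger0P t) => t0 [] ht; try (by left); try (by right; split; lra).
    by exfalso; nra.
  by apply: (three_neighbours (unit zX) (sgu _ X1) (sgu _ X2) (sgu _ X3) (sgz _ g1z) (sgz _ g2z) (sgz _ g3z) g1 g2
    (fun=> iff_refl _)); exact: ok.
- by apply: leq_ltn_trans X12.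
apply: (@four_far _ s) => //; first by move=> t /sX; exact: unit.
move=> z t zs ts zt; have := indep z t zs ts zt; rewrite /P zt /=.
by case: (vals (sX _ zs) (sX _ ts) zt) => ->; rewrite ?eqxx //; lra.
Qed.

End Three.
End SmallExclusions.

(** * Vectors with few values of positive products *)

Section Arcs.
Variable R : realType.
Notation V := 'rV[R]_3.

Definition crossp (x y : V) : V :=
  \row_j nth 0 [:: x 0 1 * y 0 2%:R - x 0 2%:R * y 0 1; x 0 2%:R * y 0 0 - x 0 0 * y 0 2%:R;
                   x 0 0 * y 0 1 - x 0 1 * y 0 0] j.

Lemma crosspP (x y : V) : [/\ dotp x (crossp x y) = 0, dotp y (crossp x y) = 0
  & dotp (crossp x y) (crossp x y) = dotp x x * dotp y y - dotp x y ^+ 2].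
Proof. by split; rewrite !dotE !mxE /=; ring. Qed.

Lemma seq_argmin (T : eqType) (f : T -> R) (s : seq T) : s != [::] ->
  exists2 z, z \in s & {in s, forall t, f z <= f t}.
Proof.
elim: s => // a [|b s] ih _; first by exists a; rewrite ?mem_head // => t; rewrite inE => /eqP->.
have [//|z zs hz] := ih; have [h|h] := leP (f a) (f z).
  exists a; rewrite ?mem_head // => t; rewrite inE => /predU1P[->//|/hz]; exact: le_trans.
exists z; first by rewrite inE zs orbT.
by move=> t; rewrite inE => /predU1P[->|/hz//]; exact: ltW.
Qed.

(** On the right half of a circle the higher point comes later counterclockwise, so the cross
    product is non-negative. *)
Lemma half_circle (p q p' q' : R) : 0 < p -> 0 < p' -> q <= q' ->
  p ^+ 2 + q ^+ 2 = p' ^+ 2 + q' ^+ 2 -> 0 <= p * q' - q * p'.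
Proof.
move=> p0 p0' qq e; have [q0|q0] := lerP 0 q.
  have qq2 : q ^+ 2 <= q' ^+ 2 by rewrite ler_pXn2r ?nnegrE // (le_trans q0).
  have h : p' <= p by rewrite -(ler_pXn2r (n := 2)) // ?nnegrE; lra.
  by rewrite subr_ge0 mulrC ler_pM // ltW.
have [q0'|q0'] := lerP 0 q'; first by nra.
have qq2 : (- q') ^+ 2 <= (- q) ^+ 2 by rewrite ler_pXn2r // ?nnegrE; lra.
have h : p <= p' by rewrite !sqrrN in qq2; rewrite -(ler_pXn2r (n := 2)) // ?nnegrE; lra.
have : p * (- q') <= p' * (- q) by rewrite ler_pM; lra.
by lra.
Qed.

Variables (W : seq V) (vals : seq R).
Hypotheses (uW : uniq W) (sW : (1 < size W)%N).
Hypothesis unit : forall z, z \in W -> dotp z z = 1.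
Hypothesis pos : {in W &, forall z t, z != t -> 0 < dotp z t < 1 /\ dotp z t \in vals}.

(* The inner product is smallest at (x, w), so all other vectors lie in an open
   half-space bounded by a plane through x. *)
Lemma extreme_vector : exists x m n M, [/\ x \in W, 0 < M, [/\ dotp x m = 0, dotp x n = 0 & dotp m n = 0],
  dotp m m = M /\ dotp n n = M & {in W, forall z, z != x -> 0 < dotp z m}].
Proof.
pose pairs := [seq p <- [seq (a, b) | a <- W, b <- W] | p.1 != p.2].
have memp a b : ((a, b) \in pairs) = [&& a != b, a \in W & b \in W].
  by rewrite mem_filter /=; congr (_ && _); apply/allpairsP/andP => [[[c d] /= [cW dW [-> ->]]]|[aW bW]] //; exists (a, b).
have [] := @seq_argmin _ (fun p => dotp p.1 p.2) pairs.
  case: (W) uW sW memp => [|a [|b s]] //= /andP[ab _] _ memp.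
  have : (a, b) \in pairs by rewrite memp !inE !eqxx orbT /= andbT; apply: contra ab => /eqP->; rewrite inE eqxx.
  by move=> h; apply/eqP => E; rewrite E in h.
move=> [x w]; rewrite memp => /and3P[xw xX wX] min; rewrite /= in min.
have [/andP[l0 l1] _] := pos xX wX xw.
have xx := unit xX; have ww := unit wX; have [c1 c2 c3] := crosspP x w.
exists x, (w - dotp x w *: x), (crossp x w), (1 - dotp x w ^+ 2); split=> //.
- by nra.
- split=> //; first by rewrite !dot_lin xx; ring.
  by rewrite !dot_lin c1 c2; ring.
- split; last by rewrite c3 xx ww mulr1.
  by rewrite !dot_lin xx ww (dotC w x); ring.
move=> z zW zx; rewrite !dot_lin; have [/andP[z0 z1] _] := pos zW xX zx.
have [->|zw] := eqVneq z w; first by rewrite ww (dotC w x); nra.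
have : dotp x w <= dotp z w by apply: (min (z, w)); rewrite memp zw zW wX.
by nra.
Qed.

Section Extreme.
Variables (x m n : V) (M : R).
Hypotheses (xW : x \in W) (M0 : 0 < M) (xm : dotp x m = 0) (xn : dotp x n = 0) (mn : dotp m n = 0).
Hypotheses (mm : dotp m m = M) (nn : dotp n n = M).
Hypothesis half : {in W, forall z, z != x -> 0 < dotp z m}.

Let circle v := [seq z <- W | (z != x) && (dotp z x == v)].

Lemma circle_dot z t v : dotp z x = v -> dotp t x = v ->
  (dotp z t - v ^+ 2) * M = dotp z m * dotp t m + dotp z n * dotp t n.
Proof.
move=> zv tv; have := parseval z t xm xn mn; rewrite mm nn zv tv unit // => e.
have M1 : M != 0 by rewrite lt0r_neq0.
apply: (mulfI M1); apply/eqP; rewrite -subr_eq0; apply/eqP.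
by move/eqP: e; rewrite -subr_eq0 => /eqP e; rewrite -[RHS]e; ring.
Qed.

Lemma circle_inj z t v : dotp z x = v -> dotp t x = v -> dotp z m = dotp t m -> dotp z n = dotp t n -> z = t.
Proof.
move=> zv tv zm zn; apply/eqP; rewrite -subr_eq0; apply/eqP.
have n0 (y : V) (k : R) : dotp y y = k -> 0 < k -> y != 0.
  by move=> <-; apply: contraTneq => ->; rewrite dotE !mxE !mul0r !addr0 ltxx.
by apply: (dot_sum0 xm xn mn); rewrite ?(n0 _ _ mm) ?(n0 _ _ nn) ?(n0 _ _ (unit xW)) // !dot_lin ?zv ?tv ?zm ?zn subrr.
Qed.

Section Circle.
Variables (v : R) (y : V).
Hypotheses (yc : y \in circle v) (ymin : {in circle v, forall t, dotp y n <= dotp t n}).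

Let inc z : z \in circle v -> [/\ z \in W, z != x & dotp z x = v].
Proof. by rewrite mem_filter => /andP[/andP[? /eqP ?] ?]. Qed.

Let cr z := dotp y m * dotp z n - dotp y n * dotp z m.

(** The vectors at product v with x lie on a half circle, and y is its lowest member in the
    direction n. The square of the cross product comes from Lagrange's identity. *)
Lemma circle_cross z : z \in circle v -> 0 <= cr z /\
  cr z ^+ 2 = ((1 - v ^+ 2) ^+ 2 - (dotp y z - v ^+ 2) ^+ 2) * M ^+ 2.
Proof.
move=> zc; have [zW zx zv] := inc zc; have [yW yx yv] := inc yc.
have zz := circle_dot zv zv; have yy := circle_dot yv yv; have yz := circle_dot yv zv.
rewrite unit // in zz; rewrite unit // in yy; split.
  by apply: half_circle; [exact: half|exact: half|exact: ymin|rewrite !expr2 -zz -yy].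
transitivity (((1 - v ^+ 2) * M) * ((1 - v ^+ 2) * M) - ((dotp y z - v ^+ 2) * M) ^+ 2); last ring.
by rewrite {1}yy zz yz /cr; ring.
Qed.

Lemma circle_dot_inj z t : z \in circle v -> t \in circle v -> dotp y z = dotp y t -> z = t.
Proof.
move=> zc tc e; have [zW zx zv] := inc zc; have [tW tx tv] := inc tc; have [yW yx yv] := inc yc.
have [z1 z2] := circle_cross zc; have [t1 t2] := circle_cross tc.
have crE : cr z = cr t by apply/eqP; rewrite -(eqrXn2 (n := 2)) // z2 t2 e.
have yz := circle_dot yv zv; have yt := circle_dot yv tv; rewrite -e yz in yt.
have P0 := half yW yx; have k0 : dotp y m ^+ 2 + dotp y n ^+ 2 != 0.
  by rewrite lt0r_neq0 // ltr_wpDr ?sqr_ge0 // exprn_gt0.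
apply: (circle_inj zv tv); apply: (mulfI k0).
  transitivity (dotp y m * (dotp y m * dotp z m + dotp y n * dotp z n) - dotp y n * cr z); first by rewrite /cr; ring.
  by rewrite crE yt /cr; ring.
transitivity (dotp y n * (dotp y m * dotp z m + dotp y n * dotp z n) + dotp y m * cr z); first by rewrite /cr; ring.
by rewrite crE yt /cr; ring.
Qed.

Lemma circle_map : [/\ uniq [seq dotp y z | z <- rem y (circle v)],
  {subset [seq dotp y z | z <- rem y (circle v)] <= vals}
  & size [seq dotp y z | z <- rem y (circle v)] = (size (circle v)).-1].
Proof.
have uc : uniq (circle v) by rewrite filter_uniq.
split; last by rewrite size_map size_rem.
- rewrite map_inj_in_uniq ?rem_uniq // => z t /mem_rem zr /mem_rem tr; exact: circle_dot_inj.
- move=> _ /mapP[z zr ->]; move: zr; rewrite mem_rem_uniq // inE => /andP[zy zc].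
  have [yW _ _] := inc yc; have [zW _ _] := inc zc.
  have yz : y != z by rewrite eq_sym.
  by have [_ h] := pos yW zW yz.
Qed.

(** z lies between y and t on the arc and is therefore closer to t than y is. *)
Lemma circle_between z t : z \in circle v -> t \in circle v -> z != y -> dotp y t < dotp y z ->
  dotp y t < dotp z t.
Proof.
move=> zc tc zy lt; have [zW zx zv] := inc zc; have [tW tx tv] := inc tc; have [yW yx yv] := inc yc.
have yz' : y != z by rewrite eq_sym.
have [/andP[yz0 yz1] _] := pos yW zW yz'.
have [z1 z2] := circle_cross zc; have [t1 t2] := circle_cross tc.
have ht := circle_dot zv tv; have yz := circle_dot yv zv; have yt := circle_dot yv tv.
have yy := circle_dot yv yv; rewrite unit // in yy.
have [/andP[yx0 yx1] _] := pos yW xW yx; rewrite yv in yx0 yx1.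
have N0 : 0 < 1 - v ^+ 2 by nra.
have NM : 0 < (1 - v ^+ 2) * M by rewrite mulr_gt0.
have key : (1 - v ^+ 2) * (dotp z t - v ^+ 2) * M ^+ 2 =
    (dotp y z - v ^+ 2) * (dotp y t - v ^+ 2) * M ^+ 2 + cr z * cr t.
  transitivity (((1 - v ^+ 2) * M) * ((dotp z t - v ^+ 2) * M)); first ring.
  rewrite yy ht; transitivity (((dotp y z - v ^+ 2) * M) * ((dotp y t - v ^+ 2) * M) + cr z * cr t); last ring.
  by rewrite yz yt /cr; ring.
move: key z1 z2 t1 t2 lt; set N := 1 - v ^+ 2; set A := dotp y z - v ^+ 2; set B := dotp y t - v ^+ 2.
move=> key z1 z2 t1 t2 lt; have AB : B < A by rewrite ltrD2r.
have AN : A < N by rewrite ltrD2r.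
suff : B * (N - A) * M ^+ 2 < cr z * cr t.
  move=> h; have : N * B * M ^+ 2 < N * (dotp z t - v ^+ 2) * M ^+ 2 by rewrite key; lra.
  rewrite ltr_pM2r ?exprn_gt0 // ltr_pM2l // /B; lra.
have M2 : 0 < M ^+ 2 by rewrite exprn_gt0.
have [B0|B0] := ltrP B 0.
  by apply: lt_le_trans (mulr_ge0 z1 t1); rewrite pmulr_llt0 // nmulr_rlt0 // subr_gt0.
have NA0 : 0 <= N - A by rewrite subr_ge0 ltW.
have lhs0 : 0 <= B * (N - A) * M ^+ 2 := mulr_ge0 (mulr_ge0 B0 NA0) (ltW M2).
rewrite -(ltr_pXn2r (n := 2)) ?nnegrE ?lhs0 ?(mulr_ge0 z1 t1) //.
rewrite [X in _ < X]exprMn z2 t2 -subr_gt0.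
have -> : (N ^+ 2 - A ^+ 2) * M ^+ 2 * ((N ^+ 2 - B ^+ 2) * M ^+ 2) - (B * (N - A) * M ^+ 2) ^+ 2 =
  N * (N - A) * M ^+ 4 * (N ^+ 2 - B ^+ 2 + (A * N - B ^+ 2)) by ring.
have NA : 0 < N - A by rewrite subr_gt0.
apply: (mulr_gt0 (mulr_gt0 (mulr_gt0 (N0 : 0 < N) NA) (exprn_gt0 _ M0))).
have BN : B < N := lt_trans AB AN.
have A0 : 0 < A := le_lt_trans B0 AB.
apply: addr_gt0; rewrite subr_gt0 !expr2.
  by apply: ltr_pM.
by apply: ltr_pM.
Qed.

(** The points other than y have products p > q > r with y. The first lies between y and the second,
    so their product exceeds q and equals p; [circle_gram] for these three points is the
    equation. *)
Lemma circle_four p q r : vals = [:: p; q; r] -> r < q -> q < p -> p < 1 -> size (circle v) = 4 ->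
  v ^+ 2 * (4 * p - 3 - q) = 2 * p ^+ 2 - 1 - q.
Proof.
move=> ve rq qp p1 sc; have [um sub sm] := circle_map; rewrite sc in sm.
have [_ eqm] := uniq_min_size um sub (eq_leq (etrans (congr1 size ve) (esym sm))).
have get t : t \in vals -> exists2 z, z \in circle v & z != y /\ dotp y z = t.
  rewrite -eqm => /mapP[z zr ->]; exists z; first exact: mem_rem zr.
  by move: zr; rewrite mem_rem_uniq ?filter_uniq // inE => /andP[].
have [|z1 z1c [z1y e1]] := get p; first by rewrite ve !inE eqxx.
have [|z2 z2c [z2y e2]] := get q; first by rewrite ve !inE eqxx orbT.
have [W1 x1 v1] := inc z1c; have [W2 x2 v2] := inc z2c; have [yW yx yv] := inc yc.
have z12 : z1 != z2 by apply: contraTneq qp => z12; rewrite -e1 -e2 z12 ltxx.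
have := circle_between z1c z2c z1y; rewrite e1 e2 => /(_ qp) lt.
have e3 : dotp z1 z2 = p.
  have [_] := pos W1 W2 z12; rewrite ve !inE => /or3P[]/eqP k //; move: lt; rewrite k ?ltxx //; lra.
have [/andP[yx0 yx1] _] := pos yW xW yx; rewrite yv in yx0 yx1.
have vv : v ^+ 2 < 1 by nra.
have z1y' : dotp z1 y = p by rewrite dotC.
have := circle_gram (unit xW) vv (unit W1) (unit yW) (unit W2) v1 yv v2.
rewrite /= z1y' e3 e2; move: (v ^+ 2) vv => w vv e.
have N0 : 1 - w != 0 by rewrite lt0r_neq0 // subr_gt0.
have Nq : 1 - q != 0 by rewrite lt0r_neq0 // subr_gt0; lra.
apply: (mulfI N0); apply: (mulfI Nq); apply/eqP; rewrite -subr_eq0; apply/eqP.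
move/eqP: e; rewrite -subr_eq0 => /eqP e; rewrite -[RHS]e; ring.
Qed.

End Circle.
Lemma circle_size v : (size (circle v) <= (size vals).+1)%N.
Proof.
have [->//|ne] := eqVneq (circle v) [::].
have [y yc ymin] := seq_argmin (fun z => dotp z n) ne.
have [um sub sm] := circle_map yc ymin.
have := uniq_leq_size um sub; rewrite sm; by case: (size (circle v)).
Qed.

Lemma circles_size : (size W <= 1 + \sum_(v <- vals) size (circle v))%N.
Proof.
have -> : size W = (size (rem x W)).+1 by rewrite size_rem // prednK // ltnW.
rewrite ltnS; have h z : z \in rem x W -> dotp z x \in vals.
  by rewrite mem_rem_uniq // inE => /andP[zx zW]; have [] := pos zW xW zx.
apply: leq_trans (size_keys h) _; apply: eq_leq; apply: eq_bigr => v _.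
by rewrite -size_filter rem_filter // -filter_predI; congr size; apply: eq_filter => z /=; rewrite andbC.
Qed.

End Extreme.

Lemma few_values_size : (size W <= 1 + size vals * (size vals).+1)%N.
Proof.
have [x [m [n [M [xW M0 [xm xn mn] [mm nn] half]]]]] := extreme_vector.
apply: leq_trans (circles_size xW) _; rewrite leq_add2l.
apply: leq_trans (_ : \sum_(v <- vals) (size vals).+1 <= _)%N.
  by apply: leq_sum => v _; exact: (circle_size xW M0 xm xn mn mm nn half).
by rewrite big_const_seq count_predT iter_addn addn0 mulnC.
Qed.

(** If two arcs had four points, [circle_four] would give 4 p - 3 - q = 0 = 2 p^2 - 1 - q, so p = 1.
    Hence there are at most 1 + 4 + 3 + 3 vectors. *)
Lemma three_values_size p q r : vals = [:: p; q; r] -> r < q -> q < p -> 0 < r -> p < 1 ->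
  (size W <= 11)%N.
Proof.
move=> ve rq qp r0 p1.
have [x [m [n [M [xW M0 [xm xn mn] [mm nn] half]]]]] := extreme_vector.
pose c v := size [seq z <- W | (z != x) && (dotp z x == v)].
have le4 v : (c v <= 4)%N by have := circle_size xW M0 xm xn mn mm nn half v; rewrite ve.
have four v : c v = 4 -> v ^+ 2 * (4 * p - 3 - q) = 2 * p ^+ 2 - 1 - q.
  move=> cv; have ne : [seq z <- W | (z != x) && (dotp z x == v)] != [::].
    by apply: contra_eq_neq cv => e; rewrite /c e.
  have [y yc ymin] := seq_argmin (fun z => dotp z n) ne.
  exact: (circle_four xW M0 xm xn mn mm nn half yc ymin ve rq qp p1 cv).
have two v v' : 0 < v -> v < v' -> c v = 4 -> c v' = 4 -> False.
  clear ve; move=> v0 vv' /four e /four e'; have : (v' ^+ 2 - v ^+ 2) * (4 * p - 3 - q) = 0 by rewrite mulrBl e e' subrr.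
  have h : v' ^+ 2 - v ^+ 2 != 0 by rewrite subr_sqr mulf_neq0 // lt0r_neq0 //; lra.
  move/eqP; rewrite mulf_eq0 (negPf h) => /eqP k; rewrite k mulr0 in e; nra.
have := circles_size xW; rewrite ve !big_cons big_nil -/(c p) -/(c q) -/(c r).
clear ve; have [q0 rp] : 0 < q /\ r < p by split; lra.
have := (two _ _ q0 qp, two _ _ r0 rq, two _ _ r0 rp, le4 p, le4 q, le4 r).
move: (c p) (c q) (c r) => cp cq cr [[[[[h1 h2] h3] k1] k2] k3] h; apply: leq_trans h _.
have : ~ (cp = 4 /\ cq = 4) by move=> [? ?]; exact: h1.
have : ~ (cq = 4 /\ cr = 4) by move=> [? ?]; exact: h2.
have : ~ (cp = 4 /\ cr = 4) by move=> [? ?]; exact: h3.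
by move: k1 k2 k3; clear; lia.
Qed.

End Arcs.

(** * Excluded regions: clusters of close lines *)

Section Clusters.
Variable R : realType.
Notation V := 'rV[R]_3.

Definition orient (p t : V) : V := if 0 <= dotp p t then t else - t.

Lemma orientE p t : orient p t = t \/ orient p t = - t.
Proof. by rewrite /orient; case: ifP; auto. Qed.

Lemma orient_dot p t : dotp p (orient p t) = `|dotp p t|.
Proof. by rewrite /orient; case: ger0P => h; rewrite ?dotNr. Qed.

Lemma orient_norm p t : dotp (orient p t) (orient p t) = dotp t t.
Proof. by case: (orientE p t) => ->; rewrite ?dotNl ?dotNr ?opprK. Qed.

Lemma orient_normr p t p' t' : `|dotp (orient p t) (orient p' t')| = `|dotp t t'|.
Proof.
by case: (orientE p t) (orientE p' t') => -> [] ->; rewrite ?dotNl ?dotNr ?opprK ?normrN.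
Qed.

Section Three.
Variables (f y z : R) (X : seq V).
Hypotheses (f01 : 0 <= f < 1) (y01 : 0 <= y < 1) (z01 : 0 <= z < 1).
Hypotheses (L : lineset f y z X) (X12 : (11 < size X)%N).

Let unit t : t \in X -> dotp t t = 1. Proof. by case: L => _ h _; exact: h. Qed.
Let uX : uniq X. Proof. by case: L. Qed.
Let vals t w : t \in X -> w \in X -> t != w -> [\/ `|dotp t w| = f, `|dotp t w| = y | `|dotp t w| = z].
Proof. by case: L => _ _ h *; apply: in3P; exact: h. Qed.
Let lt1 t w : t \in X -> w \in X -> t != w -> `|dotp t w| < 1.
Proof. by move=> tX wX tw; case: (vals tX wX tw) => ->; [case/andP: f01|case/andP: y01|case/andP: z01]. Qed.

Lemma orient_inj p t w : t \in X -> w \in X -> orient p t = orient p w -> t = w.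
Proof.
move=> tX wX e; apply/eqP/negPn/negP => ne; have := lt1 tX wX ne.
by rewrite -(orient_normr p t p w) e orient_norm unit // normr1 ltxx.
Qed.

(** The lines not at product f from p, oriented towards p, have pairwise products above f, hence y
    or z, and [few_values_size] allows 1 + 2 * 3 = 7 of them. The others are at product f from both
    p and q, hence at most four by [key_count]. *)
Lemma not_excl2 : attained y X -> ~ excl2 f y z.
Proof.
move=> [p [q [pX qX pq pqy]]] [fy fz].
case/andP: (f01) => f0 f1; case/andP: (y01) => y0 y1; case/andP: (z01) => z0 z1.
have trans a b : a = y \/ a = z -> b = y \/ b = z -> f < (a + b) ^+ 2 / 2 - 1.
  have yz : f < (y + z) ^+ 2 / 2 - 1 by case: (leP y z) => ?; nra.
  by case=> ->; case=> -> //; nra.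
pose near t := (t == p) || (`|dotp p t| != f).
have nearP t : t \in X -> t != p -> near t -> `|dotp p t| = y \/ `|dotp p t| = z.
  move=> tX tp; rewrite /near (negPf tp) /=; have pt : p != t by rewrite eq_sym.
  by case: (vals pX tX pt) => ->; rewrite ?eqxx //; auto.
pose K := [seq orient p t | t <- X & near t].
have K7 : (size K <= 7)%N.
  rewrite leqNgt; apply/negP => K8.
  have uK : uniq K.
    rewrite map_inj_in_uniq ?filter_uniq // => t w; rewrite !mem_filter => /andP[_ tX] /andP[_ wX].
    exact: orient_inj.
  have unitK t : t \in K -> dotp t t = 1.
    by move=> /mapP[w]; rewrite mem_filter => /andP[_ wX] ->; rewrite orient_norm unit.
  have posK : {in K &, forall t w, t != w -> 0 < dotp t w < 1 /\ dotp t w \in undup [:: y; z]}.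
    move=> _ _ /mapP[t + ->] /mapP[w + ->]; rewrite !mem_filter => /andP[nt tX] /andP[nw wX] tw.
    have tw' : t != w by apply: contraNneq tw => ->.
    have l := lt1 tX wX tw'; have v := vals tX wX tw'.
    suff fl : f < dotp (orient p t) (orient p w).
      have nE : `|dotp t w| = dotp (orient p t) (orient p w).
        by rewrite -(orient_normr p t p w) ger0_norm // ltW // (le_lt_trans f0).
      rewrite nE in l v; rewrite l (le_lt_trans f0 fl) mem_undup !inE; split=> //.
      by move: fl; case: v => ->; rewrite ?ltxx ?eqxx ?orbT.
    have [tp|tp] := eqVneq t p.
      have op : orient p p = p by rewrite /orient dot_ge0.
      rewrite tp op orient_dot; have wp : w != p by rewrite -tp eq_sym.
      by case: (nearP _ wX wp nw) => ->; nra.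
    have [wp|wp] := eqVneq w p.
      have op : orient p p = p by rewrite /orient dot_ge0.
      rewrite wp op dotC orient_dot.
      by case: (nearP _ tX tp nt) => ->; nra.
    have := @dot_close _ p (orient p t) (orient p w); rewrite !orient_norm !unit // !orient_dot.
    move=> /(_ erefl erefl erefl); apply: lt_le_trans; apply: trans; exact: nearP.
  have := few_values_size uK (ltn_trans (isT : (1 < 7)%N) K8) unitK posK.
  have s2 : (size (undup [:: y; z]) <= 2)%N by apply: size_undup.
  move=> h; have : (size K <= 1 + 2 * 3)%N by apply: leq_trans h _; rewrite leq_add2l leq_mul.
  by rewrite leqNgt K8.
have [w [wE pw]] : exists w, (w = q \/ w = - q) /\ dotp p w = y.
  by exists (orient p q); split; [exact: orientE|rewrite orient_dot].
have ww : dotp w w = 1 by case: wE => ->; rewrite ?dotNl ?dotNr ?opprK unit.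
have yy : y ^+ 2 < 1 by nra.
have keysO t : t \in [seq t <- X | ~~ near t] -> key p w t \in [:: (f, f); (f, - f)].
  rewrite mem_filter /near negb_or negbK => /andP[/andP[tp /eqP ptf] tX].
  have tq : t != q by apply: contraTneq y0 => e; move: pqy; rewrite -e ptf => e'; rewrite -ltNge; nra.
  have [k1 k2] := key_norm p w t; rewrite dotC ptf in k1.
  suff tqf : `|dotp t w| = f.
    rewrite tqf in k2; case: (key p w t) k1 k2 => i j /= -> jf; rewrite !inE !xpair_eqE !eqxx /=.
    by move: jf; case: ger0P => h <-; rewrite ?opprK eqxx ?orbT.
  have -> : `|dotp t w| = `|dotp q t| by rewrite dotC; case: wE => ->; rewrite ?dotNl ?normrN.
  have qt : q != t by rewrite eq_sym.
  have : ~ (`|dotp q t| = y \/ `|dotp q t| = z).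
    move=> h; have := @dot_close _ q (orient q p) (orient q t); rewrite !orient_norm !unit // !orient_dot.
    move=> /(_ erefl erefl erefl); rewrite (dotC q p) pqy => h'.
    have := lt_le_trans (trans y _ (or_introl erefl) h) h'; rewrite -ptf -(orient_normr q p q t).
    by rewrite ltNge ler_norm.
  by case: (vals qX tX qt) => // ->; tauto.
have O4 : (size [seq t <- X | ~~ near t] <= 4)%N.
  have cnt k : (count (fun t => key p w t == k) [seq t <- X | ~~ near t] <= 2)%N.
    apply: leq_trans (key_count (unit pX) ww pw yy k f01 y01 z01 L).
    by rewrite count_filter sub_count // => t /andP[].
  apply: leq_trans (size_keys keysO) _; rewrite !big_cons big_nil addn0.
  exact: (leq_add (cnt _) (cnt _)).
have : (size X <= 7 + 4)%N.
  by rewrite -(count_predC near) -!size_filter leq_add // -(size_map (orient p)).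
by rewrite leqNgt X12.
Qed.

(** Oriented towards one line, all vectors have pairwise products above -1/2 by [dot_close]. Their
    absolute values exceed 1/2, so they are positive, and [three_values_size] applies, or
    [few_values_size] if values coincide. *)
Lemma not_excl0_big : ~ [/\ 1 < 2 * f, 1 < 2 * y & 1 < 2 * z].
Proof.
move=> [hf hy hz].
have [p pX] : exists p, p \in X by case: (X) X12 => // p t _; exists p; rewrite mem_head.
pose K := [seq orient p t | t <- X].
have sK : size K = size X by rewrite size_map.
have K12 : (11 < size K)%N by rewrite sK.
have uK : uniq K by rewrite map_inj_in_uniq // => t w tX wX; exact: orient_inj.
have unitK t : t \in K -> dotp t t = 1 by move=> /mapP[w wX ->]; rewrite orient_norm unit.
have posK : {in K &, forall t w, t != w -> 0 < dotp t w < 1 /\ dotp t w \in [:: f; y; z]}.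
  move=> _ _ /mapP[t tX ->] /mapP[w wX ->] tw.
  have tw' : t != w by apply: contraNneq tw => ->.
  have l := lt1 tX wX tw'; have v := vals tX wX tw'; rewrite -(orient_normr p t p w) in l v.
  suff d0 : 0 < dotp (orient p t) (orient p w).
    rewrite gtr0_norm // in l v; rewrite d0 l !inE; split=> //.
    by case: v => ->; rewrite eqxx ?orbT.
  have big t' : t' \in X -> 1 < 2 * dotp p (orient p t').
    move=> t'X; rewrite orient_dot; have [->|pt] := eqVneq p t'; first by rewrite unit // normr1; lra.
    by case: (vals pX t'X pt) => ->.
  have := @dot_close _ p (orient p t) (orient p w); rewrite !orient_norm !unit // => /(_ erefl erefl erefl).
  move: (big _ tX) (big _ wX) v l; move: (dotp p _) (dotp p _) (dotp (orient p t) _) => a b d a1 b1 v l.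
  move=> h; have dh : - 1 < 2 * d by nra.
  have d1 : 1 < 2 * `|d| by case: v => ->.
  by move: d1; case: (ger0P d) => d0; lra.
have fewer (vs : seq R) : (size vs <= 2)%N -> {subset [:: f; y; z] <= vs} -> False.
  move=> svs sub; have posv : {in K &, forall t w, t != w -> 0 < dotp t w < 1 /\ dotp t w \in vs}.
    by move=> t w tK wK tw; have [h /sub] := posK t w tK wK tw.
  have h := few_values_size uK (ltn_trans (isT : (1 < 11)%N) K12) unitK posv.
  have : (size K <= 1 + 2 * 3)%N by apply: leq_trans h _; rewrite leq_add2l leq_mul.
  by rewrite leqNgt (ltn_trans (isT : (7 < 11)%N) K12).
have sorted a b c : c < b -> b < a -> a < 1 -> 0 < c -> {subset [:: f; y; z] <= [:: a; b; c]} -> False.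
  move=> cb ba a1 c0 sub; have posv : {in K &, forall t w, t != w -> 0 < dotp t w < 1 /\ dotp t w \in [:: a; b; c]}.
    by move=> t w tK wK tw; have [h /sub] := posK t w tK wK tw.
  have := three_values_size uK (ltn_trans (isT : (1 < 11)%N) K12) unitK posv erefl cb ba c0 a1.
  by rewrite leqNgt K12.
case/andP: f01 => f0 f1; case/andP: y01 => y0 y1; case/andP: z01 => z0 z1.
case: (ltgtP f y) => fy; last by apply: (fewer (undup [:: y; z])); rewrite ?size_undup // => t; rewrite mem_undup fy !inE orbA orbb.
all: case: (ltgtP y z) => yz; try by apply: (fewer (undup [:: f; z])); rewrite ?size_undup // => t; rewrite mem_undup yz !inE orbb.
all: case: (ltgtP f z) => fz; try by apply: (fewer (undup [:: y; z])); rewrite ?size_undup // => t; rewrite mem_undup fz !inE => /or3P[]->; rewrite ?orbT.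
all: try lra.
- by apply: (sorted z y f) ; try lra; move=> t; rewrite !inE => /or3P[]->; rewrite ?orbT.
- by apply: (sorted y z f) ; try lra; move=> t; rewrite !inE => /or3P[]->; rewrite ?orbT.
- by apply: (sorted y f z) ; try lra; move=> t; rewrite !inE => /or3P[]->; rewrite ?orbT.
- by apply: (sorted z f y) ; try lra; move=> t; rewrite !inE => /or3P[]->; rewrite ?orbT.
- by apply: (sorted f z y) ; try lra; move=> t; rewrite !inE => /or3P[]->; rewrite ?orbT.
- by apply: (sorted f y z) ; try lra; move=> t; rewrite !inE => /or3P[]->; rewrite ?orbT.
Qed.

End Three.
End Clusters.

Lemma lineset_perm (R : realType) (p q r p' q' r' : R) (X : seq 'rV[R]_3) :
  perm_eq [:: p; q; r] [:: p'; q'; r'] -> lineset p q r X -> lineset p' q' r' X.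
Proof. by move=> /perm_mem e [h1 h2 h3]; split=> // x y xX yX xy; rewrite -e; exact: h3. Qed.

Lemma not_excluded (R : realType) (p q r : R) (X : seq 'rV[R]_3) :
  0 <= p < 1 -> 0 <= q < 1 -> 0 <= r < 1 -> lineset p q r X -> (11 < size X)%N ->
  attained p X -> attained q X -> attained r X -> ~ excluded p q r.
Proof.
move=> p01 q01 r01 L X12 ap aq ar.
have Lqpr : lineset q p r X by apply: lineset_perm L; rewrite (perm_catCA [:: p] [:: q] [:: r]).
have Lrpq : lineset r p q X by apply: lineset_perm L; rewrite (perm_catCA [:: p; q] [:: r] [::]).
have Lqrp : lineset q r p X by apply: lineset_perm Lqpr; rewrite /= perm_cons (perm_catC [:: p] [:: r]).
have Lprq : lineset p r q X by apply: lineset_perm L; rewrite /= perm_cons (perm_catC [:: q] [:: r]).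
move=> [[h|h]|[[h|h|h]|[[h|h|h]|[h|h|h]]]].
- exact: (not_excl0_small L X12 h).
- exact: (not_excl0_big p01 q01 r01 L X12 h).
- exact: (not_excl1 p01 q01 r01 L X12 ap h).
- exact: (not_excl1 q01 p01 r01 Lqpr X12 aq h).
- exact: (not_excl1 r01 p01 q01 Lrpq X12 ar h).
- exact: (not_excl2 p01 q01 r01 L X12 aq h).
- exact: (not_excl2 q01 p01 r01 Lqpr X12 ap h).
- exact: (not_excl2 r01 p01 q01 Lrpq X12 ap h).
- exact: (not_excl3 r01 p01 q01 Lrpq X12 h).
- exact: (not_excl3 q01 p01 r01 Lqpr X12 h).
- exact: (not_excl3 p01 q01 r01 L X12 h).
Qed.

(** * From lines to quadruples of labels *)

Section OnLines.
Variable R : realType.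
Notation V := 'rV[R]_3.
Implicit Types (x y t : V) (X : seq V).

Definition online X x := (x \in X) || (- x \in X).

Lemma online_unit p q r X x : lineset p q r X -> online X x -> dotp x x = 1.
Proof.
by move=> [_ u _] /orP[/u//|/u]; rewrite !dot_lin opprK.
Qed.

Lemma onlineN X x : online X (- x) = online X x.
Proof. by rewrite /online opprK orbC. Qed.

Definition off x t := (t != x) && (t != - x).

Lemma online_dot p q r X x t : lineset p q r X -> online X x -> online X t -> off x t ->
  `|dotp t x| \in [:: p; q; r].
Proof.
move=> [_ _ h] /orP[xX|xX] /orP[tX|tX] /andP[n1 n2].
- exact: h.
- by have := h _ _ tX xX; rewrite dotNl normrN eqr_oppLR; apply.
- by have := h _ _ tX xX; rewrite dotNr normrN; apply.
- by have := h _ _ tX xX; rewrite dotNl dotNr opprK eqr_opp; apply.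
Qed.

Lemma not_both p q r X t : p < 1 -> q < 1 -> r < 1 -> lineset p q r X -> t \in X -> - t \in X -> False.
Proof.
move=> p1 q1 r1 [_ u h] tX NX; have tN : t != - t.
  apply/eqP => e; have := u t tX; rewrite {1}e dotNl (u t tX) => /eqP; rewrite -subr_eq0 -opprD oppr_eq0.
  by rewrite -[1 + 1]/(2%:R) pnatr_eq0.
have := h _ _ tX NX tN; rewrite dotNr normrN u // normr1 !inE => /or3P[]/eqP e.
- by rewrite -e ltxx in p1.
- by rewrite -e ltxx in q1.
- by rewrite -e ltxx in r1.
Qed.

Lemma size_off p q r X s : p < 1 -> q < 1 -> r < 1 -> lineset p q r X ->
  (size X <= size [seq t <- X | all (off^~ t) s] + size s)%N.
Proof.
move=> p1 q1 r1 L; rewrite size_filter -(count_predC (fun t => all (off^~ t) s) X) leq_add2l.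
elim: s => [|x s ih]; first by rewrite (@eq_count _ _ pred0) ?count_pred0.
rewrite (@eq_count _ _ (predU (fun t => ~~ off x t) (predC (fun t => all (off^~ t) s)))); last first.
  by move=> t; rewrite /= negb_and.
have := count_predUI (fun t => ~~ off x t) (predC (fun t => all (off^~ t) s)) X.
suff : (count (fun t => ~~ off x t) X <= 1)%N by rewrite [size (x :: s)]/=; lia.
rewrite leqNgt; apply/negP => /(count_ge2 (let: And3 h _ _ := L in h)) [t [t' [tX tX' tt']]].
rewrite !negb_and !negbK => h h'; case/orP: h => /eqP h; case/orP: h' => /eqP h'; move: tt'; rewrite h h' ?eqxx // => _.
- by apply: (not_both p1 q1 r1 L tX); rewrite h -h'.
- by apply: (not_both p1 q1 r1 L tX'); rewrite h' -h.
Qed.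

Section Quads.
Variables (sg : bool) (lu lv : label) (a b c : R) (X : seq V) (x1 x2 x3 x4 : V).
Notation lval := (lval a b c).
Hypotheses (a1 : `|a| < 1) (b1 : `|b| < 1) (c1 : `|c| < 1).
Hypotheses (L : lineset `|a| `|b| `|c| X) (X12 : (11 < size X)%N).
Hypotheses (C : cycle sg a (lval lu) (lval lv) x1 x2 x3 x4).
Hypothesis nondeg : sg = false -> ~ (lval lu = 0 /\ lval lv = 0).
Hypotheses (o1 : online X x1) (o2 : online X x2) (o3 : online X x3) (o4 : online X x4).

(** Unsigned labels come first, so [lab] prefers them when the values of labels coincide
    ([lab_pos]). *)
Let ls := [:: La; Lb; Lc; Na; Nb; Nc].
Let lab (x : R) : label := nth La ls (find (fun l => lval l == x) ls).

Let labP (x : R) : `|x| \in [:: `|a|; `|b|; `|c|] -> lval (lab x) = x.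
Proof.
move=> h; apply/eqP; rewrite /lab; apply: (@nth_find _ La (fun l => lval l == x)).
have hx (y : R) : `|x| = `|y| -> (y == x) || (- y == x).
  by move=> e; have := eqr_norm2 y x; rewrite e eqxx => /esym; rewrite eqr_oppLR.
move: h => /in3P[]/hx/orP[]/eqP h; rewrite /ls /= h eqxx ?orbT //.
Qed.

Let lab_pos (x : R) : x \in [:: a; b; c] -> lab x \in [:: La; Lb; Lc].
Proof.
rewrite /lab /ls /= !inE ![x == _]eq_sym.
by case: (a == x) => //=; case: (b == x) => //=; case: (c == x).
Qed.

Let others := [seq t <- X | all (off^~ t) [:: x1; x2; x3; x4]].
Let o t := if dotp t x1 \in [:: a; b; c] then t else - t.

Let oE t : o t = t \/ o t = - t. Proof. by rewrite /o; case: ifP; auto. Qed.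

Let o_dot t : `|dotp t x1| \in [:: `|a|; `|b|; `|c|] -> dotp (o t) x1 \in [:: a; b; c].
Proof.
move=> h; rewrite /o; case: ifPn => // /negP n; rewrite dotNl.
have hx (y : R) : `|dotp t x1| = `|y| -> dotp t x1 = y \/ - dotp t x1 = y.
  by move=> e; have := eqr_norm2 (dotp t x1) y; rewrite e eqxx => /esym/orP[]/eqP->; rewrite ?opprK; auto.
move: h => /in3P[]/hx[e|->]; rewrite ?inE ?eqxx ?orbT //; case: n; rewrite e !inE eqxx ?orbT //.
Qed.

Let off_o x t : off x (o t) = off x t.
Proof. by case: (oE t) => ->; rewrite // /off eqr_oppLR eqr_opp andbC. Qed.

Let on_o t : t \in X -> online X (o t).
Proof. by move=> tX; case: (oE t) => ->; rewrite ?onlineN /online tX. Qed.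

Let quadof y := (lab (dotp y x1), lab (dotp y x2), lab (dotp y x3), lab (dotp y x4)).

Let vals t : t \in others -> labelled a b c x1 x2 x3 x4 (o t) (quadof (o t)).
Proof.
rewrite mem_filter /= andbT => /andP[/and4P[n1 n2 n3 n4] tX].
have oo := on_o tX; rewrite /labelled /quadof.
by split; apply/esym/labP/(online_dot L) => //; rewrite off_o.
Qed.

Let inj : {in others &, injective (fun t => quadof (o t))}.
Proof.
move=> t t' tO tO' /= e; have e' : o t = o t'.
  by apply: (labelled_inj C nondeg (vals tO)); rewrite e; exact: vals.
move: tO tO'; rewrite !mem_filter => /andP[_ tX] /andP[_ tX'].
case: (oE t) (oE t') => -> [] -> in e' => //; last exact: oppr_inj.
- by case: (not_both a1 b1 c1 L tX'); rewrite -e'.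
- by case: (not_both a1 b1 c1 L tX); rewrite e'.
Qed.

(** Each line off the cycle is oriented so that its first label is unsigned. Distinct lines give
    distinct quadruples by [labelled_inj]. *)
Lemma cycle_quads : exists (Y : seq quad) (vec : quad -> V),
  [/\ uniq Y, (size X <= size Y + 4)%N, {subset Y <= allq},
      forall y : quad, y \in Y -> labelled a b c x1 x2 x3 x4 (vec y) y /\ dotp (vec y) (vec y) = 1
    & {in Y &, forall y z : quad, y != z -> exists l, dotp (vec y) (vec z) = lval l}
      /\ forall t, t \in X -> exists2 e, e \in [:: x1, x2, x3, x4 & map vec Y] & t = e \/ t = - e].
Proof.
pose Y := [seq quadof (o t) | t <- others]; pose vec (y : quad) := o (nth 0 others (find (fun t => quadof (o t) == y) others)).
have uX : uniq X by case: L.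
have uO : uniq others by rewrite filter_uniq.
have uY : uniq Y by rewrite map_inj_in_uniq.
have vecE t : t \in others -> vec (quadof (o t)) = o t.
  move=> tO; rewrite /vec; set q := fun t' => _; have h : has q others by apply/hasP; exists t => //; exact/eqP.
  by congr o; apply: inj => //; [rewrite mem_nth // -has_find|exact/eqP/(nth_find 0 h)].
exists Y, vec; split=> //.
- by rewrite size_map; exact: (size_off [:: x1; x2; x3; x4] a1 b1 c1 L).
- move=> _ /mapP[t tO ->]; apply/mem_allq/lab_pos/o_dot/(online_dot L) => //.
    by rewrite /online; move: tO; rewrite mem_filter => /andP[_ ->].
  by move: tO; rewrite mem_filter => /andP[/and4P[]].
- move=> _ /mapP[t tO ->]; rewrite vecE //; split; first exact: vals.
  by apply: (online_unit L); apply: on_o; move: tO; rewrite mem_filter => /andP[].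
split=> [_ _ /mapP[t tO ->] /mapP[t' tO' ->] ne|t tX].
  rewrite !vecE //; exists (lab (dotp (o t) (o t'))); apply/esym/labP.
  have tt' : t != t' by apply: contraNneq ne => ->.
  move: tO tO'; rewrite !mem_filter => /andP[_ tX] /andP[_ tX'].
  apply: (online_dot L (on_o tX') (on_o tX)); rewrite off_o /off.
  by case: (oE t') => ->; rewrite ?opprK tt' ?andbT /=; apply/eqP => e; apply: (not_both a1 b1 c1 L tX'); rewrite -e.
case ht: (all (off^~ t) [:: x1; x2; x3; x4]).
  have tO : t \in others by rewrite mem_filter ht.
  exists (o t); last by case: (oE t) => ->; rewrite ?opprK; auto.
  rewrite !inE -(vecE t tO) map_f ?orbT // ; exact: map_f.
move/negbT: ht => /allPn[x xs]; rewrite negb_and !negbK => h.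
exists x; last by case/orP: h => /eqP; auto.
by rewrite -[_ :: _]/([:: x1; x2; x3; x4] ++ _) mem_cat xs.
Qed.

End Quads.
End OnLines.

(** * The coplanar unbalanced cycle *)

Lemma mirror_gap (R : realFieldType) (a : R) : 7 < 10 * a -> 4 * a < 3 ->
  [\/ `|3 - 4 * a| = a, `|3 - 4 * a| = 0 | `|3 - 4 * a| = 1 - a] -> False.
Proof. by move=> al au; rewrite ger0_norm; [case; lra|lra]. Qed.

Lemma half_gap (R : realFieldType) (a : R) : 7 < 10 * a -> 1 / 2 = 1 - a -> False.
Proof. by move=> al ?; lra. Qed.

(** Two unit vectors in an orthonormal frame: the planar part of one lies on an axis with squared
    length 1/2, that of the other is (+-1/2, +-1/2). Their product d then has an impossible
    square. *)
Lemma mixed_gap (R : realFieldType) (i j i' j' n n' d : R) : 1 = i * i + j * j + n * n ->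
  1 = i' * i' + j' * j' + n' * n' -> d = i * i' + j * j' + n * n' ->
  i * i + j * j = 1 / 2 -> i' * i' = 1 / 4 -> j' * j' = 1 / 4 -> i * j = 0 ->
  [\/ d * d = 1 / 2, d * d = 0 | d * d = 1 / 4] -> False.
Proof.
move=> e1 e2 dE k hi hj ij hd; set s := i * i' + j * j' in dE.
have ss : s * s = 1 / 8.
  transitivity ((i * i) * (i' * i') + (j * j) * (j' * j') + 2 * (i * j) * (i' * j')); first by rewrite /s; ring.
  by rewrite hi hj ij; lra.
have nn : (d - s) * (d - s) = 1 / 4.
  transitivity ((n * n) * (n' * n')); first by rewrite dE; ring.
  have -> : n * n = 1 / 2 by lra.
  have -> : n' * n' = 1 / 2 by lra.
  by field.
have e : 2 * (d * s) = d * d - 1 / 8 by rewrite -ss; move: nn; lra.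
have q : (2 * (d * s)) * (2 * (d * s)) = (d * d) / 2 by transitivity (4 * (d * d) * (s * s)); [ring|rewrite ss; field].
by rewrite e in q; case: hd => h; rewrite h in q; lra.
Qed.

Section Degenerate.
Variables (R : realType) (a w : R) (X : seq 'rV[R]_3) (x1 x2 x3 x4 : 'rV[R]_3).
Hypotheses (a0 : 0 <= a) (aa : 2 * a ^+ 2 = 1) (w01 : 0 <= w < 1).
Hypotheses (L : lineset a 0 w X) (X12 : (11 < size X)%N).
Hypotheses (C : cycle false a 0 0 x1 x2 x3 x4).
Hypotheses (o1 : online X x1) (o2 : online X x2) (o3 : online X x3) (o4 : online X x4).
Let E := cycleE C.
Let w0 : 0 <= w. Proof. by case/andP: w01. Qed.
Let w1 : w < 1. Proof. by case/andP: w01. Qed.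
Let al : 7 < 10 * a.
Proof.
rewrite ltNge; apply/negP => h; have := mulr_ge0 a0 (_ : 0 <= 7 - 10 * a); rewrite subr_ge0 => /(_ h).
by move: aa h; rewrite !expr2; lra.
Qed.
Let au : 4 * a < 3. Proof. by have := sqr_ge0 (4 * a - 3); move: aa; rewrite !expr2; lra. Qed.

(** For 2 a^2 = 1 the vectors x2 and x4 are the normalised sum and difference of the orthogonal
    vectors x1 and x3. *)
Let diagonals t : dotp t x2 = a * (dotp t x1 + dotp t x3) /\ dotp t x4 = a * (dotp t x3 - dotp t x1).
Proof.
have e2 : x2 - a *: (x1 + x3) = 0.
  by apply: dot_eq0; rewrite !dot_lin !E; transitivity (1 - 2 * a ^+ 2); [ring|rewrite aa subrr].
have e4 : x4 - a *: (x3 - x1) = 0.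
  by apply: dot_eq0; rewrite !dot_lin !E; transitivity (1 - 2 * a ^+ 2); [ring|rewrite aa subrr].
move: e2 e4 => /eqP; rewrite subr_eq0 => /eqP-> /eqP; rewrite subr_eq0 => /eqP->.
by rewrite !dot_lin; split; ring.
Qed.

Let others : seq 'rV[R]_3 := [seq t <- X | all (fun x : 'rV[R]_3 => off x t) [:: x1; x2; x3; x4]].
Let ky := key x1 x3.

(** i and j are the absolute products of a line with x1 and x3. One of those with x2 and x4 is a (i
    + j), which must again be a, 0 or w. *)
Definition planar_key (i j : R) : Prop :=
  [\/ i = 0 /\ j = 0, w = 1 / 2 /\ (i = a /\ j = 0 \/ i = 0 /\ j = a),
      w = 1 / 2 /\ (i = w /\ j = w) | w = 1 - a /\ (i = a /\ j = w \/ i = w /\ j = a)].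

Lemma planar_keyP (i j : R) : [\/ i = a, i = 0 | i = w] -> [\/ j = a, j = 0 | j = w] ->
  [\/ a * (i + j) = a, a * (i + j) = 0 | a * (i + j) = w] -> planar_key i j.
Proof.
have [[[al' au'] w0'] w1'] := (al, au, w0, w1).
have an0 : a != 0 by apply: lt0r_neq0; lra.
have a2 : a * a = 1 / 2 by move: aa; rewrite expr2; lra.
have aw0 : 0 <= a * w by rewrite mulr_ge0.
have aw1 : 4 * (a * w) <= 3 * w by rewrite mulrA ler_wpM2r // ltW.
have aw2 : 7 * w <= 10 * (a * w) by rewrite mulrA ler_wpM2r // ltW.
have half : [\/ a * a = a, a * a = 0 | a * a = w] -> w = 1 / 2 by rewrite a2; case; lra.
have aw : [\/ a * (a + w) = a, a * (a + w) = 0 | a * (a + w) = w] -> w = 1 - a.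
  rewrite mulrDr a2; case=> h; [|lra|lra].
  by apply: (mulfI an0); rewrite mulrBr mulr1 a2; lra.
have w00 : [\/ a * w = a, a * w = 0 | a * w = w] -> w = 0.
  case=> h; [by have := mulfI an0 (etrans h (esym (mulr1 a))); lra| |lra].
  by move/eqP: h; rewrite mulf_eq0 (negPf an0) => /eqP.
have ww : [\/ a * (w + w) = a, a * (w + w) = 0 | a * (w + w) = w] -> w = 1 / 2 \/ w = 0.
  case=> h; [left|right|right].
  - by have := mulfI an0 (etrans h (esym (mulr1 a))); lra.
  - by move/eqP: h; rewrite mulf_eq0 (negPf an0) /= => /eqP; lra.
  - by move: h; rewrite mulrDr; lra.
case=> -> [] ->; rewrite ?addr0 ?add0r; rewrite ?(addrC w a) => h.
- by case: h; rewrite mulrDr a2; lra.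
- by constructor 2; split; [exact: half|left].
- by constructor 4; split; [exact: aw|left].
- by constructor 2; split; [exact: half|right].
- by constructor 1.
- by constructor 1; split=> //; exact: w00.
- by constructor 4; split; [exact: aw|right].
- by constructor 1; split=> //; exact: w00.
- by case: (ww h) => e; [constructor 3|constructor 1]; rewrite e.
Qed.

Lemma key_planar t : t \in others -> planar_key (ky t).1 `|(ky t).2|.
Proof.
move=> tO; have [tX n1 n2 n3 n4] : [/\ t \in X, off x1 t, off x2 t, off x3 t & off x4 t].
  by move: tO; rewrite mem_filter /= andbT => /andP[/and4P[]].
have ot : online X t by rewrite /online tX.
have := online_dot L o1 ot n1; have := online_dot L o3 ot n3.
have := online_dot L o2 ot n2; have := online_dot L o4 ot n4.
have [-> ->] := diagonals t; have [k1 k2] := key_norm x1 x3 t; rewrite /ky k1 k2; rewrite !normrM (ger0_norm a0).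
move=> /in3P h4 /in3P h2 /in3P h3 /in3P h1; apply: planar_keyP => //.
move: (dotp t x1) (dotp t x3) h2 h4 => i j.
suff [<-|<-] : `|i + j| = `|i| + `|j| \/ `|j - i| = `|i| + `|j| by [].
by case: (ger0P i) => hi; case: (ger0P j) => hj; [left; rewrite ger0_norm|right; rewrite ler0_norm|right; rewrite ger0_norm|left; rewrite ler0_norm]; lra.
Qed.

Let dd t t' : t \in X -> t' \in X -> t != t' -> [\/ `|dotp (flip x1 x3 t) (flip x1 x3 t')| = a,
  `|dotp (flip x1 x3 t) (flip x1 x3 t')| = 0 | `|dotp (flip x1 x3 t) (flip x1 x3 t')| = w].
Proof.
move=> tX tX' tt'; have [_ _ h] := L; have := in3P (h _ _ tX tX' tt').
by case: (flipE x1 x3 t) (flipE x1 x3 t') => -> [] ->; rewrite ?dotNl ?dotNr ?opprK ?normrN.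
Qed.

Let a01 : 0 <= a < 1. Proof. by rewrite a0; have := au; lra. Qed.
Let z01 : 0 <= (0 : R) < 1. Proof. by rewrite lexx ltr01. Qed.
Let unit t : t \in X -> dotp (flip x1 x3 t) (flip x1 x3 t) = 1.
Proof. by move=> tX; rewrite flip_dot; case: L => _ u _; exact: u. Qed.
Let sub : {subset others <= X}. Proof. by move=> t; rewrite mem_filter => /andP[]. Qed.
Let uO : uniq others. Proof. by rewrite filter_uniq //; case: L. Qed.

Let zz : (0 : R) ^+ 2 < 1. Proof. by rewrite expr0n ltr01. Qed.

Let cnt2 k : (count (fun t => ky t == k) others <= 2)%N.
Proof.
apply: leq_trans (key_count (cyc11 C) (cyc33 C) (cyc13 C) zz k a01 z01 w01 L).
by rewrite count_filter sub_count // => t /andP[].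
Qed.

Let cnt1 i j : (forall d : R, [\/ `|d| = a, `|d| = 0 | `|d| = w] -> d = 2 * (i ^+ 2 + j ^+ 2) - 1 -> False) ->
  (count (fun t => ky t == (i, j)) others <= 1)%N.
Proof.
move=> h; rewrite leqNgt; apply/negP => /(count_ge2 uO)[t [t' [tO tO' tt']]].
move=> /eqP[i1 j1] /eqP[i2 j2]; have tX := sub tO; have tX' := sub tO'.
have ne : flip x1 x3 t != flip x1 x3 t'.
  by apply: contra tt' => /eqP e; apply/eqP/(flip_inj a01 z01 w01 L tX tX' e).
have := mirror_dot (cyc11 C) (cyc33 C) (cyc13 C) (unit tX) (unit tX') ne i1 i2 j1 j2.
move=> e; apply: (h _ (dd tX tX' tt')); move: e; lra.
Qed.

Let cnt0 : (count (fun t => ky t == (0%R, 0%R)) others <= 1)%N.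
Proof.
have [au' w1'] := (au, w1).
by apply: cnt1 => d + e; rewrite e expr0n addr0 mulr0 sub0r normrN1; case=> h; lra.
Qed.

Let keyE t i j : (ky t).1 = i -> `|(ky t).2| = j -> ky t = (i, j) \/ ky t = (i, - j).
Proof.
case: (ky t) => i' j' /= -> <-; by case: (ger0P j') => _; rewrite ?opprK; auto.
Qed.

(** Fewer than eight further lines exist. A key occurs at most twice, and only once if the product
    of mirror images is inadmissible. For w = 1 - a this leaves 1 + 4 lines; for w = 1/2 axis and
    diagonal keys cannot coexist, leaving 1 + 6 or 1 + 4; otherwise only the key (0, 0) remains. *)
Lemma degenerate : False.
Proof.
have [[[al' au'] w0'] w1'] := (al, au, w0, w1).
have : (size others < 8)%N; last first.
  have al1 : a < 1 by case/andP: a01.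
  have h : (size X <= size others + 4)%N := size_off [:: x1; x2; x3; x4] al1 ltr01 w1 L.
  by rewrite ltnNge -(leq_add2r 4) (leq_trans X12 h).
have [wa|nwa] := eqVneq w (1 - a).
  have ks t : t \in others -> ky t \in [:: (0%R, 0%R); (a, w); (a, - w); (w, a); (w, - a)].
    move=> /key_planar[[i j]|[h _]|[h _]|[_ [[i j]|[i j]]]].
    - by case: (keyE i j) => ->; rewrite ?oppr0 !inE eqxx.
    - by case: (half_gap al); rewrite -wa h.
    - by case: (half_gap al); rewrite -wa h.
    - by case: (keyE i j) => ->; rewrite !inE eqxx ?orbT.
    - by case: (keyE i j) => ->; rewrite !inE eqxx ?orbT.
  apply: leq_ltn_trans (size_keys ks) _; rewrite !big_cons big_nil.
  have c i j : i ^+ 2 + j ^+ 2 = a ^+ 2 + w ^+ 2 -> (count (fun t => ky t == (i, j)) others <= 1)%N.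
    move=> e; apply: cnt1 => d hd; rewrite e => dE.
    have {}dE : d = 3 - 4 * a.
      rewrite dE wa; transitivity (1 - 4 * a + 2 * (2 * a ^+ 2)); first ring.
      by rewrite aa; ring.
    by apply: (mirror_gap al au); rewrite -wa -dE.
  have := (cnt0, c a w, c a (- w), c w a, c w (- a)).
  by case=> [[[[h0 h1] h2] h3] h4]; apply: leq_ltn_trans (leq_add h0 (leq_add (h1 erefl) (leq_add (h2 ltac:(ring)) (leq_add (h3 ltac:(ring)) (leq_add (h4 ltac:(ring)) (leqnn 0)))))) _.
have [wh|nwh] := eqVneq w (1 / 2); last first.
  have ks t : t \in others -> ky t \in [:: (0%R, 0%R)].
    move=> /key_planar[[i j]|[h _]|[h _]|[h _]].
    - by case: (keyE i j) => ->; rewrite ?oppr0 !inE eqxx.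
    - by rewrite h eqxx in nwh.
    - by rewrite h eqxx in nwh.
    - by rewrite h eqxx in nwa.
  by apply: leq_ltn_trans (size_keys ks) _; rewrite !big_cons big_nil addn0 (leq_ltn_trans cnt0).
have split4 t : t \in others -> ky t \in [:: (0%R, 0%R); (a, 0%R); (0%R, a); (0%R, - a)%R] \/ ky t \in [:: (w, w); (w, - w)].
  move=> /key_planar[[i j]|[_ [[i j]|[i j]]]|[_ [i j]]|[h _]].
  - by left; case: (keyE i j) => ->; rewrite ?oppr0 !inE eqxx.
  - by left; case: (keyE i j) => ->; rewrite ?oppr0 !inE eqxx ?orbT.
  - by left; case: (keyE i j) => ->; rewrite !inE eqxx ?orbT.
  - by right; case: (keyE i j) => ->; rewrite !inE eqxx ?orbT.
  - by rewrite h eqxx in nwa.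
have compat t t' : t \in others -> t' \in others -> ky t \in [:: (a, 0%R); (0%R, a); (0%R, - a)%R] -> ky t' \in [:: (w, w); (w, - w)] -> False.
  move=> tO tO' kt kt'; have tX := sub tO; have tX' := sub tO'.
  have tt' : t != t' by apply: contraTneq kt => ->; move: kt'; rewrite !inE => /orP[]/eqP->; rewrite !xpair_eqE wh; apply/negP; case/or3P=> /andP[/eqP h /eqP h']; lra.
  have := dd tX tX' tt'; move: (unit tX) (unit tX') kt kt'; rewrite /ky /key.
  have [p1 p3 pp] := crosspP x1 x3; rewrite !E in pp.
  have pv z z' : dotp z z' = dotp z x1 * dotp z' x1 + dotp z x3 * dotp z' x3 + dotp z (crossp x1 x3) * dotp z' (crossp x1 x3).
    have := parseval z z' (cyc13 C) p1 p3; rewrite !E pp => h.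
    by transitivity (dotp z z' * (1 * 1 * (1 * 1 - 0 ^+ 2))); [ring|rewrite h; ring].
  move: (flip x1 x3 t) (flip x1 x3 t') => z z' u u' k k' hd.
  apply: (mixed_gap (etrans (esym u) (pv z z)) (etrans (esym u') (pv z' z')) (pv z z')).
  - by move: k; rewrite !inE => /or3P[]/eqP[-> ->]; rewrite ?mulrNN ?mulr0 ?addr0 ?add0r -expr2; move: aa; lra.
  - by move: k'; rewrite wh !inE => /orP[]/eqP[-> _]; field.
  - by move: k'; rewrite wh !inE => /orP[]/eqP[_ ->]; field.
  - by move: k; rewrite !inE => /or3P[]/eqP[-> ->]; rewrite ?mulr0 ?mul0r.
  have sq (x : R) : `|x| * `|x| = x * x by rewrite -normrM ger0_norm // -expr2 sqr_ge0.
  rewrite -sq; case: hd => ->; [constructor 1; rewrite -expr2; move: aa; lra|constructor 2; exact: mulr0|constructor 3].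
  by rewrite wh; field.
have [/hasP[t tO kt]|/hasPn nA] := boolP (has (fun t => ky t \in [:: (a, 0%R); (0%R, a); (0%R, - a)%R]) others).
  have ks t' : t' \in others -> ky t' \in [:: (0%R, 0%R); (a, 0%R); (0%R, a); (0%R, - a)%R].
    by move=> tO'; case: (split4 _ tO') => // /(compat _ _ tO tO' kt).
  apply: leq_ltn_trans (size_keys ks) _; rewrite !big_cons big_nil.
  exact: (leq_ltn_trans (leq_add cnt0 (leq_add (cnt2 _) (leq_add (cnt2 _) (leq_add (cnt2 _) (leqnn 0)))))).
have ks t : t \in others -> ky t \in [:: (0%R, 0%R); (w, w); (w, - w)].
  move=> tO; case: (split4 _ tO) => [|h]; last by rewrite inE h orbT.
  by rewrite inE => /predU1P[->|/(negP (nA _ tO))//]; rewrite mem_head.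
apply: leq_ltn_trans (size_keys ks) _; rewrite !big_cons big_nil.
have h := leq_add cnt0 (leq_add (cnt2 (w, w)) (leq_add (cnt2 (w, - w)) (leqnn 0))).
exact: (leq_ltn_trans h).
Qed.

End Degenerate.

(** * The computations *)

Notation unit_itv := (0, 4)%BZ.
(** At the initial scale 4 these two boxes are [0, 1] and [-1, 1]. *)
Notation signed_itv := (-4, 4)%BZ.

Notation no_leaf_search sg lu lv ord b c :=
  (search sg lu lv budget ord (fun _ _ _ _ _ _ => false) 26 true 2 4 unit_itv b c allq).

(** One search for each kind of cycle (m unbalanced, p balanced) and each pair of diagonal labels up
    to symmetry; a capital letter stands for a negated label. A parameter ranges over [-1, 1] where
    it absorbs the sign of a diagonal. *)
Lemma run_m_bb : no_leaf_search false Lb Lb false unit_itv unit_itv. Proof. vm_cast_no_check (eq_refl true). Qed.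
Lemma run_m_ab : no_leaf_search false La Lb false unit_itv unit_itv. Proof. vm_cast_no_check (eq_refl true). Qed.
Lemma run_m_bc : no_leaf_search false Lb Lc true unit_itv unit_itv. Proof. vm_cast_no_check (eq_refl true). Qed.
Lemma run_m_aa : no_leaf_search false La La true unit_itv unit_itv. Proof. vm_cast_no_check (eq_refl true). Qed.
Lemma run_p_bB : no_leaf_search true Lb Nb false unit_itv unit_itv. Proof. vm_cast_no_check (eq_refl true). Qed.
Lemma run_p_bc : no_leaf_search true Lb Lc true signed_itv signed_itv. Proof. vm_cast_no_check (eq_refl true). Qed.
Lemma run_p_ab : no_leaf_search true La Lb false signed_itv unit_itv. Proof. vm_cast_no_check (eq_refl true). Qed.
Lemma run_p_Ab : no_leaf_search true Na Lb false signed_itv unit_itv. Proof. vm_cast_no_check (eq_refl true). Qed.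
Lemma run_p_aA : no_leaf_search true La Na false unit_itv unit_itv. Proof. vm_cast_no_check (eq_refl true). Qed.
Lemma run_p_AA : no_leaf_search true Na Na true unit_itv unit_itv. Proof. vm_cast_no_check (eq_refl true). Qed.
(** The exceptional case: its surviving boxes are examined by [special_leaf]. *)
Lemma run_p_bb : search true Lb Lb special_budget false special_leaf 17 true 2 4 unit_itv signed_itv unit_itv allq. Proof. vm_cast_no_check (eq_refl true). Qed.

Definition enumerates (o : seq (nat * bool)) : bool :=
  [&& all (fun i => ((nth (0, false)%N o i).1 < 12)%N) (iota 0 12),
      all (fun e => has (fun i => (nth (0, false)%N o i).1 == e) (iota 0 12)) (iota 0 12)
    & uniq (map fst o) && (size o == 12%N)].

Lemma hints_enumerate h : h \in hints -> enumerates h.2.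
Proof. by move: h; apply/allP; vm_compute. Qed.

(** * From the searches to the pattern of C *)

Section Reduction.
Variables (R : realType) (X : seq 'rV[R]_3).
Notation V := 'rV[R]_3.
Hypothesis X12 : (11 < size X)%N.

(** Stated through absolute values, so that b and c can absorb signs ([confN]). *)
Definition conf (a b c : R) : Prop :=
  [/\ [/\ `|a| < 1, `|b| < 1 & `|c| < 1], lineset `|a| `|b| `|c| X
    & [/\ attained `|a| X, attained `|b| X & attained `|c| X]].

Lemma confC a b c : conf a b c -> conf a c b.
Proof.
move=> [[a1 b1 c1] L [Aa Ab Ac]]; split=> //; apply: lineset_perm L.
by rewrite perm_cons (perm_catC [:: `|b|] [:: `|c|]).
Qed.

Lemma confN a b c : conf a b c -> conf a (- b) c.
Proof. by rewrite /conf normrN. Qed.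

Lemma conf_excl a b c : conf a b c -> ~ excluded `|a| `|b| `|c|.
Proof.
by move=> [[a1 b1 c1] L [Aa Ab Ac]]; apply: (not_excluded _ _ _ L X12 Aa Ab Ac); rewrite normr_ge0.
Qed.

Definition has_cycle sg (a u v : R) : Prop := exists x1 x2 x3 x4, cycle sg a u v x1 x2 x3 x4 /\
  [/\ online X x1, online X x2, online X x3 & online X x4].

Lemma has_cycle_rot a u v : has_cycle true a u v -> has_cycle true a v u.
Proof. by move=> [x1 [x2 [x3 [x4 [/cycle_rot C []]]]]]; exists x2, x3, x4, x1. Qed.

Lemma has_cycle_rotN a u v : has_cycle false a u v -> has_cycle false a v (- u).
Proof.
by move=> [x1 [x2 [x3 [x4 [/cycle_rotN C []]]]]]; exists x2, x3, x4, (- x1); rewrite onlineN.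
Qed.

Lemma has_cycle_refl a u v : has_cycle false a u v -> has_cycle false a v u.
Proof. by move=> [x1 [x2 [x3 [x4 [/cycle_reflN C []]]]]]; exists x4, x3, x2, x1. Qed.

Definition box (I : itv) (x : R) := inI I (zr R 4 * x).

Lemma box_pos x : 0 <= x -> `|x| < 1 -> box unit_itv x.
Proof.
rewrite /box /inI /= => x0 /ltW; rewrite ger0_norm // => x1.
by rewrite mulr_ge0 ?(ler0z R 4) // ler_piMr // (ler0z R 4).
Qed.

Lemma box_full x : `|x| < 1 -> box signed_itv x.
Proof.
rewrite /box /inI /= => /ltW; rewrite ler_norml => /andP[x0 x1].
have z4 : zr R 4 = 4 by [].
have z4' : zr R (-4) = - 4 by [].
by rewrite z4 z4'; split; lra.
Qed.

Section Search.
Variables (sg : bool) (lu lv : label) (ord : bool) (mx : nat -> nat) (n : nat).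
Variables (leaf : Z -> Z -> itv -> itv -> itv -> seq quad -> bool) (IB IC : itv) (a b c : R).
Variables (x1 x2 x3 x4 : V).
Notation lval := (lval a b c).
Hypotheses (a0 : 0 <= a) (K : conf a b c) (hB : box IB b) (hC : box IC c) (oE : ord -> c <= b).
Hypothesis hs : search sg lu lv mx ord leaf n true 2 4 unit_itv IB IC allq.
Hypothesis C : cycle sg a (lval lu) (lval lv) x1 x2 x3 x4.
Hypothesis nondeg : sg = false -> ~ (lval lu = 0 /\ lval lv = 0).
Hypotheses (o1 : online X x1) (o2 : online X x2) (o3 : online X x3) (o4 : online X x4).

Lemma cycle_leaf : exists (Y : seq quad) (vec : quad -> V), [/\ uniq Y, (7 < size Y)%N, (size X <= size Y + 4)%N,
   leaf_reached a b c Y leaf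
  & [/\ forall y : quad, y \in Y -> labelled a b c x1 x2 x3 x4 (vec y) y /\ dotp (vec y) (vec y) = 1,
     {in Y &, forall y z : quad, y != z -> exists2 l, dotp (vec y) (vec z) = lval l & qdot sg lu lv a b c y z (lval l)}
    & forall t, t \in X -> exists2 e, e \in [:: x1, x2, x3, x4 & map vec Y] & t = e \/ t = - e]].
Proof.
have [[a1 b1 c1] L _] := K.
have [Y [vec [uY sX Yq hY [dY cover]]]] := cycle_quads a1 b1 c1 L C nondeg o1 o2 o3 o4.
have sY : (7 < size Y)%N by rewrite -(ltn_add2r 4) (leq_trans X12 sX).
have dots : {in Y &, forall y z : quad, y != z -> exists2 l, dotp (vec y) (vec z) = lval l & qdot sg lu lv a b c y z (lval l)}.
  move=> y z yY zY yz; have [l e] := dY y z yY zY yz; exists l => //; rewrite -e.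
  by have [hy uy] := hY _ yY; have [hz uz] := hY _ zY; apply: (qdot_labelled C nondeg uy uz hy hz).
exists Y, vec; split=> //.
have dots' : {in Y &, forall y z : quad, y != z -> exists l, qdot sg lu lv a b c y z (lval l)}.
  by move=> y z yY zY yz; have [l _ h] := dots y z yY zY yz; exists l.
have facts y : y \in Y -> qfact sg lu lv a b c y.
  by move=> yY; have [hy uy] := hY _ yY; apply: (qfact_labelled C nondeg uy hy).
have hA : inI unit_itv (zr R 4 * a) by exact: box_pos.
exact: (search_sound (labelled_eqn C) (conf_excl K) oE uY sY facts dots' _ _ hA hB hC Yq hs).
Qed.

End Search.

Lemma no_cycle sg lu lv ord IB IC a b c : no_leaf_search sg lu lv ord IB IC -> 0 <= a -> conf a b c ->
  box IB b -> box IC c -> (ord -> c <= b) ->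
  (sg = false -> ~ (lval a b c lu = 0 /\ lval a b c lv = 0)) ->
  ~ has_cycle sg a (lval a b c lu) (lval a b c lv).
Proof.
move=> hr a0 K hB hC oE nd [x1 [x2 [x3 [x4 [C [o1 o2 o3 o4]]]]]].
have [Y [vec [_ _ _ h _]]] := cycle_leaf a0 K hB hC oE hr C nd o1 o2 o3 o4.
by have [k [s [A [B [C' [cs [_ _ _ _ [_]]]]]]]] := h.
Qed.

(* The signed directions f 0, ..., f 11 of X have Gram matrix C(al, be, ga). *)
Definition gram12 : Prop := exists (f : nat -> V) (al be ga : R),
  [/\ size X = 12%N /\ [/\ `|al| < 1, `|be| < 1 & `|ga| < 1], forall i, (i < 12)%N -> dotp (f i) (f i) = 1,
      forall i j, (i < j < 12)%N -> dotp (f i) (f j) = lval al be ga (nth La (nth [::] Cpat i) j)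
    & forall t, t \in X -> exists2 i, (i < 12)%N & t = f i \/ t = - f i].

(** The hint met at the leaf tells in which order and with which signs the cycle and the clique form
    the pattern of C. *)
Lemma special_cycle a b c : 0 <= a -> 0 <= c -> conf a b c -> has_cycle true a b b -> gram12.
Proof.
move=> a0 c0 K [x1 [x2 [x3 [x4 [C [o1 o2 o3 o4]]]]]].
have [[a1 b1 c1] L _] := K; have [_ unit _] := L.
have nd : true = false -> ~ (lval a b c Lb = 0 /\ lval a b c Lb = 0) by [].
have ho : false -> c <= b by [].
have [Y [vec [uY sY sX h [hY dY cover]]]] := cycle_leaf a0 K (box_full b1) (box_pos c0 c1) ho run_p_bb (C : cycle true a (lval a b c Lb) (lval a b c Lb) _ _ _ _) nd o1 o2 o3 o4.
have [k [s [A [B [C' [cs [[k0 sE] hA hB hC [Ycs hl]]]]]]]] := h.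
have dY' : {in Y &, forall y z : quad, y != z -> exists2 l, dotp (vec y) (vec z) = lval a b c l &
    pdot Lb Lb a b c y z = 2 * (1 + b) * (1 - b) * (1 - b) * lval a b c l}.
  by move=> y z yY zY /(dY y z yY zY)[l e hq]; exists l.
have [sY8 [K' [[[K0 m] o] [pK hh hold]]]] := special_leaf_sound uY sY dY' k0 sE hA hB hC Ycs hl.
have sX12 : size X = 12%N by apply/eqP; rewrite eqn_leq X12 andbT (leq_trans sX) // sY8.
move: hold => [EK hold].
have /and3P[/allP h12 /allP hall uo] := hints_enumerate hh; rewrite /snd in h12 hall uo.
pose q n := nth (La, La, La, La) K' (n - 4).
pose g n : V := if (n < 4)%N then nth 0 [:: x1; x2; x3; x4] n else vec (q n).
have sK : size K' = 8%N by rewrite (perm_size pK).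
have uK : uniq K' by rewrite (perm_uniq pK).
have qY n : (3 < n < 12)%N -> q n \in Y.
  by move=> /andP[n3 n12]; rewrite -(perm_mem pK) mem_nth // sK ltn_subLR.
have E := cycleE C.
have gg n : (n < 12)%N -> dotp (g n) (g n) = 1.
  move=> n12; rewrite /g; case: ifPn => [|n4].
    by case: n {n12} => [|[|[|[|//]]]] _ /=; rewrite !E.
  by have [] := hY (q n) (qY _ _); rewrite ?n12 ?andbT // leqNgt.
have gd e f : e != f -> (e < 12)%N -> (f < 12)%N ->
    itemdot a b c (fun y z => dotp (vec y) (vec z)) K' e f = dotp (g e) (g f).
  move=> ef e12 f12; rewrite /itemdot -/(q e) -/(q f) /g.
  case: ifPn => [e4|e4]; case: ifPn => [f4|f4].
  - by move: e4 f4 ef {e12 f12}; case: e => [|[|[|[|//]]]] _; case: f => [|[|[|[|//]]]] //= _ _; rewrite !E.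
  - have /hY[+ _] : q f \in Y by apply: qY; rewrite f12 andbT leqNgt.
    case: (q f) => [[[l1 l2] l3] l4] [h1 h2 h3 h4]; move: e4 {e12 ef}.
    by case: e => [|[|[|[|//]]]] _ /=; rewrite dotC.
  - have /hY[+ _] : q e \in Y by apply: qY; rewrite e12 andbT leqNgt.
    case: (q e) => [[[l1 l2] l3] l4] [h1 h2 h3 h4]; move: f4 {f12 ef}.
    by case: f => [|[|[|[|//]]]] _ /=.
  - by [].
pose f i : V := let: (e, x) := nth (0, false)%N o i in (-1) ^+ x *: g e.
exists f, (lval a b c m.1.1), (lval a b c m.1.2), (lval a b c m.2).
have lt1 l : `|lval a b c l| < 1 by case: l; rewrite /= ?normrN.
split=> //.
- move=> i i12; rewrite /f; have := h12 i; rewrite mem_iota i12 => /(_ isT).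
  by case: (nth _ o i) => e x /= e12; rewrite dotZl dotZr mulrA -expr2 sqrr_sign mul1r gg.
- move=> i j ij; have := hold i j ij; case/andP: ij => ij j12.
  have i12 : (i < 12)%N := ltn_trans ij j12.
  have := h12 i; have := h12 j; rewrite !mem_iota i12 j12 => /(_ isT) + /(_ isT).
  have : (nth (0, false)%N o i).1 != (nth (0, false)%N o j).1.
    case/andP: uo => uo /eqP so.
    have nE n : (n < 12)%N -> (nth (0, false)%N o n).1 = nth 0%N (map fst o) n.
      by move=> n12; rewrite (nth_map (0, false)%N) // so.
    by rewrite !nE // nth_uniq ?size_map ?so // neq_ltn ij.
  rewrite /f; case: (nth _ o i) => e x; case: (nth _ o j) => e' y /= ee' e'12 e12.
  rewrite gd // dotZl dotZr mulrA -signr_addb => ->.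
  by move: m {hold hh} => [[la lb] lc]; case: (nth La _ j) => /=; rewrite ?lval_opp.
move=> t /cover[e he te]; have [n n12 en] : exists2 n, (n < 12)%N & e = g n.
  move: he; rewrite -[_ :: _]/([:: x1; x2; x3; x4] ++ map vec Y) mem_cat => /orP[he|/mapP[y yY ->]].
    exists (index e [:: x1; x2; x3; x4]); first by apply: (@ltn_trans 4) => //; rewrite index_mem.
    by rewrite /g index_mem he nth_index.
  rewrite -(perm_mem pK) in yY; exists (index y K' + 4)%N.
    by rewrite (@ltn_add2r 4 _ 8) -sK index_mem.
  by rewrite /g /q ltnNge leq_addl /= addnK nth_index.
have := hall n; rewrite mem_iota n12 => /(_ isT)/hasP[i]; rewrite mem_iota => i12 /eqP ni.
exists i => //; rewrite /f; move: ni; case: (nth _ o i) => e' x /= ->; rewrite -en.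
by case: x; case: te => ->; rewrite ?scaleN1r ?scale1r ?opprK; auto.
Qed.

End Reduction.

(** The equation factors as (1 - a)(1 + 3 a) = 0. *)
Lemma equal_diagonals (R : realFieldType) (a : R) : 0 <= a -> a < 1 -> (1 + a) * (1 + a) = 4 * a ^+ 2 -> False.
Proof. by move=> a0 a1 e; have : 0 < (1 - a) * (1 + 3 * a) by [apply: mulr_gt0; lra]; lra. Qed.

(** * Every system of twelve or more lines has the pattern of C *)

Section Classification.
Variables (R : realType) (X : seq 'rV[R]_3).
Notation V := 'rV[R]_3.
Hypothesis X12 : (11 < size X)%N.
Notation conf := (conf X).
Notation has_cycle := (has_cycle X).

Lemma has_cycle_lt1 sg a u v : has_cycle sg a u v -> `|u| < 1 /\ `|v| < 1.
Proof. by move=> [x1 [x2 [x3 [x4 [C _]]]]]; have := (cyc_u C, cyc_v C) => -[]. Qed.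

Section Fixed.
Variables (a : R).
Hypothesis a0 : 0 <= a.

(** Rotation exchanges the diagonals, [confC] exchanges b and c, and [confN] reverses a sign. This
    reduces the 36 pairs of labels to the searches, with u = v = +-b or +-c exceptional. *)
Lemma balanced_case b c u v : 0 <= b -> 0 <= c -> conf a b c ->
  (exists l, u = lval a b c l) -> (exists l, v = lval a b c l) -> has_cycle true a u v -> gram12 X.
Proof.
move=> b0 c0 K [lu ->] [lv ->].
have nd (P : Prop) : true = false -> P by [].
have nf (P : Prop) : false -> P by [].
have pAA : ~ has_cycle true a a a.
  move=> H; have [+ _] := has_cycle_lt1 H; have [x1 [x2 [x3 [x4 [C _]]]]] := H.
  rewrite ger0_norm // => a1; exact: equal_diagonals a0 a1 (balanced_eqn C).
have pAN y z : 0 <= y -> 0 <= z -> conf a y z -> ~ has_cycle true a a (- a).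
  move=> y0 z0 K'; have [[_ y1 z1] _ _] := K'.
  exact: (no_cycle X12 run_p_aA a0 K' (box_pos y0 y1) (box_pos z0 z1) (nf _) (nd _)).
have pNN y z : 0 <= y -> 0 <= z -> conf a y z -> ~ has_cycle true a (- a) (- a).
  move=> y0 z0 K'; have [[_ y1 z1] _ _] := K'; case/orP: (le_total z y) => h.
    exact: (no_cycle X12 run_p_AA a0 K' (box_pos y0 y1) (box_pos z0 z1) (fun _ => h) (nd _)).
  exact: (no_cycle X12 run_p_AA a0 (confC K') (box_pos z0 z1) (box_pos y0 y1) (fun _ => h) (nd _)).
have pAB y z : 0 <= z -> conf a y z -> ~ has_cycle true a a y.
  move=> z0 K'; have [[_ y1 z1] _ _] := K'.
  exact: (no_cycle X12 run_p_ab a0 K' (box_full y1) (box_pos z0 z1) (nf _) (nd _)).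
have pNB y z : 0 <= z -> conf a y z -> ~ has_cycle true a (- a) y.
  move=> z0 K'; have [[_ y1 z1] _ _] := K'.
  exact: (no_cycle X12 run_p_Ab a0 K' (box_full y1) (box_pos z0 z1) (nf _) (nd _)).
have pBN y z : 0 <= y -> 0 <= z -> conf a y z -> ~ has_cycle true a y (- y).
  move=> y0 z0 K'; have [[_ y1 z1] _ _] := K'.
  exact: (no_cycle X12 run_p_bB a0 K' (box_pos y0 y1) (box_pos z0 z1) (nf _) (nd _)).
have pBC y z : conf a y z -> ~ has_cycle true a y z.
  move=> K' H; have [[_ y1 z1] _ _] := K'; case/orP: (le_total z y) => h.
    exact: (no_cycle X12 run_p_bc a0 K' (box_full y1) (box_full z1) (fun _ => h) (nd _) H).
  exact: (no_cycle X12 run_p_bc a0 (confC K') (box_full z1) (box_full y1) (fun _ => h) (nd _) (has_cycle_rot H)).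
have K1 := confN K; have K2 := confC K; have K3 := confN K2.
have K4 := confN (confC K1); have K5 := confC K3; have K6 := confC K4; have K7 := confC K1.
have rot := @has_cycle_rot _ X a.
case: lu; case: lv => /= H.
- by case: (pAA H).
- by case: (pAN _ _ b0 c0 K H).
- by case: (pAB _ _ c0 K H).
- by case: (pAB _ _ c0 K1 H).
- by case: (pAB _ _ b0 K2 H).
- by case: (pAB _ _ b0 K3 H).
- by case: (pAN _ _ b0 c0 K (rot _ _ H)).
- by case: (pNN _ _ b0 c0 K H).
- by case: (pNB _ _ c0 K H).
- by case: (pNB _ _ c0 K1 H).
- by case: (pNB _ _ b0 K2 H).
- by case: (pNB _ _ b0 K3 H).
- by case: (pAB _ _ c0 K (rot _ _ H)).
- by case: (pNB _ _ c0 K (rot _ _ H)).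
- exact: (special_cycle X12 a0 c0 K H).
- by case: (pBN _ _ b0 c0 K H).
- by case: (pBC _ _ K H).
- by case: (pBC _ _ K5 H).
- by case: (pAB _ _ c0 K1 (rot _ _ H)).
- by case: (pNB _ _ c0 K1 (rot _ _ H)).
- by case: (pBN _ _ b0 c0 K (rot _ _ H)).
- exact: (special_cycle X12 a0 c0 K1 H).
- by case: (pBC _ _ K1 H).
- by case: (pBC _ _ K6 H).
- by case: (pAB _ _ b0 K2 (rot _ _ H)).
- by case: (pNB _ _ b0 K2 (rot _ _ H)).
- by case: (pBC _ _ K2 H).
- by case: (pBC _ _ K7 H).
- exact: (special_cycle X12 a0 b0 K2 H).
- by case: (pBN _ _ c0 b0 K2 H).
- by case: (pAB _ _ b0 K3 (rot _ _ H)).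
- by case: (pNB _ _ b0 K3 (rot _ _ H)).
- by case: (pBC _ _ K3 H).
- by case: (pBC _ _ K4 H).
- by case: (pBN _ _ c0 b0 K2 (rot _ _ H)).
- exact: (special_cycle X12 a0 b0 K3 H).
Qed.

Lemma degenerate_case b c : 0 <= b -> 0 <= c -> conf a b c ->
  [\/ a = 0, b = 0 | c = 0] -> ~ has_cycle false a 0 0.
Proof.
move=> b0 c0 [[a1 b1 c1] L _] z [x1 [x2 [x3 [x4 [C [o1 o2 o3 o4]]]]]].
rewrite !ger0_norm // in a1 b1 c1 L.
have aa : 2 * a ^+ 2 = 1.
  by have := unbalanced_eqn C; rewrite expr0n /= mul0r addr0 subr0 => /eqP; rewrite sqrf_eq0 subr_eq0 => /eqP.
case: z => z.
- by move/eqP: aa; rewrite z expr0n mulr0 eq_sym oner_eq0.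
- have w01 : 0 <= c < 1 by rewrite c0.
  by rewrite z in L; exact: (degenerate a0 aa w01 L X12 C o1 o2 o3 o4).
- have w01 : 0 <= b < 1 by rewrite b0.
  have L' : lineset a 0 b X by rewrite -z; apply: lineset_perm L; rewrite perm_cons (perm_catC [:: b] [:: c]).
  exact: (degenerate a0 aa w01 L' X12 C o1 o2 o3 o4).
Qed.

(** Rotation maps (u, v) to (v, -u), so both labels may be taken unsigned; reflection exchanges
    them. *)
Lemma unbalanced_case b c u v : 0 <= b -> 0 <= c -> conf a b c ->
  (exists l, u = lval a b c l) -> (exists l, v = lval a b c l) -> ~ has_cycle false a u v.
Proof.
move=> b0 c0 K [lu ->] [lv ->] H.
wlog [nu nv] : lu lv H / lu \in [:: La; Lb; Lc] /\ lv \in [:: La; Lb; Lc].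
  have rot := @has_cycle_rotN _ X a.
  move=> W; case/boolP: (lu \in [:: La; Lb; Lc]) => hu; case/boolP: (lv \in [:: La; Lb; Lc]) => hv.
  - exact: (W lu lv).
  - apply: (W (lopp lv) lu); last by case: (lv) hv.
    by have := rot _ _ (rot _ _ (rot _ _ H)); rewrite opprK lval_opp.
  - apply: (W lv (lopp lu)); last by case: (lu) hu.
    by have := rot _ _ H; rewrite lval_opp.
  - apply: (W (lopp lu) (lopp lv)); last by case: (lu) hu; case: (lv) hv.
    by have := rot _ _ (rot _ _ H); rewrite !lval_opp.
have [[a1 b1 c1] _ _] := K.
have K2 := confC K.
have pos_l l : l \in [:: La; Lb; Lc] -> 0 <= lval a b c l by case: l.
have nd : ~ (lval a b c lu = 0 /\ lval a b c lv = 0).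
  move=> [u0 v0]; rewrite u0 v0 in H; apply: (degenerate_case b0 c0 K _ H).
  by move: nu u0; case: (lu) => //= _ ->; [constructor 1|constructor 2|constructor 3].
have refl := @has_cycle_refl _ X a.
have nf (P : Prop) : false -> P by [].
have pAA y z : 0 <= y -> 0 <= z -> conf a y z -> ~ (a = 0 /\ a = 0) -> ~ has_cycle false a a a.
  move=> y0 z0 K' nd'; have [[_ y1 z1] _ _] := K'; case/orP: (le_total z y) => h.
    exact: (no_cycle X12 run_m_aa a0 K' (box_pos y0 y1) (box_pos z0 z1) (fun _ => h) (fun _ => nd')).
  exact: (no_cycle X12 run_m_aa a0 (confC K') (box_pos z0 z1) (box_pos y0 y1) (fun _ => h) (fun _ => nd')).
have pAB y z : 0 <= y -> 0 <= z -> conf a y z -> ~ (a = 0 /\ y = 0) -> ~ has_cycle false a a y.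
  move=> y0 z0 K' nd'; have [[_ y1 z1] _ _] := K'.
  exact: (no_cycle X12 run_m_ab a0 K' (box_pos y0 y1) (box_pos z0 z1) (nf _) (fun _ => nd')).
have pBB y z : 0 <= y -> 0 <= z -> conf a y z -> ~ (y = 0 /\ y = 0) -> ~ has_cycle false a y y.
  move=> y0 z0 K' nd'; have [[_ y1 z1] _ _] := K'.
  exact: (no_cycle X12 run_m_bb a0 K' (box_pos y0 y1) (box_pos z0 z1) (nf _) (fun _ => nd')).
have pBC y z : 0 <= y -> 0 <= z -> conf a y z -> ~ (y = 0 /\ z = 0) -> ~ has_cycle false a y z.
  move=> y0 z0 K' nd' H'; have [[_ y1 z1] _ _] := K'; case/orP: (le_total z y) => h.
    exact: (no_cycle X12 run_m_bc a0 K' (box_pos y0 y1) (box_pos z0 z1) (fun _ => h) (fun _ => nd') H').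
  have nd'' : ~ (z = 0 /\ y = 0) by tauto.
  exact: (no_cycle X12 run_m_bc a0 (confC K') (box_pos z0 z1) (box_pos y0 y1) (fun _ => h) (fun _ => nd'') (refl _ _ H')).
have sw (P Q : Prop) : ~ (P /\ Q) -> ~ (Q /\ P) by tauto.
move: nu nv nd H; case: (lu) => //; case: (lv) => //= _ _ nd H.
- exact: (pAA _ _ b0 c0 K nd H).
- exact: (pAB _ _ b0 c0 K nd H).
- exact: (pAB _ _ c0 b0 K2 nd H).
- exact: (pAB _ _ b0 c0 K (sw _ _ nd) (refl _ _ H)).
- exact: (pBB _ _ b0 c0 K nd H).
- exact: (pBC _ _ b0 c0 K nd H).
- exact: (pAB _ _ c0 b0 K2 (sw _ _ nd) (refl _ _ H)).
- exact: (pBC _ _ c0 b0 K2 nd H).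
- exact: (pBB _ _ c0 b0 K2 nd H).
Qed.

End Fixed.

Lemma orient_to (p t : V) : exists2 s, s = t \/ s = - t & dotp p s = `|dotp p t|.
Proof. by exists (orient p t); [exact: orientE|exact: orient_dot]. Qed.

(** Orienting x2, x3, x4 in turn makes three sides equal to a. The sign of the fourth decides
    between the two kinds of cycle. *)
Lemma four_cycle b c x1 x2 x3 x4 a : 0 <= a -> 0 <= b -> 0 <= c -> conf a b c ->
  {subset [:: x1; x2; x3; x4] <= X} -> uniq [:: x1; x2; x3; x4] ->
  `|dotp x1 x2| = a -> `|dotp x2 x3| = a -> `|dotp x3 x4| = a -> `|dotp x4 x1| = a -> gram12 X.
Proof.
move=> a0 b0 c0 K sub; rewrite /= !inE !negb_or => /and4P[/and3P[n12 n13 n14] /andP[n23 n24] n34 _] h12 h23 h34 h41.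
have [[a1 b1 c1] L _] := K; rewrite !ger0_norm // in a1 b1 c1; have [_ unit _] := L.
have [X1 X2 X3 X4] : [/\ x1 \in X, x2 \in X, x3 \in X & x4 \in X].
  by split; apply: sub; rewrite !inE eqxx ?orbT.
have on (x y : V) : x \in X -> y = x \/ y = - x -> online X y by move=> xX [->|->]; rewrite ?onlineN /online xX.
have [y2 e2 d12] := orient_to x1 x2.
have [y3 e3 d23] := orient_to y2 x3.
have [y4 e4 d34] := orient_to y3 x4.
have abs (x y x' y' : V) : x = x' \/ x = - x' -> y = y' \/ y = - y' -> `|dotp x y| = `|dotp x' y'|.
  by case=> -> [] ->; rewrite ?dotNl ?dotNr ?normrN.
have uo (x y : V) : x \in X -> y = x \/ y = - x -> dotp y y = 1.
  by move=> xX [->|->]; rewrite ?dotNl ?dotNr ?opprK unit.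
rewrite h12 in d12; rewrite (abs _ _ _ _ e2 (or_introl (erefl x3))) h23 in d23.
rewrite (abs _ _ _ _ e3 (or_introl (erefl x4))) h34 in d34.
have d41 : `|dotp y4 x1| = a by rewrite (abs _ _ _ _ e4 (or_introl (erefl x1))).
have lab (x y : V) : `|dotp x y| \in [:: `|a|; `|b|; `|c|] -> exists l, dotp x y = lval a b c l.
  rewrite (ger0_norm a0) (ger0_norm b0) (ger0_norm c0) => /in3P[]; case: (ger0P (dotp x y)) => _ e.
  - by exists La.
  - by exists Na; rewrite /= -e opprK.
  - by exists Lb.
  - by exists Nb; rewrite /= -e opprK.
  - by exists Lc.
  - by exists Nc; rewrite /= -e opprK.
have v13 : `|dotp x1 y3| \in [:: `|a|; `|b|; `|c|].
  by rewrite (abs _ _ _ _ (or_introl (erefl x1)) e3); case: L => _ _; apply.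
have v24 : `|dotp y2 y4| \in [:: `|a|; `|b|; `|c|].
  by rewrite (abs _ _ _ _ e2 e4); case: L => _ _; apply.
have lt t : t \in [:: `|a|; `|b|; `|c|] -> t < 1 by rewrite (ger0_norm a0) (ger0_norm b0) (ger0_norm c0) => /in3P[] ->.
have ok sg : dotp y4 x1 = (if sg then a else - a) -> has_cycle sg a (dotp x1 y3) (dotp y2 y4).
  move=> d; exists x1, y2, y3, y4; split.
    by split=> //; [exact: unit|exact: uo X2 e2|exact: uo X3 e3|exact: uo X4 e4|exact: lt|exact: lt].
  by split; [exact: on X1 (or_introl erefl)|exact: on X2 e2|exact: on X3 e3|exact: on X4 e4].
move: d41; case: (ger0P (dotp y4 x1)) => _ d.
  exact: (balanced_case a0 b0 c0 K (lab _ _ v13) (lab _ _ v24) (ok true d)).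
have d' : dotp y4 x1 = - a by rewrite -d opprK.
by case: (unbalanced_case a0 b0 c0 K (lab _ _ v13) (lab _ _ v24) (ok false d')).
Qed.

Lemma classification p q r : 0 <= p < 1 -> 0 <= q < 1 -> 0 <= r < 1 -> lineset p q r X ->
  attained p X -> attained q X -> attained r X -> gram12 X.
Proof.
move=> p01 q01 r01 L Ap Aq Ar; have [uX _ hL] := L.
case/andP: (p01) => p0 p1; case/andP: (q01) => q0 q1; case/andP: (r01) => r0 r1.
have K : conf p q r by split; rewrite ?ger0_norm.
(* Only the first twelve lines are coloured; the size of [X] comes out of the exceptional case. *)
pose e (i : 'I_12) : V := nth 0 X i.
pose k i j : 'I_3 := if `|dotp (e i) (e j)| == p then 0 else if `|dotp (e i) (e j)| == q then 1 else 2%:R.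
have ksym i j : k i j = k j i by rewrite /k dotC.
have [x1 [x2 [x3 [x4 [i [u k12 k23 k34 k41]]]]]] := monochromatic_C4 ksym (card_ord 12).
have lt12 (j : 'I_12) : (j < size X)%N by exact: leq_trans (ltn_ord j) X12.
have einj j j' : (e j == e j') = (j == j') by rewrite nth_uniq.
have eX j : e j \in X by exact: mem_nth.
pose val (j : 'I_3) := nth 0 [:: p; q; r] j.
have kv j j' : j != j' -> `|dotp (e j) (e j')| = val (k j j').
  move=> jj'; have := hL _ _ (eX j) (eX j'); rewrite einj => /(_ jj').
  by rewrite !inE /k /val; case: eqP => [->|_] //=; case: eqP => [->|_] //= /eqP.
have ux : uniq (map e [:: x1; x2; x3; x4]) by rewrite map_inj_uniq // => j j' /eqP; rewrite einj => /eqP.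
have sx : {subset map e [:: x1; x2; x3; x4] <= X} by move=> _ /mapP[j _ ->].
move: (u); rewrite /= !inE !negb_or => /and4P[/and3P[n12 n13 n14] /andP[n23 n24] n34 _].
rewrite eq_sym in n14; have h12 := kv _ _ n12; have h23 := kv _ _ n23; have h34 := kv _ _ n34; have h41 := kv _ _ n14.
rewrite k12 in h12; rewrite k23 in h23; rewrite k34 in h34; rewrite k41 in h41.
have [b [c [v0 b0 c0 K']]] : exists b c, [/\ 0 <= val i, 0 <= b, 0 <= c & conf (val i) b c].
  move: (i) => [[|[|[|//]]] hi]; rewrite /val /=.
  - by exists q, r.
  - exists p, r; split=> //; move: K => [[h1 h2 h3] L' [A1' A2' A3']]; split=> //.
    by apply: lineset_perm L'; rewrite (perm_catCA [:: `|p|] [:: `|q|] [:: `|r|]).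
  - exists p, q; split=> //; move: K => [[h1 h2 h3] L' [A1' A2' A3']]; split=> //.
    by apply: lineset_perm L'; rewrite (perm_catCA [:: `|p|; `|q|] [:: `|r|] [::]).
exact: (four_cycle v0 b0 c0 K' sx ux h12 h23 h34 h41).
Qed.

End Classification.

(** * Vertices of a convex hull *)

Section Hull.
Variables (R : realType).
Notation V := 'rV[R]_3.
Implicit Types (S : set V) (x y v : V).

Lemma convE (l : {i01 R}) (x y : convex_lmodType V) :
  conv l x y = l%:num *: (x : V) + (1 - l%:num) *: (y : V) :> V.
Proof. by []. Qed.

Lemma hull_conv S (l : {i01 R}) x y : convex_hull S x -> convex_hull S y ->
  convex_hull S (l%:num *: x + (1 - l%:num) *: y).
Proof.
move=> hx hy A [cA SA]; have := cA x y l; rewrite !inE convE; apply; [exact: hx|exact: hy].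
Qed.

(** If an extreme point lies outside S, the hull without it is still convex and contains S. *)
Lemma vertices_sub S : (vertices (convex_hull S) `<=` S)%classic.
Proof.
move=> p [hp ext]; apply: contrapT => Sp.
pose B : set V := [set x | convex_hull S x /\ x <> p]%classic.
suff /(_ p hp)[_ []] : (convex_hull S `<=` B)%classic by [].
apply: smallest_sub => [x y l|x Sx]; last first.
  split; first by move=> A [_]; apply.
  by move=> e; apply: Sp; rewrite -e.
rewrite !inE convE => -[hx xp] [hy yp]; split; first exact: hull_conv.
move=> e; have l0 : 0 <= l%:num by [].
have l1 : l%:num <= 1 by [].
have [z0|n0] := eqVneq l%:num 0; first by move: e; rewrite z0 scale0r add0r subr0 scale1r.
have [z1|n1] := eqVneq l%:num 1; first by move: e; rewrite z1 scale1r subrr scale0r addr0.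
have l01 : 0 < l%:num < 1 by rewrite lt_neqAle eq_sym n0 l0 lt_neqAle n1.
have xy := ext x y _ hx hy l01 (esym e).
by move: e; rewrite xy -scalerDl addrC subrK scale1r.
Qed.

Lemma dot_conv (t : R) x y : dotp (t *: x + (1 - t) *: y) (t *: x + (1 - t) *: y) =
  t * dotp x x + (1 - t) * dotp y y - t * (1 - t) * dotp (x - y) (x - y).
Proof. by rewrite !dot_lin (dotC y x); ring. Qed.

(** The hull lies in the ball, and by [dot_conv] a proper combination of two distinct points of the
    ball lies strictly inside. *)
Lemma vertices_sphere S (n : R) : (forall x, S x -> dotp x x = n) -> vertices (convex_hull S) = S.
Proof.
move=> hS; apply/seteqP; split; first exact: vertices_sub.
have ball x : convex_hull S x -> dotp x x <= n.
  apply: (@smallest_sub _ _ _ [set x : V | dotp x x <= n]%classic) => [y z l|y /hS h]; last by rewrite /= h.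
  rewrite !inE convE => hy hz /=; rewrite dot_conv.
  have l0 : 0 <= l%:num by [].
  have l1 : l%:num <= 1 by [].
  have := mulr_ge0 (mulr_ge0 l0 (_ : 0 <= 1 - l%:num)) (dot_ge0 (y - z)); rewrite subr_ge0 => /(_ l1).
  have := ler_wpM2l l0 hy; have := @ler_wpM2l _ (1 - l%:num) _ _ _ hz; rewrite subr_ge0 => /(_ l1).
  move: (_ * (1 - _) * dotp _ _) (_ * dotp y y) (_ * dotp z z) => p q r; lra.
move=> v Sv; split; first by move=> A [_]; apply.
move=> x y t hx hy /andP[t0 t1] e; apply/eqP; rewrite -subr_eq0; apply/eqP/dot_eq0/eqP.
rewrite eq_le dot_ge0 andbT -(pmulr_rle0 _ (_ : 0 < t * (1 - t))) ?mulr_gt0 ?subr_gt0 //.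
have := dot_conv t x y; rewrite -e (hS _ Sv) => h.
have := ler_wpM2l (ltW t0) (ball _ hx); have := @ler_wpM2l _ (1 - t) _ _ _ (ball _ hy).
rewrite subr_ge0 => /(_ (ltW t1)); move: h.
move: (t * (1 - t) * dotp _ _) (t * dotp _ _) ((1 - t) * dotp _ _) => p q r; lra.
Qed.

End Hull.

(** * Explicit directions and the values of alpha, beta, gamma *)

Section Octahedral.
Variables (R : realType) (t : R).
Notation V := 'rV[R]_3.
Hypothesis tt : t ^+ 2 = 2.

(* The coordinate equal to +-(t - 1) and the signs of the coordinates, for
   the twelve directions in the order of the matrix C. *)
Definition directions : seq (nat * seq bool) :=
  let o := false in let i := true in
  [:: (0, [:: o; o; o]); (0, [:: i; o; i]); (1, [:: o; o; i]); (0, [:: i; i; o]);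
      (2, [:: o; i; o]); (1, [:: i; o; o]); (2, [:: i; o; o]); (2, [:: o; o; i]);
      (1, [:: o; i; o]); (0, [:: o; i; i]); (2, [:: i; i; i]); (1, [:: i; i; i])]%N.

Definition direction (n : nat) : V :=
  let: (k, s) := nth (0, [::])%N directions n in
  \row_(j < 3) ((-1) ^+ nth false s j * (if j == k :> nat then t - 1 else 1)).

Lemma Cmx_Cpat (a b g : R) (i j : 'I_12) :
  Cmx a b g i j = if i == j then 1 else lval a b g (nth La (nth [::] Cpat i) j).
Proof.
rewrite mxE -val_eqE; case: i j => [i hi] [j hj] /=.
by move: i hi; do 12 (case=> [_|]; first by move: j hj; do 12 (case=> [_|] //)).
Qed.

Lemma direction_dot i j : (i < 12)%N -> (j < 12)%N -> dotp (direction i) (direction j) =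
  if i == j then 5 - 2 * t else lval (2 * t - 3) 1 (1 - 2 * t) (nth La (nth [::] Cpat i) j).
Proof.
move: tt; rewrite expr2 dotE => t2.
by move: i; do 12 (case=> [_|]; first by move: j; do 12 (case=> [_|];
  first by rewrite /direction /= !mxE /= ?expr0 ?expr1; lra)).
Qed.

End Octahedral.

(** a = b would force a = 1, so the second equation gives g = -1 - 2 a. The third then gives b = (1
    + a) / 2 and the last 17 a^2 + 14 a + 1 = 0, so that t = (17 a + 7) / 4 has square 2. *)
Lemma Cmx_roots (R : realType) (a b g : R) : `|a| < 1 -> `|g| < 1 -> (1 + g) * (1 + g) = 4 * a ^+ 2 ->
  (1 + g) * (b - a) = 2 * a * (a - b) -> (1 + g) * (b + g) = 2 * a * (a + b) ->
  2 * (1 + g) * (1 - g) * (1 - g) = (2 * b) ^+ 2 * (1 + g) * (1 - g) + (2 * g) ^+ 2 * (1 + g) * (1 - g) ->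
  exists t, [/\ t ^+ 2 = 2, a = (- 7 + 4 * t) / 17, b = (5 + 2 * t) / 17 & g = (- 3 - 8 * t) / 17].
Proof.
rewrite !ltr_norml => /andP[a1 a2] /andP[g1 g2] e0 e1 e2 e3.
have pg : 1 + g != 0 by apply: lt0r_neq0; lra.
have mg : 1 - g != 0 by apply: lt0r_neq0; lra.
have ab : b - a != 0.
  rewrite subr_eq0; apply/eqP => ba; suff : a = 1 by lra.
  suff : a + g = 1 + g by lra.
  by apply: (mulfI pg); rewrite e0 -{1}ba e2 ba; ring.
have ga : 1 + g = - 2 * a by apply: (mulIf ab); rewrite e1; ring.
have a0 : a != 0 by apply: contraNneq pg => a0; rewrite ga a0 mulr0.
have ba : b = (1 + a) / 2.
  have two : (2 : R) != 0 by rewrite pnatr_eq0.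
  have : b + g = - (a + b) by apply: (mulfI a0); apply: (mulfI two); move: e2; rewrite ga; lra.
  by lra.
have q : 17 * a ^+ 2 + 14 * a + 1 = 0.
  have : 2 * (1 - g) = (2 * b) ^+ 2 + (2 * g) ^+ 2.
    apply: (mulfI pg); apply: (mulfI mg); transitivity (2 * (1 + g) * (1 - g) * (1 - g)); first ring.
    by rewrite e3; ring.
  have -> : g = -1 - 2 * a by lra.
  by rewrite ba !expr2; lra.
have -> : g = -1 - 2 * a by lra.
exists ((17 * a + 7) / 4); split; [|by field|by rewrite ba; field|by field].
transitivity ((17 * (17 * a ^+ 2 + 14 * a + 1) + 32) / 16); first by field.
rewrite q; by field.
Qed.

(** * The Gram matrix determines the system *)

Section Isometry.
Variable R : realType.
Notation V := 'rV[R]_3.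

Lemma dotp_mx (x y : V) : dotp x y = (x *m y^T) 0 0.
Proof. by rewrite mxE; apply: eq_bigr => i _; rewrite mxE. Qed.

Lemma dotp_orth (Q : 'M[R]_3) (x y : V) : Q *m Q^T = 1%:M -> dotp (x *m Q) (y *m Q) = dotp x y.
Proof. by move=> h; rewrite !dotp_mx trmx_mul mulmxA -(mulmxA x) h mulmx1. Qed.

Lemma orthonormal_isometry (u u' : 'I_3 -> V) :
  (forall i j, dotp (u i) (u j) = (i == j)%:R) -> (forall i j, dotp (u' i) (u' j) = (i == j)%:R) ->
  exists2 Q : 'M[R]_3, Q *m Q^T = 1%:M &
    forall x x', (forall i, dotp x (u i) = dotp x' (u' i)) -> x *m Q = x'.
Proof.
move=> hu hu'; pose M := \matrix_(i < 3) u i; pose M' := \matrix_(i < 3) u' i.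
have gram (w : 'I_3 -> V) : (forall i j, dotp (w i) (w j) = (i == j)%:R) ->
    (\matrix_(i < 3) w i) *m (\matrix_(i < 3) w i)^T = 1%:M.
  move=> hw; apply/matrixP => i j; rewrite !mxE -hw; apply: eq_bigr => k _; by rewrite !mxE.
have co (w : 'I_3 -> V) (x : V) : x *m (\matrix_(i < 3) w i)^T = \row_i dotp x (w i).
  by apply/rowP => i; rewrite !mxE; apply: eq_bigr => k _; rewrite !mxE.
exists (M^T *m M') => [|x x' h].
  by rewrite trmx_mul trmxK mulmxA -(mulmxA M^T) gram // mulmx1; apply/mulmx1C/gram.
rewrite mulmxA co (_ : \row_i _ = x' *m M'^T); last by rewrite co; apply/rowP => i; rewrite !mxE.
by rewrite -mulmxA (mulmx1C (gram _ hu')) mulmx1.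
Qed.

Lemma normalise (w : V) : 0 < dotp w w -> dotp ((Num.sqrt (dotp w w))^-1 *: w) ((Num.sqrt (dotp w w))^-1 *: w) = 1.
Proof.
move=> h; rewrite dotZl dotZr mulrA -expr2 exprVn sqr_sqrtr ?ltW // mulVf //; exact: lt0r_neq0.
Qed.

Lemma frame_isometry (s t d s' t' d' : V) : dotp s t = 0 -> dotp s d = 0 -> dotp t d = 0 ->
  dotp s' t' = 0 -> dotp s' d' = 0 -> dotp t' d' = 0 ->
  dotp s s = dotp s' s' -> dotp t t = dotp t' t' -> dotp d d = dotp d' d' ->
  0 < dotp s' s' -> 0 < dotp t' t' -> 0 < dotp d' d' ->
  exists2 Q : 'M[R]_3, Q *m Q^T = 1%:M &
    forall x x', dotp x s = dotp x' s' -> dotp x t = dotp x' t' -> dotp x d = dotp x' d' -> x *m Q = x'.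
Proof.
move=> st sd td st' sd' td' ss tt dd s0 t0 d0.
pose n (w : V) := (Num.sqrt (dotp w w))^-1 *: w.
pose u (x y z : V) (i : 'I_3) := nth 0 [:: n x; n y; n z] i.
have on (x y z : V) : dotp x y = 0 -> dotp x z = 0 -> dotp y z = 0 -> 0 < dotp x x -> 0 < dotp y y -> 0 < dotp z z ->
    forall i j, dotp (u x y z i) (u x y z j) = (i == j)%:R.
  move=> xy xz yz x0 y0 z0 [[|[|[|//]]] hi] [[|[|[|//]]] hj]; rewrite -val_eqE /u /n /= ?normalise //;
    by rewrite dotZl dotZr ?xy ?xz ?yz ?(dotC y x) ?(dotC z x) ?(dotC z y) ?xy ?xz ?yz !mulr0.
have [||Q hQ h] := @orthonormal_isometry (u s t d) (u s' t' d').
- by apply: on => //; rewrite ?ss ?tt ?dd.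
- exact: on.
exists Q => // x x' xs xt xd; apply: h => -[[|[|[|//]]] hi]; rewrite /u /= /n !dotZr ?ss ?tt ?dd; congr (_ * _) => //.
Qed.

Definition gram_of (f : nat -> V) (a b g : R) : Prop :=
  (forall i, (i < 12)%N -> dotp (f i) (f i) = 1) /\
  forall i j, (i < j < 12)%N -> dotp (f i) (f j) = lval a b g (nth La (nth [::] Cpat i) j).

Section Gram.
Variables (f : nat -> V) (a b g : R).
Hypotheses (G : gram_of f a b g) (a1 : `|a| < 1) (g1 : `|g| < 1).

(** A balanced cycle inside C with both diagonals gamma; its relations with the vectors 2, 3 and 8
    feed [Cmx_roots]. *)
Lemma gram_cycle : cycle true a g g (f 0) (f 4) (f 10) (f 1).
Proof.
have [h1 h2] := G; split=> //; rewrite ?h1 //; try by rewrite h2.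
by rewrite dotC h2.
by rewrite dotC h2.
by rewrite dotC h2.
Qed.

Lemma gram_roots : exists t, [/\ t ^+ 2 = 2, a = (- 7 + 4 * t) / 17, b = (5 + 2 * t) / 17 & g = (- 3 - 8 * t) / 17].
Proof.
have [h1 h2] := G; have C := gram_cycle.
have c i j : (i < j < 12)%N -> dotp (f j) (f i) = lval a b g (nth La (nth [::] Cpat i) j) by move=> /h2; rewrite dotC.
apply: Cmx_roots => //; first exact: balanced_eqn C.
- have := balanced_rel1 C (f 2); rewrite (h2 2 4) ?(c 1 2) ?(c 0 2) ?(h2 2 10) //= => e.
  by apply: etrans (etrans e _); ring.
- have := balanced_rel1 C (f 3); rewrite (h2 3 4) ?(c 1 3) ?(c 0 3) ?(h2 3 10) //.
- have := balanced_norm2 C (h1 8 isT); rewrite (h2 8 10) ?(c 4 8) ?(c 1 8) ?(c 0 8) //= => ->; ring.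
Qed.

End Gram.

(** f 0 + f 10, f 0 - f 10 and f 4 - f 1 form an orthogonal basis whose lengths, and whose products
    with all the vectors, are read off the Gram matrix. *)
Lemma gram_isometry (f e : nat -> V) (a b g : R) : gram_of f a b g -> gram_of e a b g -> `|g| < 1 ->
  exists2 Q : 'M[R]_3, Q *m Q^T = 1%:M & forall i, (i < 12)%N -> f i *m Q = e i.
Proof.
move=> F E g1; have CF := cycleE (gram_cycle F g1); have CE := cycleE (gram_cycle E g1).
have ij i j : (i < 12)%N -> (j < 12)%N -> dotp (f i) (f j) = dotp (e i) (e j).
  move=> i12 j12; case: F E => [h1 h2] [k1 k2]; case: (ltngtP i j) => [l|l|->]; last by rewrite h1 ?k1.
    by rewrite h2 ?k2 ?l.
  by rewrite dotC (dotC (e i)) h2 ?k2 ?l.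
have [g2 g3] : 0 < 1 + g /\ 0 < 1 - g by move: g1; rewrite ltr_norml => /andP[? ?]; split; lra.
have [||||||||||||Q hQ h] := @frame_isometry (f 0 + f 10) (f 0 - f 10) (f 4 - f 1) (e 0 + e 10) (e 0 - e 10) (e 4 - e 1).
1-12: rewrite !dot_lin ?CF ?CE; lra.
by exists Q => // i i12; apply: h; rewrite !dot_lin !ij.
Qed.

End Isometry.

(** * The model systems for t = sqrt 2 and t = - sqrt 2 *)

Section System.
Variables (R : realType) (t : R).
Notation V := 'rV[R]_3.
Hypothesis tt : t ^+ 2 = 2.
Notation al := ((- 7 + 4 * t) / 17).
Notation be := ((5 + 2 * t) / 17).
Notation ga := ((- 3 - 8 * t) / 17).
Notation N := (5 - 2 * t).

Lemma sqrt2_bounds : -3 < 2 * t < 3.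
Proof. by move: tt; rewrite expr2 => t2; apply/andP; split; rewrite ltNge; apply/negP => h; nra. Qed.

Lemma norm_gt0 : 0 < N. Proof. by case/andP: sqrt2_bounds => ? ?; lra. Qed.

Lemma gram_values : [/\ N * al = 2 * t - 3, N * be = 1 & N * ga = 1 - 2 * t].
Proof. by move: tt; rewrite expr2 => t2; split; lra. Qed.

Lemma gram_lt1 : [/\ `|al| < 1, `|be| < 1 & `|ga| < 1].
Proof.
case/andP: sqrt2_bounds => h1 h2.
by split; rewrite ltr_norml; apply/andP; split; lra.
Qed.

Definition axis (i : nat) : V := (Num.sqrt N)^-1 *: direction t i.

Lemma axis_dot i j : (i < 12)%N -> (j < 12)%N -> dotp (axis i) (axis j) =
  if i == j then 1 else lval al be ga (nth La (nth [::] Cpat i) j).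
Proof.
move=> i12 j12; have N0 := norm_gt0; have N1 : N != 0 by exact: lt0r_neq0.
rewrite dotZl dotZr mulrA -expr2 exprVn sqr_sqrtr ?ltW // direction_dot //.
apply: (mulfI N1); rewrite mulrA divff // mul1r; case: eqP => _; first by rewrite mulr1.
have [h1 h2 h3] := gram_values.
by case: (nth La _ j); rewrite /= ?mulrN ?h1 ?h2 ?h3.
Qed.

Lemma axis_gram : gram_of axis al be ga.
Proof.
split=> [i i12|i j /andP[ij j12]]; first by rewrite axis_dot ?eqxx.
by rewrite axis_dot ?(ltn_trans ij) // (ltn_eqF ij).
Qed.

Lemma lval_lt1 l : `|lval al be ga l| < 1.
Proof. by have [? ? ?] := gram_lt1; case: l => /=; rewrite ?normrN. Qed.

Lemma axis_inj i j : (i < 12)%N -> (j < 12)%N -> axis i = axis j -> i = j.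
Proof.
move=> i12 j12 e; apply/eqP/negPn/negP => ij; have := axis_dot i12 j12; rewrite (negPf ij) e axis_dot // eqxx => h.
by have := lval_lt1 (nth La (nth [::] Cpat i) j); rewrite -h normr1 ltxx.
Qed.

Definition system : {fset V} := [fset x in [seq axis i | i <- iota 0 12]]%fset.

Lemma systemP x : reflect (exists2 i, (i < 12)%N & x = axis i) (x \in system).
Proof.
have -> : (x \in system) = (x \in [seq axis i | i <- iota 0 12]) by rewrite in_fset.
apply: (iffP mapP) => [[i + ->]|[i i12 ->]]; first by rewrite mem_iota => i12; exists i.
by exists i; rewrite ?mem_iota.
Qed.

Lemma system_card : #|` system| = 12%N.
Proof.
rewrite card_fseq undup_id ?size_map ?size_iota // map_inj_in_uniq ?iota_uniq //.
by move=> i j; rewrite !mem_iota; exact: axis_inj.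
Qed.

Lemma system_dot x y : x \in system -> y \in system -> x != y -> exists l, dotp x y = lval al be ga l.
Proof.
move=> /systemP[i i12 ->] /systemP[j j12 ->] xy; exists (nth La (nth [::] Cpat i) j).
have ij : i != j by apply: contraNneq xy => ->.
by rewrite axis_dot // (negPf ij).
Qed.

Lemma inner_productsP (X : {fset V}) c : reflect (exists x y, [/\ x \in X, y \in X, x != y & c = dotp x y])
  (c \in inner_products X).
Proof.
apply: (iffP (imfsetP _ _ _ _)) => [[[x y]]|[x [y [xX yX xy ->]]]] /=.
  by rewrite !inE /= => /andP[/andP[xX yX] xy] ->; exists x, y.
by exists (x, y); rewrite // !inE /= xX yX.
Qed.

Lemma system_angular : angular_lines 3 system.
Proof.
split.
- by move=> _ /systemP[i i12 ->]; rewrite axis_dot ?eqxx.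
- apply/negP => /inner_productsP[x [y [xX yX xy]]]; have [l ->] := system_dot xX yX xy => h.
  by have := lval_lt1 l; rewrite -h normrN normr1 ltxx.
have sub : ([fset a ^+ 2 | a in inner_products system] `<=` [fset al ^+ 2; be ^+ 2; ga ^+ 2])%fset.
  apply/fsubsetP => _ /imfsetP[c /inner_productsP[x [y [xX yX xy ->]]] ->]; have [l ->] := system_dot xX yX xy.
  by rewrite !inE; case: l => /=; rewrite ?sqrrN eqxx ?orbT.
apply: leq_trans (fsubset_leq_card sub) _.
by rewrite !cardfsU !cardfs1; lia.
Qed.

Lemma system_gram : has_gram (Cmx al be ga) system.
Proof.
exists (fun i : 'I_12 => axis i); split.
- by move=> i j /axis_inj e; apply/val_inj/e.
- move=> x; apply/systemP/codomP => [[i i12 ->]|[i ->]]; first by exists (Ordinal i12).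
  by exists i.
by apply/matrixP => i j; rewrite Cmx_Cpat mxE axis_dot.
Qed.

(** The isometry of [gram_isometry] sends each x to an axis up to sign, and [s] corrects the sign.
    Images of distinct lines stay distinct, so equal cardinalities finish the proof. *)
Lemma isometric_system (X : {fset V}) (f : nat -> V) : #|` X| = 12%N -> gram_of f al be ga ->
  (forall x y, x \in X -> y \in X -> x != y -> `|dotp x y| < 1) -> (forall x, x \in X -> dotp x x = 1) ->
  (forall x, x \in X -> exists2 i, (i < 12)%N & x = f i \/ x = - f i) -> isometric X system.
Proof.
move=> X12 F lt1 unit cover; have [_ _ g1] := gram_lt1.
have [Q hQ fQ] := gram_isometry F axis_gram g1.
pose s (x : V) := x *m Q \notin system; exists Q, s; split=> //.
have im x : x \in X -> (-1) ^+ s x *: (x *m Q) \in system.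
  move=> /cover[i i12 e]; rewrite /s; case: (boolP (x *m Q \in system)) => n; first by rewrite expr0 scale1r.
  rewrite expr1 scaleN1r.
  have iS : axis i \in system by apply/systemP; exists i.
  by move: n; case: e => ->; rewrite ?mulNmx fQ // ?iS // opprK.
apply/esym/eqP; rewrite eqEfcard; apply/andP; split.
  by apply/fsubsetP => _ /imfsetP[x xX ->]; exact: im.
rewrite system_card card_in_imfset /= ?X12 // => x y xX yX e.
apply/eqP/negPn/negP => xy; have := lt1 x y xX yX xy.
have : `|dotp ((-1) ^+ s x *: (x *m Q)) ((-1) ^+ s y *: (y *m Q))| = `|dotp x y|.
  by rewrite dotZl dotZr dotp_orth // !normrM !normrX !normrN1 !expr1n !mul1r.
move=> <-; rewrite e dotZl dotZr dotp_orth // unit // mulr1 normrM normrX normrN1 expr1n mulr1.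
by rewrite ltxx.
Qed.

Section Diagonals.
Variables (c : R) (neg : bool).
(** In use c is |t - 1|: sqrt 2 - 1 for t = sqrt 2, and sqrt 2 + 1 with [neg] true for t = - sqrt
    2. *)
Hypothesis cE : t - 1 = (-1) ^+ neg * c.

Lemma perm_coord (p : 'S_3) (j : 'I_3) : [:: 1; 1; c]`_(p j) = if j == (p^-1)%g 2%:R then c else 1.
Proof.
have -> : (j == (p^-1)%g 2%:R) = (p j == 2%:R) by rewrite (can2_eq (permK p) (permKV p)).
by case: (p j) => [[|[|[|//]]] h].
Qed.

Lemma signed_permutationsP v : signed_permutations 1 1 c v <->
  exists (k : 'I_3) (s : 'I_3 -> bool), v = \row_j ((-1) ^+ s j * (if j == k then c else 1)).
Proof.
split=> [[p [s ->]]|[k [s ->]]].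
  by exists ((p^-1)%g 2%:R), s; apply/rowP => j; rewrite !mxE perm_coord.
by exists (tperm k 2%:R), s; apply/rowP => j; rewrite !mxE perm_coord tpermV tpermR.
Qed.

Lemma directions_lt i : (i < 12)%N -> ((nth (0, [::]) directions i).1 < 3)%N.
Proof. by do 12 (case: i => [|i] //). Qed.

Lemma directionE i : direction t i = \row_j ((-1) ^+ (nth false (nth (0, [::]) directions i).2 j (+)
   (neg && (j == (nth (0, [::]) directions i).1 :> nat))) * (if j == (nth (0, [::]) directions i).1 :> nat then c else 1)).
Proof.
rewrite /direction; case: (nth _ _ i) => k s /=; apply/rowP => j; rewrite !mxE cE.
case: (j == k :> nat); last by rewrite andbF addbF.
by rewrite andbT signr_addb mulrA.
Qed.

Lemma directions_complete (k : nat) (b0 b1 b2 : bool) : (k < 3)%N ->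
  exists2 d, d \in directions & d.1 = k /\ (d.2 = [:: b0; b1; b2] \/ d.2 = map negb [:: b0; b1; b2]).
Proof.
move=> k3; have /hasP[d dD /andP[/eqP d1 d2]] : has (fun d => (d.1 == k) && ((d.2 == [:: b0; b1; b2]) || (d.2 == map negb [:: b0; b1; b2]))) directions.
  by move: k k3 b0 b1 b2; do 3 (case=> [|]; first by move=> _ [] [] []).
by exists d => //; split=> //; case/orP: d2 => /eqP; auto.
Qed.

Lemma signedN v : signed_permutations 1 1 c v -> signed_permutations 1 1 c (- v).
Proof.
move=> /signed_permutationsP[k [s ->]]; apply/signed_permutationsP; exists k, (fun j => ~~ s j).
by apply/rowP => j; rewrite !mxE signrN mulNr.
Qed.

Lemma direction_signed i : (i < 12)%N -> signed_permutations 1 1 c (direction t i).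
Proof.
move=> i12; apply/signed_permutationsP; rewrite directionE.
exists (Ordinal (directions_lt i12)); eexists; apply/rowP => j; rewrite !mxE -val_eqE /=.
reflexivity.
Qed.

(** By [directions_complete] each position of c and each sign pattern occurs among the directions,
    up to a global sign. *)
Lemma signed_direction v : signed_permutations 1 1 c v -> exists2 i, (i < 12)%N & v = direction t i \/ v = - direction t i.
Proof.
move=> /signed_permutationsP[k [s ->]].
pose b (j : 'I_3) := s j (+) (neg && (j == k)).
have [d dD [d1 d2]] := directions_complete (b 0) (b 1) (b 2%:R) (ltn_ord k).
have /(nthP (0%N, [::]))[i i12 di] := dD; exists i => //.
have bn (j : 'I_3) : nth false [:: b 0; b 1; b 2%:R] j = b j.
  by case: j => [[|[|[|//]]] h] /=; congr b; exact: val_inj.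
have nbn (j : 'I_3) : nth false (map negb [:: b 0; b 1; b 2%:R]) j = ~~ b j.
  by case: j => [[|[|[|//]]] h] /=; congr (~~ b _); exact: val_inj.
rewrite directionE di d1.
case: d2 => ->; [left|right]; apply/rowP => j; rewrite !mxE ?bn ?nbn /b -val_eqE.
  by rewrite -addbA addbb addbF.
by rewrite addNb -addbA addbb addbF signrN mulNr opprK.
Qed.

Lemma span_axis i : (i < 12)%N -> <[axis i]>%VS = <[direction t i]>%VS.
Proof.
move=> i12; have l0 : Num.sqrt N != 0 by rewrite lt0r_neq0 // sqrtr_gt0 norm_gt0.
apply/eqP; rewrite eqEsubv -!memvE; apply/andP; split; first by rewrite memvZ ?memv_line.
have -> : direction t i = Num.sqrt N *: axis i by rewrite scalerA divff // scale1r.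
by rewrite memvZ ?memv_line.
Qed.

Lemma spanN (v : V) : <[- v]>%VS = <[v]>%VS.
Proof. by apply/eqP; rewrite eqEsubv -!memvE memvN -[X in X \in <[- v]>%VS]opprK memvN !memv_line. Qed.

(** The signed permutations lie on a sphere, so all of them are vertices of the hull. *)
Lemma system_lines : lines system = main_diagonals (convex_hull (signed_permutations 1 1 c)).
Proof.
have sph v : signed_permutations 1 1 c v -> dotp v v = N.
  by move=> /signed_direction[i i12 [->|->]]; rewrite ?dotNl ?dotNr ?opprK direction_dot ?eqxx.
have vert := vertices_sphere sph.
apply/seteqP; split=> [l [_ /systemP[i i12 ->] ->]|l [v [hv _ ->]]].
  exists (direction t i); rewrite vert; split; [|apply: signedN|exact: span_axis]; exact: direction_signed.
rewrite vert in hv; have [i i12 vi] := signed_direction hv.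
exists (axis i); first by apply/systemP; exists i.
by rewrite span_axis //; case: vi => ->; rewrite ?spanN.
Qed.

End Diagonals.
End System.

(** * Triangular line systems *)

Section Main.
Variable R : realType.
Notation V := 'rV[R]_3.

Lemma angular_lt1 m (X : {fset V}) x y : angular_lines m X -> x \in X -> y \in X -> x != y -> `|dotp x y| < 1.
Proof.
move=> [unit n1 _] xX yX xy.
have h1 : dotp x y != -1 by apply: contraNneq n1 => <-; apply/inner_productsP; exists x, y.
have h2 : dotp (x - y) (x - y) = 2 * (1 - dotp x y) by rewrite !dot_lin !unit // (dotC y x); ring.
have h3 : dotp (x + y) (x + y) = 2 * (1 + dotp x y) by rewrite !dot_lin !unit // (dotC y x); ring.
have h4 : dotp (x - y) (x - y) != 0 by apply: contraNneq xy => /dot_eq0/eqP; rewrite subr_eq0.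
have h5 : 0 < dotp (x - y) (x - y) by rewrite lt_def h4 dot_ge0.
have h6 := dot_ge0 (x + y); rewrite h2 in h5; rewrite h3 in h6.
rewrite ltr_norml lt_neqAle eq_sym h1 /=; apply/andP; split; lra.
Qed.

Lemma angular_lineset (X : {fset V}) : angular_lines 3 X -> (1 < #|` X|)%N ->
  exists p q r, [/\ [/\ 0 <= p < 1, 0 <= q < 1 & 0 <= r < 1], lineset p q r (enum_fset X)
    & [/\ attained p (enum_fset X), attained q (enum_fset X) & attained r (enum_fset X)]].
Proof.
move=> A X1; have [unit _ card] := A; have lt1 := angular_lt1 A.
set S := [fset a ^+ 2 | a in inner_products X]%fset in card.
have SP c : reflect (exists x y, [/\ x \in X, y \in X, x != y & c = dotp x y ^+ 2]) (c \in S).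
  apply: (iffP (imfsetP _ _ _ _)) => [[a /inner_productsP[x [y [xX yX xy ->]]] ->]|[x [y [xX yX xy ->]]]].
    by exists x, y.
  by exists (dotp x y); rewrite //; apply/inner_productsP; exists x, y.
have [x0 [y0 [x0X y0X xy0]]] : exists x y, [/\ x \in X, y \in X & x != y].
  have : uniq (enum_fset X) by exact: fset_uniq.
  have := X1; rewrite cardfE -cardfE; have mE x : x \in enum_fset X -> x \in X by [].
  case: (enum_fset X) mE => [|x [|y s]] mE //= _; rewrite inE negb_or => /andP[/andP[xy _] _].
  by exists x, y; split=> //; apply: mE; rewrite !inE eqxx ?orbT.
pose s0 := dotp x0 y0 ^+ 2; have s0S : s0 \in S by apply/SP; exists x0, y0.
(* If fewer than three squares occur, the default [s0] repeats one of them, so that all three values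
   are attained. *)
pose v k := Num.sqrt (nth s0 (enum_fset S) k).
have vS k : nth s0 (enum_fset S) k \in S.
  have [h|h] := ltnP k (size (enum_fset S)); first exact: mem_nth.
  by rewrite nth_default.
have att k : attained (v k) (enum_fset X).
  by have [x [y [xX yX xy e]]] := SP _ (vS k); exists x, y; split=> //; rewrite /v e sqrtr_sqr.
have v01 k : 0 <= v k < 1.
  by have [x [y [xX yX xy <-]]] := att k; rewrite normr_ge0 lt1.
exists (v 0), (v 1), (v 2); split=> //; split=> //; first exact: fset_uniq.
move=> x y xX yX xy.
have cS : dotp x y ^+ 2 \in S by apply/SP; exists x, y.
have : (index (dotp x y ^+ 2) (enum_fset S) < 3)%N by apply: leq_trans card; rewrite index_mem.
have : v (index (dotp x y ^+ 2) (enum_fset S)) = `|dotp x y| by rewrite /v nth_index // sqrtr_sqr.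
by case: (index _ _) => [|[|[|//]]] <- _; rewrite !inE eqxx ?orbT.
Qed.

Lemma triangular_lines (X : {fset V}) : angular_lines 3 X -> (11 < #|` X|)%N ->
  #|` X| = 12%N /\ exists t, t ^+ 2 = 2 /\ isometric X (system t).
Proof.
move=> A X12; have [p [q [r [[p01 q01 r01] L [Ap Aq Ar]]]]] := angular_lineset A (ltn_trans (isT : 1 < 11)%N X12).
have [f [a [b [g [[X12' [a1 b1 g1]] unit gram cover]]]]] := classification X12 p01 q01 r01 L Ap Aq Ar.
have F : gram_of f a b g by split.
have [t [tt aE bE gE]] := gram_roots F a1 g1; split=> //; exists t; split=> //.
rewrite aE bE gE in F; have [u _ _] := A.
by apply: (isometric_system tt X12' F) => // x y; exact: angular_lt1 A.
Qed.

(** For t = sqrt 2 the vectors 0 and 9 have product (-3 - 8 t) / 17, about -0.84, which exceeds in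
    absolute value every product of distinct vectors in the other system. *)
Lemma not_isometric (t : R) : 0 <= t -> t ^+ 2 = 2 -> ~ isometric (system t) (system (- t)).
Proof.
move=> t0 tt [Q [s [hQ E]]]; have tt' : (- t) ^+ 2 = 2 by rewrite sqrrN.
have [_ _ g1] := gram_lt1 tt.
pose h (x : V) := (-1) ^+ s x *: (x *m Q).
have hS i : (i < 12)%N -> h (axis t i) \in system (- t).
  by move=> i12; rewrite E; apply/imfsetP; exists (axis t i) => //; apply/systemP; exists i.
have hd x y : `|dotp (h x) (h y)| = `|dotp x y|.
  by rewrite /h dotZl dotZr dotp_orth // !normrM !normrX !normrN1 !expr1n !mul1r.
have := hd (axis t 0) (axis t 9); rewrite (axis_dot tt) //= => e.
have [xy|xy] := eqVneq (h (axis t 0)) (h (axis t 9)).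
  have /systemP[i i12 xi] := hS 0%N isT.
  by rewrite -xy xi (axis_dot tt') // eqxx normr1 in e; rewrite -e ltxx in g1.
have [l hl] := system_dot tt' (hS 0%N isT) (hS 9 isT) xy; rewrite hl in e.
have {e} : lval ((- 7 + 4 * (- t)) / 17) ((5 + 2 * (- t)) / 17) ((- 3 - 8 * (- t)) / 17) l ^+ 2 = ((- 3 - 8 * t) / 17) ^+ 2.
  by rewrite -[LHS]real_normK ?num_real // e real_normK ?num_real.
have /andP[_ hi] := sqrt2_bounds tt.
have lo : 7 < 5 * t.
  by rewrite ltNge; apply/negP => le; have := mulr_ge0 t0 (_ : 0 <= 7 - 5 * t); rewrite subr_ge0 => /(_ le); move: tt; rewrite expr2; lra.
move: tt; rewrite !expr2 => tt0.
case: l {hl} => /=; lra.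
Qed.

End Main.

Theorem theorem5p1 (R : realType) :
  (forall X : {fset 'rV[R]_3}, angular_lines 3 X -> (#|` X| <= 12)%N) /\
  exists X1 X2 : {fset 'rV[R]_3},
    [/\ angular_lines 3 X1 /\ #|` X1| = 12%N,
        angular_lines 3 X2 /\ #|` X2| = 12%N,
        ~ isometric X1 X2 /\
        (forall X : {fset 'rV[R]_3}, angular_lines 3 X -> #|` X| = 12%N ->
           isometric X X1 \/ isometric X X2),
        has_gram (Cmx ((- 7 + 4 * Num.sqrt 2) / 17) ((5 + 2 * Num.sqrt 2) / 17)
                      ((- 3 - 8 * Num.sqrt 2) / 17)) X1 /\
        lines X1 = main_diagonals (truncated_cube R)
      & has_gram (Cmx ((- 7 - 4 * Num.sqrt 2) / 17) ((5 - 2 * Num.sqrt 2) / 17)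
                      ((- 3 + 8 * Num.sqrt 2) / 17)) X2 /\
        lines X2 = main_diagonals (small_rhombicuboctahedron R)].
Proof.
split=> [X A|].
  rewrite leqNgt; apply/negP => X13; have [X12 _] := triangular_lines A (ltnW X13).
  by rewrite X12 ltnn in X13.
have tt : (Num.sqrt 2 : R) ^+ 2 = 2 by rewrite sqr_sqrtr.
have tt' : (- Num.sqrt 2 : R) ^+ 2 = 2 by rewrite sqrrN.
exists (system (Num.sqrt 2)), (system (- Num.sqrt 2)); split.
- by split; [exact: system_angular|exact: system_card].
- by split; [exact: system_angular|exact: system_card].
- split=> [|X A X12]; first by apply: not_isometric; rewrite ?sqrtr_ge0.
  have [_ [t [t2 iso]]] := triangular_lines A (eq_leq (esym X12)).
  have /eqP : t ^+ 2 = Num.sqrt 2 ^+ 2 by rewrite t2 tt.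
  by rewrite eqf_sqr => /orP[]/eqP <-; [left|right; rewrite -?[- t]opprK].
- split; first exact: system_gram.
  by apply: (@system_lines _ _ tt _ false); rewrite mul1r.
- split.
    by have := system_gram tt'; rewrite !mulrN opprK.
  by apply: (@system_lines _ _ tt' _ true); rewrite mulN1r opprD.
Qed.
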